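(* Let $\mu$ be a PW-sampling measure, $t>0$, let $k_t$ be the reproducing kernel at $0$ of $\mathrm{PW}_t(\mu)$, and let $\psi_t=\hat k_t$ be the Fourier transform of $k_t|_{\mathbb R}\in L^2(\mathbb R)$. Then $\psi_t=0$ a.e. on $\mathbb R\setminus[-t,t]$, and the distribution $\psi_t*\hat\mu$ coincides with the constant function $1$ on $(-t,t)$. Moreover $k_t(0)=\frac1{\sqrt{2\pi}}\int_{\mathbb R}\psi_t$.
   Context: Fourier transform convention: $\hat f(\xi)=(2\pi)^{-1/2}\int e^{-i\xi x}f(x)\,dx$, extended to $L^2(\mathbb R)$ and (for the $\Pi$-finite measure $\mu$) to tempered distributions. $\mathrm{PW}_t$: entire functions of exponential type at most $t$ in $L^2(\mathbb R)$, with the $L^2(\mathbb R)$ inner product. $\mu$ (positive measure on $\mathbb R$) is PW-sampling if for every $a>0$ there is $C>0$ with $C^{-1}\|f\|_{L^2(\mathbb R)}\le\|f\|_{L^2(\mu)}\le C\|f\|_{L^2(\mathbb R)}$ for all $f\in\mathrm{PW}_a$; such $\mu$ satisfy $\int d\mu/(1+x^2)<\infty$. $\mathrm{PW}_t(\mu)$ denotes $\mathrm{PW}_t$ with the $L^2(\mu)$ inner product, and $k_t\in\mathrm{PW}_t$ is defined by $f(0)=\int f\bar k_t\,d\mu$ for all $f\in\mathrm{PW}_t$. *)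

(* Defs.v *)
From mathcomp Require Import all_boot all_order all_algebra.
From mathcomp Require Import complex.
From mathcomp Require Import all_classical all_reals all_analysis.
Import numFieldNormedType.Exports.
Import Order.TTheory GRing.Theory Num.Theory.

Set Implicit Arguments.
Unset Strict Implicit.
Unset Printing Implicit Defensive.

Local Open Scope ring_scope.
Local Open Scope complex_scope.
Local Open Scope classical_set_scope.

Section PW.
Variable R : realType.

(* modulus of a complex number, as a real number *)
Definition cabs (z : R[i]) : R := Normc.normc z.

(* the Lebesgue measure on the Borel sets of R *)
Definition leb := (@lebesgue_measure R).

(* integral over D of a complex-valued function, via real and imaginary parts *)
Definition CInt (mu : {measure set (measurableTypeR R) -> \bar R})
  (D : set R) (g : R -> R[i]) : R[i] :=
  (Rintegral mu D (fun x => complex.Re (g x)))%:C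
  + 'i * (Rintegral mu D (fun x => complex.Im (g x)))%:C.

(* measurability of a complex-valued function on R *)
Definition cmeasurable (g : R -> R[i]) : Prop :=
  measurable_fun setT (fun x => complex.Re (g x)) /\ measurable_fun setT (fun x => complex.Im (g x)).

(* L^2(mu)-norm of a complex-valued function on R *)
Definition L2norm (mu : {measure set (measurableTypeR R) -> \bar R})
  (g : R -> R[i]) : \bar R :=
  Lnorm mu 2%:E (fun x => (cabs (g x))%:E).

(* g belongs to L^2(R) (Lebesgue) *)
Definition inL2 (g : R -> R[i]) : Prop :=
  cmeasurable g /\ (L2norm leb g < +oo)%E.

(* entire function: complex differentiable at every point of C *)
Definition entire (f : R[i] -> R[i]) : Prop :=
  forall z : R[i], derivable (f : R[i]^o -> R[i]^o) z 1.

(* exponential type at most t *)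
Definition exp_type_le (t : R) (f : R[i] -> R[i]) : Prop :=
  forall eps : R, 0 < eps ->
    exists M : R, forall z : R[i], cabs (f z) <= M * expR ((t + eps) * cabs z).

(* restriction to the real line *)
Definition onR (f : R[i] -> R[i]) : R -> R[i] := fun x => f x%:C.

(* Paley-Wiener space PW_t *)
Definition PW (t : R) (f : R[i] -> R[i]) : Prop :=
  entire f /\ exp_type_le t f /\ inL2 (onR f).

(* PW-sampling measure *)
Definition PW_sampling (mu : {measure set (measurableTypeR R) -> \bar R}) : Prop :=
  forall a : R, 0 < a -> exists C : R, 0 < C /\
    forall f, PW a f ->
      ((C^-1)%:E * L2norm leb (onR f) <= L2norm mu (onR f))%E /\
      (L2norm mu (onR f) <= C%:E * L2norm leb (onR f))%E.

(* k is the reproducing kernel at 0 of PW_t(mu) *)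
Definition repr_kernel0 (mu : {measure set (measurableTypeR R) -> \bar R})
  (t : R) (k : R[i] -> R[i]) : Prop :=
  PW t k /\ forall f, PW t f -> f 0 = CInt mu setT (fun x => onR f x * (onR k x)^*).

(* e^{-i xi x} *)
Definition cexpm (xi x : R) : R[i] := (cos (xi * x)) -i* (sin (xi * x)).

Definition invsqrt2pi : R[i] := ((Num.sqrt (2 * pi))^-1)%:C.

(* (2 pi)^{-1/2} \int_D e^{-i xi x} g(x) dx *)
Definition FT_on (D : set R) (g : R -> R[i]) (xi : R) : R[i] :=
  invsqrt2pi * CInt leb D (fun x => cexpm xi x * g x).

(* Fourier transform (integral formula, for integrable g) *)
Definition FT (g : R -> R[i]) : R -> R[i] := FT_on setT g.

(* psi is the L^2(R) (Plancherel) Fourier transform of g in L^2(R):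
   the L^2-limit of the truncated transforms over [-N, N] *)
Definition L2_fourier (g psi : R -> R[i]) : Prop :=
  inL2 psi /\
  (fun N : nat =>
     (\int[leb]_xi ((cabs (psi xi - FT_on `[- (N%:R), N%:R] g xi)) ^+ 2)%:E)%E)
    @ \oo --> 0%:E.

(* test functions: smooth (real and imaginary parts), support compact in (-t,t) *)
Definition smoothR (h : R -> R) : Prop :=
  forall (n : nat) (x : R), derivable (derive1n n h) x 1.

Definition test_fun_in (t : R) (phi : R -> R[i]) : Prop :=
  smoothR (fun x => complex.Re (phi x)) /\ smoothR (fun x => complex.Im (phi x)) /\
  exists a : R, a < t /\ forall x : R, a < `|x| -> phi x = 0.

(* pairing <psi * hat mu, phi> := <hat mu, psi~ * phi> := \int hat(psi~ * phi) dmu,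
   where (psi~ * phi)(x) = \int psi(y) phi(x + y) dy *)
Definition conv_refl (psi phi : R -> R[i]) : R -> R[i] :=
  fun x => CInt leb setT (fun y => psi y * phi (x + y)).

Definition pair_conv_FTmeasure (mu : {measure set (measurableTypeR R) -> \bar R})
  (psi phi : R -> R[i]) : R[i] :=
  CInt mu setT (FT (conv_refl psi phi)).

End PW.

(* Main.v *)
Require Import Defs.
From HB Require Import structures.
From mathcomp Require Import all_boot all_order all_algebra.
From mathcomp Require Import complex.
From mathcomp Require Import all_classical all_reals all_analysis.
From mathcomp Require Import measurable_realfun.
From mathcomp Require Import ring lra.
Import numFieldNormedType.Exports.
Import Order.TTheory GRing.Theory Num.Theory.
Local Open Scope ring_scope.
Local Open Scope complex_scope.
Local Open Scope classical_set_scope.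
Set Implicit Arguments.
Unset Strict Implicit.
Unset Printing Implicit Defensive.

(* Support of psi.  Let q be the entire extension of the Fourier transform of the indicator of
   [a, b] with a > t.  On the real line k q is a product of two square integrable functions, hence
   integrable, and it decays exponentially on the negative imaginary axis.  Rotating both half lines
   of R onto that axis (Cauchy's theorem in the coordinate w = log z, with a damping factor of order
   3/2 that beats the exponential type) shows that k q has integral zero over R.  The multiplication
   formula turns this into the vanishing of the integral of psi over [a, b], so psi = 0 almost
   everywhere to the right of t, and symmetrically to the left of -t.

   Convolution.  As psi is now square integrable with bounded support, it is integrable, and Abel
   summation with e^{-eps|xi|}, whose transform is the Poisson kernel, gives the pointwise inversion
   k(x) = (2 pi)^{-1/2} int psi(xi) e^{ix xi} dxi; x = 0 is the last claim.  For a test function phi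
   supported in (-t, t), Fubini and inversion identify the transform of psi~ * phi with k q, where
   q is the unnormalised transform of phi.  The function q# : z |-> conj(q(conj z)) lies in PW_t, so
   the reproducing property at q#, conjugated, says that int k q dmu = q(0) = int phi. *)

(** * Complex numbers in real coordinates, the exponential, complex differentiability *)

Section ComplexPlane.
Variable R : realType.
Implicit Types (z w : R[i]) (x y a b : R) (f g : R[i] -> R[i]).

(** The obstacle is that [k] is controlled only through its exponential type and its square
    integrability on the line: inside a quadrant no decay of [k q] is available, so the arcs of a
    quarter-circle contour cannot be estimated directly. The damping factor exp(-d (e^{i pi/4}
    z)^{3/2}) takes the place of a Phragmen-Lindelof argument. Its order must exceed 1 to beat every
    exponential type, and stay below 2 so that on a quadrant, bisected by the rotation e^{i pi/4},
    the exponent keeps a negative real part. As d tends to 0, dominated convergence asks for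
    integrability on the two boundary rays only. The coordinate w = log z turns quarter circles into
    vertical segments and the 3/2 power into an entire function, so Cauchy's theorem is needed for
    rectangles alone.

    A second constraint is that [psi] is given merely as an L^2 limit of truncated transforms. It is
    therefore never evaluated: all information on it comes from pairing it with explicit functions h
    (indicators, modulated e^{-eps|xi|}) for which h is in both L^1 and L^2 and the transform of h
    is in L^2. *)

Lemma ReD z w : complex.Re (z + w) = complex.Re z + complex.Re w.
Proof. by case: z w => ? ? []. Qed.
Lemma ImD z w : complex.Im (z + w) = complex.Im z + complex.Im w.
Proof. by case: z w => ? ? []. Qed.
Lemma ReN z : complex.Re (- z) = - complex.Re z.
Proof. by case: z. Qed.
Lemma ImN z : complex.Im (- z) = - complex.Im z.
Proof. by case: z. Qed.
Lemma ReM z w : complex.Re (z * w) =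
  complex.Re z * complex.Re w - complex.Im z * complex.Im w.
Proof. by case: z w => ? ? []. Qed.
Lemma ImM z w : complex.Im (z * w) =
  complex.Re z * complex.Im w + complex.Im z * complex.Re w.
Proof. by case: z w => a b [c d] /=. Qed.
Lemma ReJ z : complex.Re z^* = complex.Re z. Proof. by case: z. Qed.
Lemma ImJ z : complex.Im z^* = - complex.Im z. Proof. by case: z. Qed.
Definition ReImE := (ReD, ImD, ReN, ImN, ReM, ImM, ReJ, ImJ).

Lemma complex_ext z w : complex.Re z = complex.Re w ->
  complex.Im z = complex.Im w -> z = w.
Proof. by case: z w => ? ? [? ?] /= -> ->. Qed.

Lemma normcomplexE z : `|z| = (cabs z)%:C. Proof. by []. Qed.

Lemma cabsE z : cabs z = Num.sqrt (complex.Re z ^+ 2 + complex.Im z ^+ 2).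
Proof. by case: z. Qed.

Lemma cabs_ge0 z : 0 <= cabs z.
Proof. by rewrite cabsE sqrtr_ge0. Qed.

Lemma cabsM z w : cabs (z * w) = cabs z * cabs w.
Proof. exact: ComplexField.Normc.normcM. Qed.

Lemma cabsD z w : cabs (z + w) <= cabs z + cabs w.
Proof. exact: le_normcD. Qed.

Lemma cabsN z : cabs (- z) = cabs z.
Proof. exact: normcN. Qed.

Lemma cabsB z w : cabs (z - w) <= cabs z + cabs w.
Proof. by rewrite -(cabsN w) cabsD. Qed.

Lemma cabs_distC z w : cabs (z - w) = cabs (w - z).
Proof. by rewrite -cabsN opprB. Qed.

Lemma cabs_real x : cabs x%:C = `|x|.
Proof. by rewrite cabsE /= expr0n/= addr0 sqrtr_sqr. Qed.

Lemma cabs0 : cabs (0 : R[i]) = 0.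
Proof. by rewrite cabs_real normr0. Qed.

Lemma cabs1 : cabs (1 : R[i]) = 1.
Proof. by rewrite cabs_real normr1. Qed.

Lemma cabs_i : cabs ('i : R[i]) = 1.
Proof. by rewrite cabsE /= expr0n/= add0r expr1n sqrtr1. Qed.

Lemma cabsJ z : cabs z^* = cabs z.
Proof. by rewrite !cabsE ReJ ImJ sqrrN. Qed.

Lemma cabsV z : cabs z^-1 = (cabs z)^-1.
Proof. exact: ComplexField.Normc.normcV. Qed.

Lemma cabs_eq0 z : (cabs z == 0) = (z == 0).
Proof.
apply/eqP/eqP => [|->]; last exact: cabs0.
exact: ComplexField.Normc.eq0_normc.
Qed.

Lemma cabs_gt0 z : (0 < cabs z) = (z != 0).
Proof. by rewrite lt_neqAle cabs_ge0 andbT eq_sym cabs_eq0. Qed.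

Lemma Re_le_cabs z : `|complex.Re z| <= cabs z.
Proof.
by rewrite cabsE -sqrtr_sqr ler_sqrt ?addr_ge0 ?sqr_ge0// lerDl sqr_ge0.
Qed.

Lemma Im_le_cabs z : `|complex.Im z| <= cabs z.
Proof.
by rewrite cabsE -sqrtr_sqr ler_sqrt ?addr_ge0 ?sqr_ge0// lerDr sqr_ge0.
Qed.

Lemma cabs_le_ReIm z : cabs z <= `|complex.Re z| + `|complex.Im z|.
Proof.
rewrite {1}[z]complexE (le_trans (cabsD _ _))// cabsM cabs_i mul1r.
by rewrite !cabs_real.
Qed.

Definition cexp z : R[i] :=
  (expR (complex.Re z))%:C * (cos (complex.Im z) +i* sin (complex.Im z)).

Lemma Re_cexp z : complex.Re (cexp z) = expR (complex.Re z) * cos (complex.Im z).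
Proof. by rewrite /cexp ReM /= mul0r subr0. Qed.

Lemma Im_cexp z : complex.Im (cexp z) = expR (complex.Re z) * sin (complex.Im z).
Proof. by rewrite /cexp ImM /= mul0r addr0. Qed.

Lemma cexpD z w : cexp (z + w) = cexp z * cexp w.
Proof.
apply: complex_ext.
  by rewrite [LHS]Re_cexp ReM !Re_cexp !Im_cexp ReD ImD expRD cosD; ring.
by rewrite [LHS]Im_cexp ImM !Re_cexp !Im_cexp ReD ImD expRD sinD; ring.
Qed.

Lemma cexp0 : cexp 0 = 1.
Proof. by apply: complex_ext; rewrite ?Re_cexp ?Im_cexp /= expR0 mul1r ?cos0 ?sin0. Qed.

Lemma cabs_cexp z : cabs (cexp z) = expR (complex.Re z).
Proof.
rewrite cabsE Re_cexp Im_cexp !exprMn -mulrDr cos2Dsin2 mulr1 sqrtr_sqr.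
by rewrite ger0_norm// expR_ge0.
Qed.

Lemma cexp_real x : cexp x%:C = (expR x)%:C.
Proof. by apply: complex_ext; rewrite ?Re_cexp ?Im_cexp /= ?cos0 ?sin0 ?mulr1 ?mulr0. Qed.

Lemma cexpmE (xi x : R) : cexpm xi x = cexp (- ('i * (xi * x)%:C)).
Proof.
apply: complex_ext; rewrite ?Re_cexp ?Im_cexp ?ReImE /= !mul0r ?mul1r ?add0r ?addr0 ?subrr ?oppr0 ?expR0 ?mul1r.
  by rewrite cosN.
by rewrite sinN.
Qed.

Lemma cabs_cexpm (xi x : R) : cabs (cexpm xi x) = 1.
Proof. by rewrite cexpmE cabs_cexp ?ReImE /= !mul0r mulr0 subrr oppr0 expR0. Qed.

Lemma mvt_bound (F F' : R -> R) (M a b : R) :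
  (forall x, is_derive x 1 F (F' x)) ->
  (forall x, `|x - a| <= `|b - a| -> `|F' x| <= M) ->
  `|F b - F a| <= M * `|b - a|.
Proof.
move=> dF bF.
have cF (c d : R) : {within `[c, d], continuous F}.
  apply: derivable_within_continuous => x _.
  exact: (@ex_derive _ _ _ _ _ _ _ (dF x)).
have [ab|ba] := leP a b.
  have [c] := MVT_segment ab (fun x _ => dF x) (cF a b).
  rewrite in_itv/= => /andP[ac cb] ->.
  rewrite normrM ler_wpM2r// bF// !ger0_norm ?subr_ge0//.
  by rewrite lerD2r.
have [c] := MVT_segment (ltW ba) (fun x _ => dF x) (cF b a).
rewrite in_itv/= => /andP[ac cb] e.
rewrite distrC e normrM distrC ler_wpM2r// bF// !ler0_norm ?subr_le0// ?(ltW ba)//.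
by rewrite lerN2 lerD2r.
Qed.

Lemma norm_sin_le (b : R) : `|sin b| <= `|b|.
Proof.
have := @mvt_bound sin cos 1 0 b (fun x => is_derive_sin x).
by rewrite sin0 !subr0 mul1r; apply => x _; exact: cos_max.
Qed.

Lemma norm_cosB1_le (b : R) : `|cos b - 1| <= `|b| ^+ 2.
Proof.
have := @mvt_bound cos (fun x => - sin x) `|b| 0 b (fun x => is_derive_cos x).
rewrite cos0 !subr0 expr2; apply => x; rewrite !subr0 => xb.
by rewrite normrN (le_trans (norm_sin_le _)).
Qed.

Lemma norm_cosB1_le1 (b : R) : `|cos b - 1| <= `|b|.
Proof.
have := @mvt_bound cos (fun x => - sin x) 1 0 b (fun x => is_derive_cos x).
rewrite cos0 !subr0 mul1r; apply => x _.
by rewrite normrN sin_max.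
Qed.

Lemma norm_sinB_le (b : R) : `|sin b - b| <= `|b| ^+ 2.
Proof.
have dS (x : R) : is_derive x 1 (fun y : R => sin y - y) (cos x - 1).
  exact: is_deriveB.
have := @mvt_bound (fun x => sin x - x) (fun x => cos x - 1) `|b| 0 b dS.
rewrite sin0 !subr0 expr2; apply => x; rewrite !subr0 => xb.
by rewrite (le_trans (norm_cosB1_le1 _)).
Qed.

(** The inequality 1 + x <= e^x, taken at [a] and at [- a], encloses e^a - 1 between a and a e^a. *)
Lemma norm_expRB1_le (a : R) : `|expR a - 1| <= `|a| * expR `|a|.
Proof.
have := expR_ge1Dx a; have := expR_ge1Dx (- a); rewrite expRN => h1 h2.
have e0 := expR_gt0 a.
have h3 : 1 - a * expR a * (expR a)^-1 <= (expR a)^-1 by rewrite mulfK ?gt_eqF.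
have h4 : expR a - a * expR a <= 1.
  have := ler_wpM2r (ltW e0) h1; rewrite mulVf ?gt_eqF// mulrBl mul1r; lra.
have [a0|a0] := leP 0 a.
  rewrite !ger0_norm//; last lra.
  by rewrite lerBlDr; lra.
rewrite (ler0_norm (ltW a0)) ler0_norm; last first.
  by rewrite subr_le0 -expR0 ler_expR ltW.
have := expR_ge1Dx (- a); nra.
Qed.

Lemma norm_expRB1B_le (a : R) : `|expR a - 1 - a| <= `|a| ^+ 2 * expR `|a|.
Proof.
have h := norm_expRB1_le a; have := expR_ge1Dx a => h2.
rewrite ger0_norm; last lra.
apply: (@le_trans _ _ (`|a| * `|expR a - 1|)); last first.
  by rewrite expr2 -mulrA ler_wpM2l.
have e0 := expR_gt0 a.
have h4 : expR a - 1 <= a * expR a.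
  have := expR_ge1Dx (- a); rewrite expRN => h1.
  have := ler_wpM2r (ltW e0) h1; rewrite mulVf ?gt_eqF// mulrBl mul1r; lra.
have [a0|a0] := leP 0 a.
  rewrite !ger0_norm//; nra.
rewrite (ler0_norm (ltW a0)) ler0_norm; last first.
  by rewrite subr_le0 -expR0 ler_expR ltW.
nra.
Qed.

(** The remainder splits into three terms in its real part and two in its imaginary part. Each is at
    most A^2 e^A with A = |w|, whence the 5. *)
Lemma cabs_cexpB1B_le w : cabs (cexp w - 1 - w) <= 5 * cabs w ^+ 2 * expR (cabs w).
Proof.
case: w => a b; set w := a +i* b; set A := cabs w.
have ha : `|a| <= A := Re_le_cabs w.
have hb : `|b| <= A := Im_le_cabs w.
have A0 : 0 <= A := cabs_ge0 w.
have E1 : 1 <= expR A by rewrite -expR0 ler_expR.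
have Ea : expR `|a| <= expR A by rewrite ler_expR.
apply: (le_trans (cabs_le_ReIm _)).
rewrite !(ReD, ImD, ReN, ImN) Re_cexp Im_cexp /= oppr0 addr0.
have -> : expR a * cos b - 1 - a = (expR a - 1 - a) + (expR a - 1) * (cos b - 1)
  + (cos b - 1) by ring.
have -> : expR a * sin b - b = (sin b - b) + (expR a - 1) * sin b by ring.
have h1 := norm_expRB1B_le a.
have h2 := norm_expRB1_le a.
have h3 := norm_cosB1_le b.
have h4 := norm_sinB_le b.
have h5 := norm_sin_le b.
have h6 := norm_cosB1_le1 b.
have H2 : `|expR a - 1| <= A * expR A.
  by rewrite (le_trans h2)// ler_pM// expR_ge0.
have H1 : `|expR a - 1 - a| <= A ^+ 2 * expR A.
  rewrite (le_trans h1)// ler_pM// ?exprn_ge0 ?expR_ge0//.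
  by rewrite lerXn2r ?nnegrE.
have B2 : `|b| ^+ 2 <= A ^+ 2 * expR A.
  rewrite -[leLHS]mulr1 ler_pM// ?exprn_ge0// lerXn2r ?nnegrE//.
have H3 : `|(expR a - 1) * (cos b - 1)| <= A ^+ 2 * expR A.
  rewrite normrM expr2 mulrAC ler_pM//. exact: le_trans hb.
have H4 : `|(expR a - 1) * sin b| <= A ^+ 2 * expR A.
  rewrite normrM expr2 mulrAC ler_pM//. exact: le_trans hb.
have n1 := ler_normD ((expR a - 1 - a) + (expR a - 1) * (cos b - 1)) (cos b - 1).
have n2 := ler_normD (expR a - 1 - a) ((expR a - 1) * (cos b - 1)).
have n3 := ler_normD (sin b - b) ((expR a - 1) * sin b).
rewrite -mulrA; lra.
Qed.

(* Complex differentiability with real-valued moduli, which avoids the topology of R[i]. *)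
Definition cdiff f z (d : R[i]) := forall e : R, 0 < e -> exists2 r : R, 0 < r &
  forall h, cabs h < r -> cabs (f (z + h) - f z - d * h) <= e * cabs h.

Lemma derivable_cdiff f z :
  derivable (f : R[i]^o -> R[i]^o) z 1 -> exists d, cdiff f z d.
Proof.
move=> /cvg_ex[d /cvgrPdist_lt H]; exists d => e e0.
have e0C : (0 : R[i]) < e%:C by rewrite ltcR.
have := H _ e0C; rewrite near_withinE => /nbhs_ballP[r /= r0 Hr].
(* In the order of [R[i]], being positive forces the imaginary part to vanish, so the radius is a
   real number. *)
move: r r0 Hr => [r ri]; rewrite ltcE/= => /andP[/eqP -> r0] Hr.
exists r => // h hr.
have [->|h0] := eqVneq h 0.
  by rewrite addr0 subrr mulr0 subr0 cabs0 mulr0.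
have := Hr h; rewrite /ball/= sub0r normrN normcomplexE ltcR => /(_ hr h0).
rewrite normcomplexE ltcR /GRing.scale/= mulr1 => H1.
have -> : f (z + h) - f z - d * h = - h * (d - h^-1 * (f (h + z) - f z)).
  by rewrite [h + z]addrC; field.
by rewrite cabsM cabsN mulrC ler_wpM2r ?cabs_ge0// ltW.
Qed.

Lemma cdiff_derivable f z (d : R[i]) :
  cdiff f z d -> derivable (f : R[i]^o -> R[i]^o) z 1.
Proof.
move=> H; apply/cvg_ex; exists d; apply/cvgrPdist_lt => -[e ei].
rewrite ltcE/= => /andP[/eqP -> e0].
have [r r0 Hr] := H (e / 2) (divr_gt0 e0 (ltr0n _ 2)).
rewrite near_withinE; apply/nbhs_ballP; exists r%:C; first by rewrite /= ltcR.
move=> h; rewrite /ball/= sub0r normrN normcomplexE ltcR => hr h0.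
rewrite normcomplexE ltcR /GRing.scale/= mulr1.
have -> : d - h^-1 * (f (h + z) - f z) = - h^-1 * (f (z + h) - f z - d * h).
  by rewrite [h + z]addrC; field.
have h0' : 0 < cabs h by rewrite cabs_gt0.
rewrite cabsM cabsN cabsV mulrC ltr_pdivrMr//.
by rewrite (le_lt_trans (Hr _ hr))// ltr_pM2r//; lra.
Qed.

(** The definition tested at [e = 1]. It yields continuity along curves and, later, the Lipschitz
    hypothesis of [poisson_limit]. *)
Lemma cdiff_lip f z d : cdiff f z d -> exists2 r : R, 0 < r &
  forall h, cabs h < r -> cabs (f (z + h) - f z) <= (cabs d + 1) * cabs h.
Proof.
move=> /(_ 1 ltr01)[r r0 H]; exists r => // h hr.
have -> : f (z + h) - f z = (f (z + h) - f z - d * h) + d * h by ring.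
rewrite (le_trans (cabsD _ _))// cabsM mulrDl addrC lerD2l.
exact: H.
Qed.

Lemma cdiff_cst (c : R[i]) z : cdiff (fun _ => c) z 0.
Proof.
by move=> e e0; exists 1 => // h _; rewrite subrr mul0r subr0 cabs0 mulr_ge0 ?cabs_ge0// ltW.
Qed.

Lemma cdiff_id z : cdiff (fun z => z) z 1.
Proof.
move=> e e0; exists 1 => // h _; rewrite mul1r.
have -> : z + h - z - h = 0 by ring.
by rewrite cabs0 mulr_ge0 ?cabs_ge0// ltW.
Qed.

Lemma cdiffM f g z (df dg : R[i]) : cdiff f z df -> cdiff g z dg ->
  cdiff (fun z => f z * g z) z (df * g z + f z * dg).
Proof.
move=> Hf Hg e e0.
pose D := cabs df + 1; pose E := cabs dg + 1.
have D0 : 0 < D by rewrite ltr_wpDl ?cabs_ge0.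
have E0 : 0 < E by rewrite ltr_wpDl ?cabs_ge0.
(* The remainder of the product has three pieces, with coefficients |g z|, |f z| and D E. The last
   is a product of two increments, made small by |h| < e / K; [K] collects the three. *)
pose K := cabs (f z) + cabs (g z) + D * E + 1.
have K0 : 0 < K by rewrite ltr_wpDl// !addr_ge0 ?cabs_ge0// mulr_ge0// ltW.
have eK : 0 < e / K by rewrite divr_gt0.
have [r1 r10 H1] := Hf _ eK.
have [r2 r20 H2] := Hg _ eK.
have [r3 r30 H3] := cdiff_lip Hf.
have [r4 r40 H4] := cdiff_lip Hg.
exists (Num.min (e / K) (Num.min (Num.min r1 r2) (Num.min r3 r4))).
  by rewrite !lt_min eK r10 r20 r30 r40.
move=> h; rewrite !lt_min => /and3P[he /andP[h1 h2] /andP[h3 h4]].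
have -> : f (z + h) * g (z + h) - f z * g z - (df * g z + f z * dg) * h =
  (f (z + h) - f z - df * h) * g z + f z * (g (z + h) - g z - dg * h) +
  (f (z + h) - f z) * (g (z + h) - g z) by ring.
have c0 := cabs_ge0 h.
have X1 := H1 _ h1; have X2 := H2 _ h2; have X3 := H3 _ h3; have X4 := H4 _ h4.
rewrite (le_trans (cabsD _ _))// (le_trans (lerD (cabsD _ _) (lexx _)))//.
rewrite !cabsM.
have -> : e * cabs h = (e / K * cabs h) * K by field; rewrite gt_eqF.
have Y1 := ler_wpM2r (cabs_ge0 (g z)) X1.
have Y2 := ler_wpM2l (cabs_ge0 (f z)) X2.
have Y3 : cabs (f (z + h) - f z) * cabs (g (z + h) - g z) <=
   (D * cabs h) * (E * (e / K)).
  rewrite ler_pM ?cabs_ge0//.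
  by rewrite (le_trans X4)// ler_wpM2l ?ltW.
have Y4 : 0 <= e / K * cabs h by rewrite mulr_ge0// ltW.
apply: (@le_trans _ _ (e / K * cabs h * cabs (g z) + cabs (f z) * (e / K * cabs h)
  + D * cabs h * (E * (e / K)))); first by rewrite !lerD.
rewrite /K; nra.
Qed.

Lemma cdiff_comp f g z (df dg : R[i]) : cdiff f z df -> cdiff g (f z) dg ->
  cdiff (fun z => g (f z)) z (dg * df).
Proof.
move=> Hf Hg e e0.
pose D := cabs df + 1; pose E := cabs dg + 1.
have D0 : 0 < D by rewrite ltr_wpDl ?cabs_ge0.
have E0 : 0 < E by rewrite ltr_wpDl ?cabs_ge0.
have e1 : 0 < e / (2 * D) by rewrite divr_gt0// mulr_gt0.
have e2 : 0 < e / (2 * E) by rewrite divr_gt0// mulr_gt0.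
have [r1 r10 H1] := Hg _ e1.
have [r2 r20 H2] := Hf _ e2.
have [r3 r30 H3] := cdiff_lip Hf.
exists (Num.min (r1 / D) (Num.min r2 r3)).
  by rewrite !lt_min divr_gt0// r20 r30.
move=> h; rewrite !lt_min => /and3P[h1 h2 h3].
pose k := f (z + h) - f z.
have kD : cabs k <= D * cabs h by exact: H3.
have kr : cabs k < r1.
  by rewrite (le_lt_trans kD)// mulrC -ltr_pdivlMr.
have := H1 _ kr; rewrite {1}/k.
have -> : f z + (f (z + h) - f z) = f (z + h) by ring.
move=> X1; have X2 := H2 _ h2.
have -> : g (f (z + h)) - g (f z) - dg * df * h =
  (g (f (z + h)) - g (f z) - dg * k) + dg * (f (z + h) - f z - df * h).
  by rewrite /k; ring.
have c0 := cabs_ge0 h; have d0 := cabs_ge0 dg.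
rewrite (le_trans (cabsD _ _))// cabsM.
have Y1 : e / (2 * D) * cabs k <= e / 2 * cabs h.
  have -> : e / 2 * cabs h = e / (2 * D) * (D * cabs h) by field; rewrite gt_eqF.
  by rewrite ler_wpM2l// ltW.
have Y2 : cabs dg * cabs (f (z + h) - f z - df * h) <= e / 2 * cabs h.
  have -> : e / 2 * cabs h = E * (e / (2 * E) * cabs h) by field; rewrite gt_eqF.
  by rewrite ler_pM ?cabs_ge0// /E lerDl.
lra.
Qed.

Lemma cdiff_cexp z : cdiff cexp z (cexp z).
Proof.
move=> e e0; pose K := 5 * expR (complex.Re z) * expR 1.
have K0 : 0 < K by rewrite !mulr_gt0 ?expR_gt0.
exists (Num.min 1 (e / K)); first by rewrite lt_min ltr01 divr_gt0.
move=> h; rewrite lt_min => /andP[h1 he].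
have -> : cexp (z + h) - cexp z - cexp z * h = cexp z * (cexp h - 1 - h).
  by rewrite cexpD; ring.
rewrite cabsM cabs_cexp.
have c0 := cabs_ge0 h.
apply: (@le_trans _ _ (expR (complex.Re z) * (5 * cabs h ^+ 2 * expR 1))).
  rewrite ler_wpM2l ?expR_ge0// (le_trans (cabs_cexpB1B_le _))// ler_wpM2l//.
    by rewrite mulr_ge0// sqr_ge0.
  by rewrite ler_expR ltW.
have -> : expR (complex.Re z) * (5 * cabs h ^+ 2 * expR 1) = (cabs h * K) * cabs h.
  by rewrite /K; ring.
by rewrite ler_wpM2r// -ler_pdivlMr// ltW.
Qed.

Definition centire f := forall z, exists d, cdiff f z d.

Lemma entireP f : entire f <-> centire f.
Proof.
split=> H z; first exact: derivable_cdiff.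
by have [d] := H z; exact: cdiff_derivable.
Qed.

Lemma centire_cst (c : R[i]) : centire (fun _ => c).
Proof. by move=> z; exists 0; exact: cdiff_cst. Qed.

Lemma centire_id : centire (fun z => z).
Proof. by move=> z; exists 1; exact: cdiff_id. Qed.

Lemma centireM f g : centire f -> centire g -> centire (fun z => f z * g z).
Proof.
by move=> F G z; have [d D] := F z; have [e E] := G z; eexists; exact: (cdiffM D E).
Qed.

Lemma centire_comp f g : centire f -> centire g -> centire (fun z => g (f z)).
Proof.
by move=> F G z; have [d D] := F z; have [e E] := G (f z); eexists; exact: (cdiff_comp D E).
Qed.

Lemma centire_cexp : centire cexp.
Proof. by move=> z; eexists; exact: cdiff_cexp. Qed.

(** Schwarz reflection: the remainder at [z] is the conjugate of the remainder of [f] at the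
    conjugate point. *)
Lemma centire_conj f : centire f -> centire (fun z => (f z^*)^*).
Proof.
move=> F z; have [d D] := F z^*; exists d^* => e e0.
have [r r0 H] := D e e0; exists r => // h hr.
rewrite -(cabsJ h) -[leLHS]cabsJ !(rmorphB, rmorphM, rmorphD)/= !conjcK.
by apply: H; rewrite cabsJ.
Qed.

End ComplexPlane.

Arguments cabs : simpl never.
Arguments cexp : simpl never.

(** * Measurability, integration and dominated convergence for complex-valued functions *)

Section ComplexIntegral.
Variable R : realType.
Local Notation T := (measurableTypeR R).
Implicit Types (D : set T).

Definition cmeas d (X : measurableType d) (D : set X) (g : X -> R[i]) :=
  measurable_fun D (fun x => complex.Re (g x)) /\
  measurable_fun D (fun x => complex.Im (g x)).

Section Measurability.
Context d (X : measurableType d).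
Implicit Types (E : set X) (f g : X -> R[i]).

Lemma cmeasS E F g : measurable F -> E `<=` F -> cmeas F g -> cmeas E g.
Proof. by move=> mF EF [h1 h2]; split; exact: measurable_funS EF _. Qed.

Lemma cmeas_cst E (c : R[i]) : cmeas E (fun _ => c).
Proof. by split; exact: measurable_cst. Qed.

Lemma cmeasD E f g : cmeas E f -> cmeas E g -> cmeas E (fun x => f x + g x).
Proof.
move=> [h1 h2] [h3 h4]; split.
  under eq_fun do rewrite ReD; exact: measurable_funD.
under eq_fun do rewrite ImD; exact: measurable_funD.
Qed.

Lemma cmeasN E f : cmeas E f -> cmeas E (fun x => - f x).
Proof.
move=> [h1 h2]; split.
  under eq_fun do rewrite ReN; exact: measurableT_comp.
under eq_fun do rewrite ImN; exact: measurableT_comp.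
Qed.

Lemma cmeasB E f g : cmeas E f -> cmeas E g -> cmeas E (fun x => f x - g x).
Proof. by move=> hf hg; apply: cmeasD => //; exact: cmeasN. Qed.

Lemma cmeasM E f g : cmeas E f -> cmeas E g -> cmeas E (fun x => f x * g x).
Proof.
move=> [h1 h2] [h3 h4]; split.
  by under eq_fun do rewrite ReM; apply: measurable_funB; exact: measurable_funM.
by under eq_fun do rewrite ImM; apply: measurable_funD; exact: measurable_funM.
Qed.

Lemma cmeasJ E f : cmeas E f -> cmeas E (fun x => (f x)^*).
Proof.
move=> [h1 h2]; split.
  by under eq_fun do rewrite ReJ.
under eq_fun do rewrite ImJ; exact: measurableT_comp.
Qed.

Lemma cmeas_real E (f : X -> R) : measurable_fun E f -> cmeas E (fun x => (f x)%:C).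
Proof. by move=> mf; split => //=; exact: measurable_cst. Qed.

Lemma measurable_cabs E f : cmeas E f -> measurable_fun E (fun x => cabs (f x)).
Proof.
move=> [h1 h2]; under eq_fun do rewrite cabsE.
apply: (measurableT_comp (f := @Num.sqrt R)).
  by apply: continuous_measurable_fun; exact: sqrt_continuous.
by apply: measurable_funD; exact: measurable_funX.
Qed.

Lemma cmeas_cexp E f : cmeas E f -> cmeas E (fun x => cexp (f x)).
Proof.
move=> [h1 h2]; split.
  under eq_fun do rewrite Re_cexp; apply: measurable_funM.
    exact: measurableT_comp.
  apply: (measurableT_comp (f := @cos R)) => //.
  by apply: continuous_measurable_fun; exact: continuous_cos.
under eq_fun do rewrite Im_cexp; apply: measurable_funM.
  exact: measurableT_comp.
apply: (measurableT_comp (f := @sin R)) => //.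
by apply: continuous_measurable_fun; exact: continuous_sin.
Qed.

Lemma cmeas_cexpm E (f g : X -> R) : measurable_fun E f -> measurable_fun E g ->
  cmeas E (fun x => cexpm (f x) (g x)).
Proof.
move=> hf hg; under eq_fun do rewrite cexpmE.
apply: cmeas_cexp; apply: cmeasN; apply: cmeasM; first exact: cmeas_cst.
by apply: cmeas_real; exact: measurable_funM.
Qed.

Lemma cmeas_comp d' (Y : measurableType d') (h : Y -> X) f :
  measurable_fun setT h -> cmeas setT f -> cmeas setT (fun x => f (h x)).
Proof.
by move=> mh [h1 h2]; split; [exact: (measurableT_comp h1)|exact: (measurableT_comp h2)].
Qed.

Lemma cmeas_restrict E f : measurable E -> cmeas E f ->
  cmeas setT (fun x => if x \in E then f x else 0).
Proof.
move=> mE [h1 h2]; split.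
  have /measurable_restrict : measurable_fun (setT `&` E) (fun x => complex.Re (f x)) by rewrite setTI.
  move=> /(_ mE measurableT); apply: eq_measurable_fun => x _.
  by rewrite patchE; case: ifP.
have /measurable_restrict : measurable_fun (setT `&` E) (fun x => complex.Im (f x)) by rewrite setTI.
move=> /(_ mE measurableT); apply: eq_measurable_fun => x _.
by rewrite patchE; case: ifP.
Qed.

End Measurability.

Definition cintegrable (mu : {measure set T -> \bar R}) D (g : T -> R[i]) :=
  mu.-integrable D (fun x => (complex.Re (g x))%:E) /\
  mu.-integrable D (fun x => (complex.Im (g x))%:E).

Section CInt.
Variable mu : {measure set T -> \bar R}.
Implicit Types (f g : T -> R[i]).

Lemma Re_CInt D g :
  complex.Re (CInt mu D g) = Rintegral mu D (fun x => complex.Re (g x)).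
Proof. by rewrite /CInt ReD ReM /=; ring. Qed.

Lemma Im_CInt D g :
  complex.Im (CInt mu D g) = Rintegral mu D (fun x => complex.Im (g x)).
Proof. by rewrite /CInt ImD ImM /=; ring. Qed.

Lemma eq_CInt D f g : (forall x, D x -> f x = g x) -> CInt mu D f = CInt mu D g.
Proof.
move=> fg; apply: complex_ext; rewrite ?Re_CInt ?Im_CInt; apply: eq_Rintegral => x;
  by rewrite inE => /fg ->.
Qed.

(** Moves a varying domain into the integrand, the form that dominated convergence and Fubini ask
    for. *)
Lemma CInt_restrict D g :
  CInt mu D g = CInt mu setT (fun x => if x \in D then g x else 0).
Proof.
by apply: complex_ext; rewrite ?Re_CInt ?Im_CInt Rintegral_mkcond;
  apply: eq_Rintegral => x _; rewrite patchE; case: ifP.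
Qed.

(* No integrability is needed: [fine] sends both infinities to 0. *)
Lemma RintegralN D (h : T -> R) :
  Rintegral mu D (fun x => - h x) = - Rintegral mu D h.
Proof.
pose f (x : T) := (h x)%:E.
rewrite /Rintegral -[X in fine X]/(integral mu D (\- f)%E) -[X in - fine X]/(integral mu D f).
rewrite integralE [in RHS]integralE funeposN funenegN.
by case: (integral mu D _) => [a| |]; case: (integral mu D _) => [b| |] //=;
  rewrite ?oppr0// opprB.
Qed.

Lemma CInt_conj D g : CInt mu D (fun x => (g x)^*) = (CInt mu D g)^*.
Proof.
apply: complex_ext; rewrite ?ReJ ?ImJ ?Re_CInt ?Im_CInt.
  by apply: eq_Rintegral => x _; rewrite ReJ.
by rewrite -RintegralN; apply: eq_Rintegral => x _; rewrite ImJ.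
Qed.

Lemma cintegrable_cmeas D g : cintegrable mu D g -> cmeas D g.
Proof.
by move=> [/integrableP[/measurable_EFinP h1 _] /integrableP[/measurable_EFinP h2 _]].
Qed.

Lemma le_cintegrable D g (h : T -> R) : measurable D -> cmeas D g ->
  (forall x, D x -> cabs (g x) <= h x) -> mu.-integrable D (EFin \o h) ->
  cintegrable mu D g.
Proof.
move=> mD [m1 m2] gh ih; split.
  apply: (le_integrable mD _ _ ih); first exact/measurable_EFinP.
  move=> x Dx /=; rewrite lee_fin (le_trans (Re_le_cabs _))// (le_trans (gh _ Dx))//.
  exact: ler_norm.
apply: (le_integrable mD _ _ ih); first exact/measurable_EFinP.
move=> x Dx /=; rewrite lee_fin (le_trans (Im_le_cabs _))// (le_trans (gh _ Dx))//.
exact: ler_norm.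
Qed.

Lemma integrable_cabs D g : measurable D -> cintegrable mu D g ->
  mu.-integrable D (fun x => (cabs (g x))%:E).
Proof.
move=> mD ig; have [i1 i2] := ig.
apply: (le_integrable mD _ _ (integrableD mD (integrable_abse i1) (integrable_abse i2))).
  by apply/measurable_EFinP/measurable_cabs/cintegrable_cmeas.
move=> x Dx /=; rewrite lee_fin ger0_norm ?cabs_ge0// (le_trans (cabs_le_ReIm _))//.
exact: ler_norm.
Qed.

Lemma cintegrableS (D E : set T) g : measurable E -> measurable D -> D `<=` E ->
  cintegrable mu E g -> cintegrable mu D g.
Proof. by move=> mE mD DE [i1 i2]; split; apply: integrableS DE _. Qed.

Lemma eq_cintegrable D f g : measurable D -> (forall x, D x -> f x = g x) ->
  cintegrable mu D f -> cintegrable mu D g.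
Proof.
move=> mD fg [i1 i2]; split.
  by apply: eq_integrable i1 => // x; rewrite inE => /fg ->.
by apply: eq_integrable i2 => // x; rewrite inE => /fg ->.
Qed.

Lemma cintegrableD D f g : measurable D -> cintegrable mu D f ->
  cintegrable mu D g -> cintegrable mu D (fun x => f x + g x).
Proof.
move=> mD [f1 f2] [g1 g2]; split.
  by apply: eq_integrable (integrableD mD f1 g1) => // x _ /=; rewrite ReD.
by apply: eq_integrable (integrableD mD f2 g2) => // x _ /=; rewrite ImD.
Qed.

Lemma cintegrableZ D (c : R[i]) g : measurable D -> cintegrable mu D g ->
  cintegrable mu D (fun x => c * g x).
Proof.
move=> mD ig; apply: (@le_cintegrable D _ (fun x => cabs c * cabs (g x))) => //.
- by apply: cmeasM; [exact: cmeas_cst|exact: cintegrable_cmeas].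
- by move=> x _; rewrite cabsM.
- by have := integrableZl mD (cabs c) (integrable_cabs mD ig).
Qed.

Lemma CIntD D f g : measurable D -> cintegrable mu D f -> cintegrable mu D g ->
  CInt mu D (fun x => f x + g x) = CInt mu D f + CInt mu D g.
Proof.
move=> mD [f1 f2] [g1 g2]; apply: complex_ext; [rewrite [LHS]Re_CInt ReD !Re_CInt|rewrite [LHS]Im_CInt ImD !Im_CInt].
  by rewrite -RintegralD//; apply: eq_Rintegral => x _; rewrite ReD.
by rewrite -RintegralD//; apply: eq_Rintegral => x _; rewrite ImD.
Qed.

Lemma CIntZ D (c : R[i]) g : measurable D -> cintegrable mu D g ->
  CInt mu D (fun x => c * g x) = c * CInt mu D g.
Proof.
move=> mD [g1 g2].
have Z (a : R) (h : T -> R) : mu.-integrable D (fun x => (h x)%:E) ->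
  mu.-integrable D (EFin \o (fun x => a * h x)).
  by move=> ih; have := integrableZl mD a ih.
apply: complex_ext; [rewrite [LHS]Re_CInt ReM|rewrite [LHS]Im_CInt ImM];
  rewrite !Re_CInt !Im_CInt.
  rewrite -!RintegralZl// -RintegralB//; [|exact: Z|exact: Z].
  by apply: eq_Rintegral => x _; rewrite ReM.
rewrite -!RintegralZl// -RintegralD//; [|exact: Z|exact: Z].
by apply: eq_Rintegral => x _; rewrite ImM.
Qed.

Lemma CIntN D g : CInt mu D (fun x => - g x) = - CInt mu D g.
Proof.
apply: complex_ext; rewrite ?ReN ?ImN ?Re_CInt ?Im_CInt -RintegralN;
  by apply: eq_Rintegral => x _; rewrite ?ReN ?ImN.
Qed.

Lemma CIntB D f g : measurable D -> cintegrable mu D f -> cintegrable mu D g ->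
  CInt mu D (fun x => f x - g x) = CInt mu D f - CInt mu D g.
Proof.
move=> mD hf hg; rewrite -CIntN -CIntD//.
by apply: (eq_cintegrable mD _ (cintegrableZ (-1) mD hg)) => x _; rewrite mulN1r.
Qed.

(** The factor 2 comes from bounding the real and the imaginary part separately. *)
Lemma cabs_CInt_le D g (h : T -> R) : measurable D -> cmeas D g ->
  (forall x, D x -> cabs (g x) <= h x) -> mu.-integrable D (EFin \o h) ->
  cabs (CInt mu D g) <= 2 * Rintegral mu D h.
Proof.
move=> mD mg gh ih; have [i1 i2] := le_cintegrable mD mg gh ih.
apply: (le_trans (cabs_le_ReIm _)); rewrite Re_CInt Im_CInt mulrDl mul1r lerD//.
  apply: (le_trans (le_normr_Rintegral mD i1)); apply: le_Rintegral => //.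
    by have := integrable_abse i1.
  by move=> x Dx; exact: le_trans (Re_le_cabs _) (gh _ Dx).
apply: (le_trans (le_normr_Rintegral mD i2)); apply: le_Rintegral => //.
  by have := integrable_abse i2.
by move=> x Dx; exact: le_trans (Im_le_cabs _) (gh _ Dx).
Qed.

Lemma CInt_real D (h : T -> R) : CInt mu D (fun x => (h x)%:C) = (Rintegral mu D h)%:C.
Proof.
apply: complex_ext; rewrite ?Re_CInt ?Im_CInt//=.
by rewrite /Rintegral integral0.
Qed.

Lemma ae_eq_CInt D f g : measurable D -> cmeas D f -> cmeas D g ->
  {ae mu, forall x, D x -> f x = g x} -> CInt mu D f = CInt mu D g.
Proof.
move=> mD [f1 f2] [g1 g2] fg; apply: complex_ext; rewrite ?Re_CInt ?Im_CInt /Rintegral;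
  congr fine; apply: ae_eq_integral => //; try exact/measurable_EFinP.
  by apply: filterS fg => x H Dx; rewrite H.
by apply: filterS fg => x H Dx; rewrite H.
Qed.

End CInt.

Definition ccvg (u : nat -> R[i]) (l : R[i]) := (fun n => cabs (u n - l)) @ \oo --> (0 : R).

Lemma ccvg_ReIm (u : nat -> R[i]) l : ccvg u l ->
  (fun n => complex.Re (u n)) @ \oo --> complex.Re l /\
  (fun n => complex.Im (u n)) @ \oo --> complex.Im l.
Proof.
move=> /cvgr0Pnorm_lt H; split; apply/cvgrPdist_lt => e e0; near=> n.
  have : cabs (u n - l) < e.
    by rewrite -[ltLHS]ger0_norm ?cabs_ge0//; near: n; exact: H.
  by apply: le_lt_trans; rewrite cabs_distC -ReN -ReD Re_le_cabs.
have : cabs (u n - l) < e.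
  by rewrite -[ltLHS]ger0_norm ?cabs_ge0//; near: n; exact: H.
by apply: le_lt_trans; rewrite cabs_distC -ImN -ImD Im_le_cabs.
Unshelve. all: by end_near. Qed.

Lemma ReIm_ccvg (u : nat -> R[i]) l :
  (fun n => complex.Re (u n)) @ \oo --> complex.Re l ->
  (fun n => complex.Im (u n)) @ \oo --> complex.Im l -> ccvg u l.
Proof.
move=> /subr_cvg0 h1 /subr_cvg0 h2.
have H : (fun n => `|complex.Re (u n) - complex.Re l| + `|complex.Im (u n) - complex.Im l|)
  @ \oo --> (0 : R).
  rewrite -[X in _ --> X](addr0 0); apply: cvgD.
    by rewrite -(normr0 R); apply: cvg_norm.
  by rewrite -(normr0 R); apply: cvg_norm.
apply: (squeeze_cvgr _ (cvg_cst 0) H); near=> n.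
by rewrite cabs_ge0 /= (le_trans (cabs_le_ReIm _))// !ReImE.
Unshelve. all: by end_near. Qed.

Lemma ccvg_unique (u : nat -> R[i]) l l' : ccvg u l -> ccvg u l' -> l = l'.
Proof.
move=> /ccvg_ReIm[h1 h2] /ccvg_ReIm[h3 h4].
by apply: complex_ext; [apply: cvg_unique h1 h3|apply: cvg_unique h2 h4].
Qed.

Lemma ccvg_cst (l : R[i]) : ccvg (fun _ => l) l.
Proof. by rewrite /ccvg subrr cabs0; exact: cvg_cst. Qed.

Lemma ccvg_le (u : nat -> R[i]) l (v : nat -> R) :
  (forall n, cabs (u n - l) <= v n) -> v @ \oo --> (0 : R) -> ccvg u l.
Proof.
move=> uv v0; apply: (squeeze_cvgr _ (cvg_cst 0) v0).
by near=> n; rewrite cabs_ge0 uv.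
Unshelve. all: by end_near. Qed.

Lemma ccvgD (u v : nat -> R[i]) l m : ccvg u l -> ccvg v m ->
  ccvg (fun n => u n + v n) (l + m).
Proof.
move=> hu hv; apply: (@ccvg_le _ _ (fun n => cabs (u n - l) + cabs (v n - m))).
  by move=> n; rewrite (le_trans _ (cabsD _ _))// opprD addrACA.
by rewrite -[X in _ --> X](addr0 0); exact: cvgD.
Qed.

Lemma ccvgZ (c : R[i]) (u : nat -> R[i]) l : ccvg u l -> ccvg (fun n => c * u n) (c * l).
Proof.
move=> hu; apply: (@ccvg_le _ _ (fun n => cabs c * cabs (u n - l))).
  by move=> n; rewrite -mulrBr cabsM.
by rewrite -[X in _ --> X](mulr0 (cabs c)); apply: cvgM => //; exact: cvg_cst.
Qed.

Lemma CInt_dominated_cvg (mu : {measure set T -> \bar R}) D (f_ : nat -> T -> R[i])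
    (f : T -> R[i]) (g : T -> R) : measurable D ->
  (forall n, cmeas D (f_ n)) -> cmeas D f ->
  {ae mu, forall x, D x -> ccvg (fun n => f_ n x) (f x)} ->
  mu.-integrable D (EFin \o g) ->
  (forall n x, D x -> cabs (f_ n x) <= g x) ->
  ccvg (fun n => CInt mu D (f_ n)) (CInt mu D f).
Proof.
move=> mD mf_ mf ff ig fg.
(* [p] stands for the real or the imaginary part; the scalar theorem is applied to each. *)
have key (p : R[i] -> R) : (forall z, `|p z| <= cabs z) ->
    (forall n, measurable_fun D (fun x => p (f_ n x))) ->
    measurable_fun D (fun x => p (f x)) ->
    (forall u l, ccvg u l -> (fun n => p (u n)) @ \oo --> p l) ->
    (fun n => Rintegral mu D (fun x => p (f_ n x))) @ \oo -->
      Rintegral mu D (fun x => p (f x)).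
  move=> pc mp_ mp pcvg.
  have [||||| i0 _ H] := @dominated_convergence _ _ _ mu D mD
    (fun n x => (p (f_ n x))%:E) (fun x => (p (f x))%:E) (EFin \o g).
  - by move=> n; exact/measurable_EFinP.
  - exact/measurable_EFinP.
  - by apply: filterS ff => x H Dx; apply: cvg_EFin; [near=> n|exact: pcvg (H Dx)].
  - exact: ig.
  - apply: aeW => x n Dx; rewrite /= lee_fin (le_trans (pc _))//.
    exact: fg.
  have := integrable_fin_num mD i0 => /fineK e.
  rewrite /Rintegral; apply: (fine_cvg (f := fun n => integral mu D (fun x => (p (f_ n x))%:E))).
  by rewrite e; exact: H.
apply: ReIm_ccvg.
  rewrite Re_CInt; under eq_fun do rewrite Re_CInt.
  apply: key => //; [exact: Re_le_cabs|by move=> n; have [] := mf_ n|by have [] := mf|].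
  by move=> u l /ccvg_ReIm[].
rewrite Im_CInt; under eq_fun do rewrite Im_CInt.
apply: key => //; [exact: Im_le_cabs|by move=> n; have [] := mf_ n|by have [] := mf|].
by move=> u l /ccvg_ReIm[].
Unshelve. all: by end_near. Qed.

End ComplexIntegral.

(** * Lebesgue integrals on the line: Fubini, invariance, continuity, the fundamental theorem *)

Section LebesgueIntegral.
Variable R : realType.
Local Notation T := (measurableTypeR R).
Local Notation lam := (@leb R).

Lemma measurable_itvT (i : interval R) : @measurable _ T [set` i].
Proof. exact: measurable_itv. Qed.

Section Fubini.
Variables (a b : T -> R).
Hypotheses (ia : lam.-integrable setT (EFin \o a)) (ib : lam.-integrable setT (EFin \o b)).

Lemma product_integrable (f : T * T -> R) :
  measurable_fun setT f -> (forall p, `|f p| <= a p.1 * b p.2) ->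
  (lam \x lam)%E.-integrable setT (fun p => (f p)%:E).
Proof.
move=> mf fab.
have [ma ia'] := integrableP _ _ _ ia; have [mb ib'] := integrableP _ _ _ ib.
have mab : measurable_fun setT (fun p : T * T => (a p.1 * b p.2)%:E).
  apply/measurable_EFinP; apply: measurable_funM.
    by apply: measurableT_comp measurable_fst; exact/measurable_EFinP.
  by apply: measurableT_comp measurable_snd; exact/measurable_EFinP.
suff H : (lam \x lam)%E.-integrable setT (fun p : T * T => (a p.1 * b p.2)%:E).
  apply: (le_integrable measurableT _ _ H); first exact/measurable_EFinP.
  by move=> p _ /=; rewrite lee_fin (le_trans (fab _))// ler_norm.
apply/(@integrable12ltyP _ _ T T R lam lam _ mab).
set B := integral lam setT (fun y => `|(b y)%:E|%E) in ib'.
have B0 : (0 <= B)%E by exact: integral_ge0.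
have -> : (\int[lam]_x \int[lam]_y `|(a x * b y)%:E|)%E = (\int[lam]_x (`|(a x)%:E| * B))%E.
  apply: eq_integral => x _; rewrite -ge0_integralZl//; last exact: measurableT_comp.
  by apply: eq_integral => y _; rewrite EFinM abseM.
have Bfin : B \is a fin_num by rewrite ge0_fin_numE.
rewrite -(fineK Bfin); under eq_integral do rewrite muleC.
rewrite ge0_integralZl//; last 2 first.
  exact: measurableT_comp.
  by rewrite lee_fin fine_ge0.
by rewrite lte_mul_pinfty// ?lee_fin ?fine_ge0.
Qed.

Lemma Rintegral_fubini (f : T * T -> R) :
  measurable_fun setT f -> (forall p, `|f p| <= a p.1 * b p.2) ->
  Rintegral lam setT (fun x => Rintegral lam setT (fun y => f (x, y))) =
  Rintegral lam setT (fun y => Rintegral lam setT (fun x => f (x, y))).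
Proof.
move=> mf fab; have H := product_integrable mf fab.
have X x : lam.-integrable setT (fun y => (f (x, y))%:E).
  have := integrableZl measurableT (a x) ib.
  apply: le_integrable => //.
    by apply/measurable_EFinP; exact: measurable_fun_pair2.
  by move=> y _; rewrite /= lee_fin (le_trans (fab _))//= ler_norm.
have Y y : lam.-integrable setT (fun x => (f (x, y))%:E).
  have := integrableZl measurableT (b y) ia.
  apply: le_integrable => //.
    by apply/measurable_EFinP; exact: measurable_fun_pair1.
  by move=> x _; rewrite /= lee_fin (le_trans (fab _))//= mulrC ler_norm.
rewrite /Rintegral; congr fine.
transitivity (\int[lam]_x \int[lam]_y (f (x, y))%:E)%E.
  by apply: eq_integral => x _; rewrite fineK//; exact: integrable_fin_num.
rewrite (Fubini H).
by apply: eq_integral => y _; rewrite fineK//; exact: integrable_fin_num.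
Qed.

Lemma CInt_fubini (F : T * T -> R[i]) : cmeas setT F ->
  (forall p, cabs (F p) <= a p.1 * b p.2) ->
  CInt lam setT (fun x => CInt lam setT (fun y => F (x, y))) =
  CInt lam setT (fun y => CInt lam setT (fun x => F (x, y))).
Proof.
move=> [m1 m2] Fab; apply: complex_ext.
  rewrite [LHS]Re_CInt [RHS]Re_CInt.
  under eq_Rintegral do rewrite Re_CInt.
  under [in RHS]eq_Rintegral do rewrite Re_CInt.
  apply: (Rintegral_fubini m1) => p; exact: le_trans (Re_le_cabs _) (Fab p).
rewrite [LHS]Im_CInt [RHS]Im_CInt.
under eq_Rintegral do rewrite Im_CInt.
under [in RHS]eq_Rintegral do rewrite Im_CInt.
apply: (Rintegral_fubini m2) => p; exact: le_trans (Im_le_cabs _) (Fab p).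
Qed.

End Fubini.

Section ChangeOfVariable.
Variable (s : T -> T).
Hypothesis ms : measurable_fun setT s.
Hypothesis inv_s : forall A : set T, measurable A -> pushforward lam s A = lam A.

(** Nonnegative functions go through the pushforward measure, which is [lam] again. The general case
    subtracts positive and negative parts. *)
Lemma integral_invariant (f : T -> \bar R) : measurable_fun setT f ->
  (\int[lam]_x f (s x) = \int[lam]_x f x)%E.
Proof.
have ge0 (g : T -> \bar R) : measurable_fun setT g -> (forall x, 0 <= g x)%E ->
    (\int[lam]_x g (s x) = \int[lam]_x g x)%E.
  move=> mg g0; have /= := @ge0_integral_pushforward _ _ T T R s ms lam setT g measurableT mg (fun y _ => g0 y).
  rewrite preimage_setT => <-.
  by apply: eq_measure_integral => A mA _; exact: inv_s.
move=> mf; rewrite integralE [RHS]integralE; congr (_ - _)%E.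
  rewrite -(ge0 (f^\+)%E)//; last exact: measurable_funepos.
  by apply: eq_integral => x _; rewrite (funepos_comp f s).
rewrite -(ge0 (f^\-)%E)//; last exact: measurable_funeneg.
by apply: eq_integral => x _; rewrite (funeneg_comp f s).
Qed.

Lemma cintegrable_invariant (g : T -> R[i]) : cintegrable lam setT g ->
  cintegrable lam setT (fun x => g (s x)).
Proof.
move=> ig; have mg := cintegrable_cmeas ig.
have [mc ic] := integrableP _ _ _ (integrable_cabs measurableT ig).
apply: (le_cintegrable (h := fun x => cabs (g (s x)))) => //.
  exact: cmeas_comp.
apply/integrableP; split.
  by apply: (measurableT_comp mc).
by rewrite (integral_invariant (f := fun x => `|(cabs (g x))%:E|%E))//; exact: measurableT_comp.
Qed.

Lemma CInt_invariant (g : T -> R[i]) : cmeas setT g ->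
  CInt lam setT (fun x => g (s x)) = CInt lam setT g.
Proof.
move=> [m1 m2]; apply: complex_ext; rewrite ?Re_CInt ?Im_CInt /Rintegral; congr fine.
  by rewrite (integral_invariant (f := fun x => (complex.Re (g x))%:E))//; exact/measurable_EFinP.
by rewrite (integral_invariant (f := fun x => (complex.Im (g x))%:E))//; exact/measurable_EFinP.
Qed.

End ChangeOfVariable.

Definition translation (c : R) (x : T) : T := x + c.

Lemma measurable_translation (c : R) : measurable_fun setT (translation c).
Proof.
by apply: continuous_measurable_fun => x; apply: cvgD; [exact: cvg_id|exact: cvg_cst].
Qed.

HB.instance Definition _ (c : R) :=
  @isMeasurableFun.Build _ _ T T (translation c) (measurable_translation c).

(** Lebesgue measure is determined by its values on the half-open intervals, and translation maps
    these to intervals of the same length. *)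
Lemma leb_translation (c : R) (A : set T) : measurable A ->
  pushforward lam (translation c) A = lam A.
Proof.
move=> mA; apply/esym/lebesgue_measure_unique => //= _ [[a b]] _ <-.
rewrite /pushforward /leb.
have -> : translation c @^-1` `]a, b]%classic = `]a - c, b - c]%classic.
  apply/seteqP; split=> x; rewrite /translation /= !in_itv/= => /andP[h1 h2];
    by apply/andP; split; lra.
rewrite !lebesgue_measure_itv/= !lte_fin ltrD2r.
by case: ifP => // _; rewrite -!EFinB; congr EFin; ring.
Qed.

Lemma leb_opp (A : set T) : measurable A ->
  pushforward lam (fun x : T => (- x : T)) A = lam A.
Proof. exact: lebesgue_measureN. Qed.

Lemma measurable_oppT : measurable_fun setT (fun x : T => (- x : T)).
Proof. by apply: continuous_measurable_fun => x; apply: cvgN; exact: cvg_id. Qed.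

Definition ccont (g : R -> R[i]) :=
  forall x, (fun y => cabs (g y - g x)) @ x --> (0 : R).

Lemma ccont_ReIm (g : R -> R[i]) : ccont g ->
  continuous (fun x => complex.Re (g x)) /\ continuous (fun x => complex.Im (g x)).
Proof.
move=> H; split=> x; apply/cvgrPdist_lt => e e0;
  have /cvgr0Pnorm_lt/(_ _ e0) := H x; apply: filterS => y; rewrite ger0_norm ?cabs_ge0//;
  apply: le_lt_trans; rewrite cabs_distC.
  by rewrite -ReN -ReD Re_le_cabs.
by rewrite -ImN -ImD Im_le_cabs.
Qed.

Lemma ReIm_ccont (g : R -> R[i]) : continuous (fun x => complex.Re (g x)) ->
  continuous (fun x => complex.Im (g x)) -> ccont g.
Proof.
move=> h1 h2 x; apply/cvgr0Pnorm_lt => e e0.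
have e2 : 0 < e / 2 by rewrite divr_gt0.
near=> y.
rewrite ger0_norm ?cabs_ge0// (le_lt_trans (cabs_le_ReIm _))// !ReImE (splitr e).
rewrite ltrD// distrC.
  by near: y; have /cvgrPdist_lt/(_ _ e2) := h1 x.
by near: y; have /cvgrPdist_lt/(_ _ e2) := h2 x.
Unshelve. all: by end_near. Qed.

Lemma ccont_cmeas (g : R -> R[i]) : ccont g -> cmeas (X := T) setT g.
Proof.
by move=> /ccont_ReIm[h1 h2]; split; exact: continuous_measurable_fun.
Qed.

Lemma ccontM (f g : R -> R[i]) : ccont f -> ccont g -> ccont (fun x => f x * g x).
Proof.
move=> /ccont_ReIm[f1 f2] /ccont_ReIm[g1 g2]; apply: ReIm_ccont => x.
  have -> : (fun y => complex.Re (f y * g y)) = (fun y => complex.Re (f y) * complex.Re (g y) - complex.Im (f y) * complex.Im (g y)) by apply/funext => y; rewrite ReM.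
  by apply: cvgB; apply: cvgM; [exact: f1|exact: g1|exact: f2|exact: g2].
have -> : (fun y => complex.Im (f y * g y)) = (fun y => complex.Re (f y) * complex.Im (g y) + complex.Im (f y) * complex.Re (g y)) by apply/funext => y; rewrite ImM.
by apply: cvgD; apply: cvgM; [exact: f1|exact: g2|exact: f2|exact: g1].
Qed.

Lemma ccont_comp (f : R[i] -> R[i]) (g : R -> R[i]) :
  centire f -> ccont g -> ccont (fun x => f (g x)).
Proof.
move=> ef cg x; have [d /cdiff_lip[r r0 H]] := ef (g x).
have C : (cabs d + 1) * cabs (g y - g x) @[y --> x] --> (0 : R).
  by rewrite -[X in _ --> X](mulr0 (cabs d + 1)); apply: cvgM; [exact: cvg_cst|exact: cg].
have /cvgr0Pnorm_lt/(_ _ r0) near_r := cg x.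
apply: (squeeze_cvgr _ (cvg_cst 0) C).
apply: filterS near_r => y; rewrite ger0_norm ?cabs_ge0// => hy.
by have := H _ hy; rewrite [g x + _]addrC subrK => ->; rewrite ?cabs_ge0.
Qed.

Lemma ccont_real (h : R -> R) : continuous h -> ccont (fun x => (h x)%:C).
Proof. by move=> ch; apply: ReIm_ccont => // x; exact: cvg_cst. Qed.

Lemma ccont_cst (c : R[i]) : ccont (fun _ => c).
Proof. by apply: ReIm_ccont => x; exact: cvg_cst. Qed.

Lemma ccontD (f g : R -> R[i]) : ccont f -> ccont g -> ccont (fun x => f x + g x).
Proof.
move=> /ccont_ReIm[f1 f2] /ccont_ReIm[g1 g2]; apply: ReIm_ccont => x.
  have -> : (fun y => complex.Re (f y + g y)) = (fun y => complex.Re (f y) + complex.Re (g y)) by apply/funext => y; rewrite ReD.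
  by apply: cvgD; [exact: f1|exact: g1].
have -> : (fun y => complex.Im (f y + g y)) = (fun y => complex.Im (f y) + complex.Im (g y)) by apply/funext => y; rewrite ImD.
by apply: cvgD; [exact: f2|exact: g2].
Qed.

Lemma ccontN (f : R -> R[i]) : ccont f -> ccont (fun x => - f x).
Proof. by move=> cf x; under eq_fun do rewrite -opprD cabsN; exact: cf. Qed.

Lemma ccont_cintegrable (g : R -> R[i]) (a b : R) : ccont g ->
  cintegrable lam `[a, b] g.
Proof.
move=> /ccont_ReIm[h1 h2].
by split; apply: continuous_compact_integrable; (try exact: segment_compact);
  exact: continuous_subspaceT.
Qed.

Lemma CInt_FTC (F f : R -> R[i]) (a b : R) : a < b ->
  (forall x : R, is_derive x 1 (fun y : R => complex.Re (F y)) (complex.Re (f x))) ->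
  (forall x : R, is_derive x 1 (fun y : R => complex.Im (F y)) (complex.Im (f x))) ->
  ccont f -> CInt lam `[a, b] f = F b - F a.
Proof.
move=> ab d1 d2 /ccont_ReIm[c1 c2].
have H (G g : R -> R) : (forall x : R, is_derive x 1 G (g x)) -> continuous g ->
    Rintegral lam `[a, b] g = G b - G a.
  move=> dG cg; rewrite /Rintegral (continuous_FTC2 (F := G) ab)//.
  - exact: continuous_subspaceT.
  - have cG : continuous G.
      by move=> x; apply: differentiable_continuous; apply/derivable1_diffP; have [] := dG x.
    split.
    + by move=> x _; have [] := dG x.
    + by apply: cvg_at_right_filter; exact: cG.
    + by apply: cvg_at_left_filter; exact: cG.
  - by move=> x _; rewrite derive1E; have [] := dG x.
apply: complex_ext.
  by rewrite Re_CInt ReD ReN; exact: (H (fun x => complex.Re (F x))).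
by rewrite Im_CInt ImD ImN; exact: (H (fun x => complex.Im (F x))).
Qed.

Lemma Rintegral_itv_split (g : R -> R) (a c b : R) : a <= c -> c <= b ->
  lam.-integrable `[a, b] (EFin \o g) ->
  Rintegral lam `[a, b] g = Rintegral lam `[a, c] g + Rintegral lam `[c, b] g.
Proof.
move=> ac cb ig.
have := @Rintegral_itvB R g (BLeft a) (BRight b) c ig; rewrite !bnd_simp => /(_ ac cb).
rewrite Rintegral_itv_obnd_cbnd; last first.
  apply: integrableS ig => //; apply: subset_itvr; by rewrite bnd_simp.
by move=> <-; rewrite addrC subrK.
Qed.

Lemma CInt_itv_split (g : R -> R[i]) (a c b : R) : a <= c -> c <= b -> ccont g ->
  CInt lam `[a, b] g = CInt lam `[a, c] g + CInt lam `[c, b] g.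
Proof.
move=> ac cb cg; have [i1 i2] := ccont_cintegrable a b cg.
apply: complex_ext; [rewrite [RHS]ReD !Re_CInt|rewrite [RHS]ImD !Im_CInt].
  exact: Rintegral_itv_split ac cb i1.
exact: Rintegral_itv_split ac cb i2.
Qed.

Lemma fine_leb_itv (a b : R) : a <= b -> fine (lam `[a, b]) = b - a.
Proof.
rewrite /leb lebesgue_measure_itv/= lte_fin le_eqVlt => /predU1P[->|->//].
by rewrite ltxx subrr.
Qed.

Lemma integrable_itv_cst (a b c : R) : lam.-integrable `[a, b] (EFin \o (fun _ : T => c)).
Proof.
apply: continuous_compact_integrable; first exact: segment_compact.
by apply: continuous_subspaceT => x; exact: cvg_cst.
Qed.

Lemma cabs_CInt_itv_le (g : R -> R[i]) (a b M : R) : a <= b -> ccont g ->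
  (forall x, a <= x <= b -> cabs (g x) <= M) ->
  cabs (CInt lam `[a, b] g) <= 2 * M * (b - a).
Proof.
move=> ab cg gM.
have := @cabs_CInt_le R lam `[a, b] g (fun _ => M) (measurable_itvT _) (cintegrable_cmeas (ccont_cintegrable a b cg)).
rewrite Rintegral_cst// fine_leb_itv// mulrA; apply.
  by move=> x /=; rewrite in_itv/= => /gM.
exact: integrable_itv_cst.
Qed.

End LebesgueIntegral.

(** * Goursat's theorem for rectangles *)

Section Goursat.
Variable R : realType.
Local Notation lam := (@leb R).
Variable g : R[i] -> R[i].
Hypothesis eg : centire g.

Let hor (y a b : R) := CInt lam `[a, b] (fun s : R => g (s +i* y)).
Let ver (x a b : R) := CInt lam `[a, b] (fun s : R => g (x +i* s)).

(** Counterclockwise boundary integral of g(z) dz over the rectangle with lower left corner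
    [x +i* y], width [l] and height [m]; the factor ['i] is dz on the vertical sides. *)
Definition rect_integral (x y l m : R) : R[i] :=
  hor y x (x + l) - hor (y + m) x (x + l)
  + 'i * (ver (x + l) y (y + m) - ver x y (y + m)).

Lemma ccont_hor (y : R) : ccont (fun s : R => g (s +i* y)).
Proof.
by apply: ccont_comp => //; apply: ReIm_ccont => x /=; [exact: cvg_id|exact: cvg_cst].
Qed.

Lemma ccont_ver (x : R) : ccont (fun s : R => g (x +i* s)).
Proof.
by apply: ccont_comp => //; apply: ReIm_ccont => y /=; [exact: cvg_cst|exact: cvg_id].
Qed.

Lemma CInt_itv_cst (c : R[i]) (a b : R) : a <= b ->
  CInt lam `[a, b] (fun _ => c) = c * (b - a)%:C.
Proof.
move=> ab; apply: complex_ext.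
  by rewrite Re_CInt Rintegral_cst// fine_leb_itv// ReM /= mulr0 subr0.
by rewrite Im_CInt Rintegral_cst// fine_leb_itv// ImM /= mulr0 add0r.
Qed.

Lemma rect_integral_quarter (x y l m : R) : 0 <= l -> 0 <= m ->
  rect_integral x y (l + l) (m + m) =
  rect_integral x y l m + rect_integral (x + l) y l m
  + rect_integral x (y + m) l m + rect_integral (x + l) (y + m) l m.
Proof.
move=> l0 m0; rewrite /rect_integral (addrA x l l) (addrA y m m).
have Hs z : hor z x (x + l + l) = hor z x (x + l) + hor z (x + l) (x + l + l).
  by apply: CInt_itv_split; rewrite ?lerDl//; exact: ccont_hor.
have Vs z : ver z y (y + m + m) = ver z y (y + m) + ver z (y + m) (y + m + m).
  by apply: CInt_itv_split; rewrite ?lerDl//; exact: ccont_ver.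
rewrite !Hs !Vs; ring.
Qed.

(** Pigeonhole: of the four quarters, one carries at least a quarter of the modulus. *)
Lemma rect_integral_split (x y l m : R) : 0 <= l -> 0 <= m ->
  exists p : R * R, [/\ x <= p.1 <= x + l, y <= p.2 <= y + m &
  cabs (rect_integral x y (l + l) (m + m)) / 4 <= cabs (rect_integral p.1 p.2 l m)].
Proof.
move=> l0 m0; rewrite rect_integral_quarter//.
set A := rect_integral _ _ _ _; set B := rect_integral _ _ _ _.
set C := rect_integral _ _ _ _; set D := rect_integral _ _ _ _.
have H : cabs (A + B + C + D) <= cabs A + cabs B + cabs C + cabs D.
  by rewrite (le_trans (cabsD _ _))// lerD2r (le_trans (cabsD _ _))// lerD2r cabsD.
set S := cabs (A + B + C + D) in H *.
have [hA|hA] := leP (S / 4) (cabs A).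
  by exists (x, y); rewrite /= !lexx !lerDl l0 m0.
have [hB|hB] := leP (S / 4) (cabs B).
  by exists (x + l, y); rewrite /= !lexx !lerDl l0 m0.
have [hC|hC] := leP (S / 4) (cabs C).
  by exists (x, y + m); rewrite /= !lexx !lerDl l0 m0.
have [hD|hD] := leP (S / 4) (cabs D).
  by exists (x + l, y + m); rewrite /= !lexx !lerDl l0 m0.
by exfalso; clearbody S A B C D; lra.
Qed.

(** The affine part g(z0) + d (z - z0) has zero boundary integral: its horizontal sides give - d i m
    l, and ['i] times its vertical sides cancels this. Only the remainder [E] is left. In the
    constant 4, one factor 2 counts the two opposite sides and the other comes from
    [cabs_CInt_itv_le]. *)
Lemma rect_integral_le (x y l m e : R) (z0 d : R[i]) : 0 <= l -> 0 <= m ->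
  (forall a b : R, x <= a <= x + l -> y <= b <= y + m ->
     cabs (g (a +i* b) - g z0 - d * (a +i* b - z0)) <= e) ->
  cabs (rect_integral x y l m) <= 4 * e * (l + m).
Proof.
move=> l0 m0 H.
pose E z := g z - g z0 - d * (z - z0).
have xl : x <= x + l by rewrite lerDl.
have ym : y <= y + m by rewrite lerDl.
have eE : centire E.
  move=> z; have [f F] := eg z; exists (f - d) => e' e'0.
  have [r r0 Hr] := F e' e'0; exists r => // h hr.
  have -> : E (z + h) - E z - (f - d) * h = g (z + h) - g z - f * h by rewrite /E; ring.
  exact: Hr.
have cEh (b : R) : ccont (fun s : R => E (s +i* b)).
  by apply: ccont_comp => //; apply: ReIm_ccont => u /=; [exact: cvg_id|exact: cvg_cst].
have cEv (a : R) : ccont (fun s : R => E (a +i* s)).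
  by apply: ccont_comp => //; apply: ReIm_ccont => u /=; [exact: cvg_cst|exact: cvg_id].
have Hh : hor y x (x + l) - hor (y + m) x (x + l) =
    CInt lam `[x, x + l] (fun s : R => E (s +i* y) - E (s +i* (y + m))) - d * ('i * m%:C) * l%:C.
  rewrite /hor -CIntB//; [|exact: ccont_cintegrable (ccont_hor _)..].
  have -> : d * ('i * m%:C) * l%:C = CInt lam `[x, x + l] (fun _ => d * ('i * m%:C)).
    by rewrite CInt_itv_cst// addrC addKr.
  rewrite -CIntB//; [|exact: ccont_cintegrable (ccontD (cEh _) (ccontN (cEh _)))|exact: ccont_cintegrable (ccont_cst _)].
  apply: eq_CInt => s _; rewrite /E.
  have -> : s +i* (y + m) = s +i* y + 'i * m%:C.
    by apply: complex_ext; rewrite !ReImE /=; ring.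
  ring.
have Hv : ver (x + l) y (y + m) - ver x y (y + m) =
    CInt lam `[y, y + m] (fun s : R => E ((x + l) +i* s) - E (x +i* s)) + d * l%:C * m%:C.
  rewrite /ver -CIntB//; [|exact: ccont_cintegrable (ccont_ver _)..].
  have -> : d * l%:C * m%:C = CInt lam `[y, y + m] (fun _ => d * l%:C).
    by rewrite CInt_itv_cst// addrC addKr.
  rewrite -CIntD//; [|exact: ccont_cintegrable (ccontD (cEv _) (ccontN (cEv _)))|exact: ccont_cintegrable (ccont_cst _)].
  apply: eq_CInt => s _; rewrite /E.
  have -> : (x + l) +i* s = x +i* s + l%:C.
    by apply: complex_ext; rewrite !ReImE /=; ring.
  ring.
have -> : rect_integral x y l m =
    CInt lam `[x, x + l] (fun s : R => E (s +i* y) - E (s +i* (y + m)))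
    + 'i * CInt lam `[y, y + m] (fun s : R => E ((x + l) +i* s) - E (x +i* s)).
  by rewrite /rect_integral Hh Hv; ring.
rewrite (le_trans (cabsD _ _))// cabsM cabs_i mul1r.
have b1 : cabs (CInt lam `[x, x + l] (fun s : R => E (s +i* y) - E (s +i* (y + m)))) <= 2 * (2 * e) * (x + l - x).
  apply: cabs_CInt_itv_le => //; first exact: (ccontD (cEh _) (ccontN (cEh _))).
  move=> s hs; rewrite (le_trans (cabsB _ _))// mulrDl mul1r lerD//; apply: H => //;
    by rewrite lexx ym.
have b2 : cabs (CInt lam `[y, y + m] (fun s : R => E ((x + l) +i* s) - E (x +i* s))) <= 2 * (2 * e) * (y + m - y).
  apply: cabs_CInt_itv_le => //; first exact: (ccontD (cEv _) (ccontN (cEv _))).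
  move=> s hs; rewrite (le_trans (cabsB _ _))// mulrDl mul1r lerD//; apply: H => //;
    by rewrite lexx xl.
lra.
Qed.

(** The intervals from [p n] to [p n + L / 2 ^+ n] are nested, and the supremum of their left ends
    lies in all of them. Applied to each coordinate, this locates the point to which the rectangles
    shrink. *)
Lemma nested_limit (p : nat -> R) (L : R) : 0 <= L ->
  (forall n, p n <= p n.+1 <= p n + L / 2 ^+ n.+1) ->
  exists c, forall n, p n <= c <= p n + L / 2 ^+ n.
Proof.
move=> L0 H.
have inc n k : p n <= p (n + k)%N.
  by elim: k => [|k IH]; rewrite ?addn0// addnS (le_trans IH)//; have /andP[] := H (n + k)%N.
have dec n k : p (n + k)%N + L / 2 ^+ (n + k) <= p n + L / 2 ^+ n.
  elim: k => [|k IH]; rewrite ?addn0// addnS (le_trans _ IH)//.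
  have /andP[_] := H (n + k)%N.
  have -> : L / 2 ^+ (n + k) = L / 2 ^+ (n + k).+1 + L / 2 ^+ (n + k).+1.
    by rewrite exprS; field; rewrite expf_neq0.
  lra.
have pos n : 0 <= L / 2 ^+ n by rewrite divr_ge0// exprn_ge0.
have ub n : ubound (range p) (p n + L / 2 ^+ n).
  move=> _ [m _ <-]; have [mn|nm] := leP m n.
    have := inc m (n - m)%N; rewrite subnKC// => h; by apply: le_trans h _; rewrite lerDl.
  have := dec n (m - n)%N; rewrite subnKC 1?ltnW// => h.
  by apply: le_trans h; rewrite lerDl.
exists (sup (range p)) => n; apply/andP; split.
  by apply: ub_le_sup; [exists (p 0%N + L / 2 ^+ 0); exact: ub|exists n].
by apply: ge_sup; [exists (p 0%N), 0%N|exact: ub].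
Qed.

Theorem goursat (x y l m : R) : 0 <= l -> 0 <= m -> rect_integral x y l m = 0.
Proof.
move=> l0 m0; apply/eqP; rewrite -cabs_eq0; apply/eqP.
set A := cabs _.
have pos (L : R) n : 0 <= L -> 0 <= L / 2 ^+ n by move=> L0; rewrite divr_ge0// exprn_ge0.
have halve (L : R) n : L / 2 ^+ n = L / 2 ^+ n.+1 + L / 2 ^+ n.+1.
  by rewrite exprS; field; rewrite expf_neq0.
pose P n (p : R * R) := A / 4 ^+ n <= cabs (rect_integral p.1 p.2 (l / 2 ^+ n) (m / 2 ^+ n)).
(* The implication makes [Q] satisfiable at every argument, so [choice] gives a total function;
   along the sequence [s] the premise holds by induction. *)
pose Q (np : nat * (R * R)) (q : R * R) := P np.1 np.2 ->
  [/\ np.2.1 <= q.1 <= np.2.1 + l / 2 ^+ np.1.+1,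
      np.2.2 <= q.2 <= np.2.2 + m / 2 ^+ np.1.+1 & P np.1.+1 q].
have /choice[f Hf] : forall np, exists q, Q np q.
  move=> [n [a b]]; have [h|h] := pselect (P n (a, b)); last by exists (a, b) => /h.
  have [q [q1 q2 q3]] := rect_integral_split a b (pos l n.+1 l0) (pos m n.+1 m0).
  exists q => _; split => //; rewrite /P /=; apply: le_trans q3.
  rewrite -!halve; have := h; rewrite /P /= => h'.
  rewrite exprS invfM mulrCA mulrC ler_wpM2r//.
pose s := fix s n := if n is k.+1 then f (k, s k) else (x, y).
have Ps n : P n (s n).
  elim: n => [|n IH]; first by rewrite /P /= !expr0 !divr1.
  by have [] := Hf (n, s n) IH.
have [cx Hcx] := nested_limit (p := fun n => (s n).1) l0
  (fun n => let: And3 a _ _ := Hf (n, s n) (Ps n) in a).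
have [cy Hcy] := nested_limit (p := fun n => (s n).2) m0
  (fun n => let: And3 _ a _ := Hf (n, s n) (Ps n) in a).
have [d Hd] := eg (cx +i* cy).
pose W := l + m.
have W0 : 0 <= W by rewrite addr_ge0.
(* At stage n the error is at most e W / 2^n and the sides add up to W / 2^n, so the integral is at
   most 4 e W^2 / 4^n. This is compared with the lower bound A / 4^n, and the powers of 4 cancel. *)
have key e : 0 < e -> A <= e * (4 * W * W).
  move=> e0; have [r r0 Hr] := Hd e e0.
  have [n Hn] : exists n : nat, W / 2 ^+ n < r.
    have [n Hn] : exists n : nat, W / r < n%:R.
      exists (Num.truncn (W / r)).+1; exact: truncnS_gt.
    exists n; rewrite ltr_pdivrMr ?exprn_gt0// mulrC -ltr_pdivrMr//.
    rewrite (lt_le_trans Hn)// -natrX ler_nat ltnW// ltn_expl//.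
  have := Ps n; rewrite /P => hP.
  have /(le_trans hP) : cabs (rect_integral (s n).1 (s n).2 (l / 2 ^+ n) (m / 2 ^+ n)) <=
      4 * (e * (W / 2 ^+ n)) * (l / 2 ^+ n + m / 2 ^+ n).
    apply: (@rect_integral_le _ _ _ _ _ (cx +i* cy) d); rewrite ?pos//.
    move=> a b ha hb.
    have hz : cabs (a +i* b - cx +i* cy) <= W / 2 ^+ n.
      rewrite (le_trans (cabs_le_ReIm _))// !ReImE /= mulrDl lerD// ler_norml;
        move: (Hcx n) (Hcy n) => /andP[? ?] /andP[? ?]; move: ha hb => /andP[? ?] /andP[? ?];
        apply/andP; split; lra.
    have := Hr (a +i* b - cx +i* cy) (le_lt_trans hz Hn).
    rewrite [_ + (_ - _)]addrC subrK => /le_trans; apply.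
    by rewrite ler_wpM2l// ltW.
  rewrite -mulrDl -/W ler_pdivrMr ?exprn_gt0//.
  congr (_ <= _).
  have -> : (4 : R) ^+ n = 2 ^+ n * 2 ^+ n by rewrite -exprMn; congr (_ ^+ _); ring.
  by field; rewrite expf_neq0.
apply/eqP; rewrite eq_le cabs_ge0 andbT.
rewrite leNgt; apply/negP => A0.
have K0 : 0 < 4 * W * W + 1 by rewrite ltr_wpDl// !mulr_ge0.
(* With this [e] the bound falls below [A]; the [+ 1] covers the degenerate case [W = 0]. *)
have := key (A / (2 * (4 * W * W + 1))) (divr_gt0 A0 (mulr_gt0 (ltr0n _ 2) K0)).
rewrite leNgt => /negP; apply.
rewrite mulrAC ltr_pdivrMr ?mulr_gt0//.
have K1 : 0 <= 4 * W * W by rewrite !mulr_ge0.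
nra.
Qed.

End Goursat.

(** * Rotation of a half line by a quarter turn *)

Section ContourRotation.
Variable R : realType.
Local Notation T := (measurableTypeR R).
Local Notation lam := (@leb R).

Lemma mem_itv_oy (a y : R) : (y \in `]a, +oo[%classic) = (a < y).
Proof. by rewrite mem_setE in_itv/= andbT. Qed.

Lemma mem_itv_cc (a b y : R) : (y \in `[a, b]%classic) = (a <= y <= b).
Proof. by rewrite mem_setE in_itv. Qed.

Lemma CInt_subst_exp (k : R -> R[i]) (A : R) : 0 <= A -> ccont k ->
  CInt lam `[expR (- A), expR A] (fun y => k (ln y)) =
  CInt lam `[- A, A] (fun s => k s * (expR s)%:C).
Proof.
move=> A0 /ccont_ReIm[k1 k2].
have dE : (@expR R)^`() = expR by apply/funext => x; rewrite derive1E derive_val.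
have H (h : R -> R) : continuous h ->
    Rintegral lam `[expR (- A), expR A] (fun y => h (ln y)) =
    Rintegral lam `[- A, A] (fun s => h s * expR s).
  move=> ch; rewrite /Rintegral; congr fine.
  rewrite (@integration_by_substitution_increasing R expR (fun y => h (ln y)) (- A) A)//.
  - by apply: eq_integral => s _; rewrite dE -[LHS]/((h (ln (expR s)) * expR s)%:E) expRK.
  - by lra.
  - by move=> x y _ _ xy; rewrite ltr_expR.
  - by move=> x _; rewrite dE; exact: continuous_expR.
  - rewrite dE; apply/cvg_ex; exists (expR (- A)).
    by apply: cvg_at_right_filter; exact: continuous_expR.
  - rewrite dE; apply/cvg_ex; exists (expR A).
    by apply: cvg_at_left_filter; exact: continuous_expR.
  - split.
    + by move=> x _; exact: derivable_expR.
    + by apply: cvg_at_right_filter; exact: continuous_expR.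
    + by apply: cvg_at_left_filter; exact: continuous_expR.
  - apply: continuous_in_subspaceT => y; rewrite inE/= in_itv/= => /andP[h1 _].
    apply: continuous_comp; last exact: ch.
    by apply: continuous_ln; rewrite (lt_le_trans _ h1)// expR_gt0.
apply: complex_ext.
  rewrite !Re_CInt (H _ k1); apply: eq_Rintegral => s _.
  by rewrite ReM /= mulr0 subr0.
rewrite !Im_CInt (H _ k2); apply: eq_Rintegral => s _.
by rewrite ImM /= mulr0 add0r.
Qed.

Lemma ccvg_le_near (u : nat -> R[i]) l (v : nat -> R) :
  (\forall n \near \oo, cabs (u n - l) <= v n) -> v @ \oo --> (0 : R) -> ccvg u l.
Proof.
move=> uv v0; apply: (squeeze_cvgr _ (cvg_cst 0) v0).
by apply: filterS uv => n ->; rewrite cabs_ge0.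
Qed.

(** For z in the closed fourth quadrant, e^{i pi/4} z has argument at most pi/4 in absolute value,
    and its 3/2 power at most 3 pi/8. This is below pi/2, so the real part stays comparable to
    |z|^{3/2}. *)
Lemma cos_lower (x : R) : `|x| <= 3 / 8 * pi -> cos (3 / 8 * pi) <= cos x.
Proof.
have p0 := pi_gt0 R => hx.
have -> : cos x = cos `|x| by rewrite normrEsign; case: (x < 0); rewrite ?expr0 ?expr1 ?mul1r ?mulN1r ?cosN.
rewrite leNgt ltr_cos ?in_itv/= ?normr_ge0 -?leNgt//; apply/andP; split; lra.
Qed.

(* [damp d] is exp(-d (e^{i pi/4} e^w)^{3/2}): on the strip -pi/2 <= Im w <= 0 it has modulus at
   most 1 and it beats every exponential of |e^w|. *)
Definition damp (d : R) (w : R[i]) : R[i] :=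
  cexp (- d%:C * cexp (0 +i* (3 / 8 * pi)) * cexp ((3 / 2)%:C * w)).

Lemma cabs_damp_le (d a b : R) : 0 <= d -> - (pi / 2) <= b <= 0 ->
  cabs (damp d (a +i* b)) <= expR (- (d * cos (3 / 8 * pi) * expR (3 / 2 * a))).
Proof.
move=> d0 hb; have p0 := pi_gt0 R.
have E z : complex.Re (- d%:C * z) = - (d * complex.Re z).
  by case: z => u v /=; ring.
rewrite /damp -mulrA -cexpD cabs_cexp ler_expR E lerN2 Re_cexp.
rewrite !ReImE /= !mul0r subr0 add0r addr0 -[d * _ * expR _]mulrA ler_wpM2l// [cos _ * _]mulrC.
rewrite ler_wpM2l ?expR_ge0// cos_lower// ler_norml; apply/andP; split; lra.
Qed.

Lemma centire_damp (d : R) : centire (damp d).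
Proof.
have H (c : R[i]) (f : R[i] -> R[i]) : centire f -> centire (fun w => c * f w).
  by move=> ef; apply: centireM => //; exact: centire_cst.
rewrite /damp; apply: centire_comp (@centire_cexp R); apply: (H _).
by apply: centire_comp (@centire_cexp R); apply: (H _); exact: centire_id.
Qed.

Lemma cos_damp_gt0 : 0 < cos (3 / 8 * pi : R).
Proof. by apply: cos_gt0_pihalf; have p0 := pi_gt0 R; apply/andP; split; lra. Qed.

Lemma cabs_damp_le1 (d a b : R) : 0 <= d -> - (pi / 2) <= b <= 0 ->
  cabs (damp d (a +i* b)) <= 1.
Proof.
move=> d0 hb; rewrite (le_trans (cabs_damp_le _ d0 hb))// expR_le1 oppr_le0.
by rewrite mulr_ge0 ?expR_ge0// mulr_ge0// ltW// cos_damp_gt0.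
Qed.

Lemma damp_cvg (w : R[i]) : ccvg (fun n => damp (n.+1%:R^-1) w) 1.
Proof.
have C : ccont (fun r : R =>
    cexp (- r%:C * cexp (0 +i* (3 / 8 * pi)) * cexp ((3 / 2)%:C * w))).
  apply: ccont_comp; first exact: centire_cexp.
  apply: ccontM; last exact: ccont_cst.
  apply: ccontM; last exact: ccont_cst.
  by apply: ccontN; apply: ccont_real => x; exact: cvg_id.
have D0 : damp 0 w = 1 by rewrite /damp oppr0 !mul0r cexp0.
have := C 0; rewrite -/(damp 0 w) D0 => C0.
by rewrite /ccvg; apply: (cvg_comp _ _ (@cvg_harmonic R) C0).
Qed.

Section Rotation.
Variables (G : R[i] -> R[i]) (M C : R).
Hypotheses (eG : centire G) (M0 : 0 <= M) (C0 : 0 <= C).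
Hypothesis expG : forall z, cabs (G z) <= M * expR (C * cabs z).

(** The contour runs over N^-4 <= |z| <= N^4 with damping parameter 1/N. At radius N^4 the damping
    exponent is of size N^-1 (N^4)^{3/2} = N^5, which beats the growth exponent C N^4. The factor
    [cexp w] in [g] is the Jacobian of z = e^w. *)
Let N (n : nat) : R := n.+1%:R.
Let A n : R := 4 * ln (N n).
Let g n w := G (cexp w) * cexp w * damp (N n)^-1 w.

Let N1 n : 1 <= N n. Proof. by rewrite /N ler1n. Qed.
Let N0 n : 0 < N n. Proof. by rewrite /N ltr0n. Qed.
Let A0 n : 0 <= A n. Proof. by rewrite /A mulr_ge0// ln_ge0. Qed.
Let expA n : expR (A n) = N n ^+ 4.
Proof. by rewrite /A expRM_natl lnK// posrE. Qed.
Let expA32 n : expR (3 / 2 * A n) = N n ^+ 6.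
Proof.
have -> : 3 / 2 * A n = 6 * ln (N n) by rewrite /A; field.
by rewrite expRM_natl lnK// posrE.
Qed.

Let eg n : centire (g n).
Proof.
apply: centireM; last exact: centire_damp.
by apply: centireM; [apply: centire_comp => //|]; exact: centire_cexp.
Qed.

Let cabs_g n w : cabs (g n w) =
  cabs (G (cexp w)) * expR (complex.Re w) * cabs (damp (N n)^-1 w).
Proof.
by rewrite /g (cabsM (G (cexp w) * cexp w)) (cabsM (G (cexp w))) cabs_cexp.
Qed.

Let ver_right n (b : R) : - (pi / 2) <= b <= 0 ->
  cabs (g n (A n +i* b)) <=
  M * N n ^+ 4 * expR (C * N n ^+ 4 - cos (3 / 8 * pi) * N n ^+ 5).
Proof.
move=> hb; rewrite cabs_g [complex.Re _]/= expA.
have h1 : cabs (G (cexp (A n +i* b))) <= M * expR (C * N n ^+ 4).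
  by have := expG (cexp (A n +i* b)); rewrite cabs_cexp /= expA.
have h2 : cabs (damp (N n)^-1 (A n +i* b)) <= expR (- (cos (3 / 8 * pi) * N n ^+ 5)).
  have i0 : 0 <= (N n)^-1 by rewrite invr_ge0 ltW.
  have := cabs_damp_le (A n) i0 hb; rewrite expA32.
  by congr (_ <= expR (- _)); field; rewrite gt_eqF.
have p4 : 0 <= N n ^+ 4 by rewrite exprn_ge0// ltW.
rewrite expRD [leRHS](_ : _ =
  (M * expR (C * N n ^+ 4)) * N n ^+ 4 * expR (- (cos (3 / 8 * pi) * N n ^+ 5))); last by ring.
apply: ler_pM => //; rewrite ?cabs_ge0// ?mulr_ge0 ?cabs_ge0//.
by apply: ler_pM => //; rewrite cabs_ge0.
Qed.

(** Near the origin [G] is bounded by M e^C, and smallness comes from the Jacobian, of modulus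
    N^-4. *)
Let ver_left n (b : R) : - (pi / 2) <= b <= 0 ->
  cabs (g n ((- A n) +i* b)) <= M * expR C * (N n)^-1.
Proof.
move=> hb; rewrite cabs_g [complex.Re _]/= expRN expA.
have i0 : 0 <= (N n)^-1 by rewrite invr_ge0 ltW.
have h0 : (N n ^+ 4)^-1 <= (N n)^-1.
  by rewrite lef_pV2 ?posrE ?exprn_gt0// -[leLHS]expr1 ler_weXn2l.
have h3 : (N n)^-1 <= 1 by rewrite invf_le1.
have h1 : cabs (G (cexp ((- A n) +i* b))) <= M * expR C.
  have := expG (cexp ((- A n) +i* b)); rewrite cabs_cexp /= expRN expA.
  move=> /le_trans; apply; rewrite ler_wpM2l// ler_expR -[leRHS]mulr1 ler_wpM2l//.
  exact: le_trans h0 h3.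
have h2 : cabs (damp (N n)^-1 ((- A n) +i* b)) <= 1.
  exact: cabs_damp_le1.
have p4 : 0 <= (N n ^+ 4)^-1 by rewrite invr_ge0 exprn_ge0// ltW.
rewrite -[leRHS]mulr1; apply: ler_pM => //; rewrite ?cabs_ge0// ?mulr_ge0 ?cabs_ge0//.
by apply: ler_pM => //; rewrite cabs_ge0.
Qed.

(** Under the hypothesis the exponent is at most - N^4. With x = N^4, e^x >= 1 + x^2 / 2 gives x
    e^{-x} <= 2 / x, and 2 / N^4 <= 2 / N. *)
Let right_small n : C + 1 <= cos (3 / 8 * pi) * N n ->
  M * N n ^+ 4 * expR (C * N n ^+ 4 - cos (3 / 8 * pi) * N n ^+ 5) <= 2 * M * (N n)^-1.
Proof.
move=> hn; have n0 := N0 n; have n1 := N1 n.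
have p4 : 0 < N n ^+ 4 by rewrite exprn_gt0.
have h1 : C * N n ^+ 4 - cos (3 / 8 * pi) * N n ^+ 5 <= - N n ^+ 4.
  have := ler_wpM2r (ltW p4) hn; rewrite (exprS _ 4).
  by move: (cos _) (N n ^+ 4) (N n) => u v w; lra.
have h2 : expR (C * N n ^+ 4 - cos (3 / 8 * pi) * N n ^+ 5) <= expR (- N n ^+ 4).
  by rewrite ler_expR.
have h3 : N n ^+ 4 * expR (- N n ^+ 4) <= 2 * (N n)^-1.
  have := expR_ge1Dxn 1 (ltW p4); rewrite expRN => h.
  have e0 := expR_gt0 (N n ^+ 4).
  rewrite ler_pdivrMr// -mulrA mulrCA -ler_pdivrMl ?invr_gt0// invrK.
  have h4 : N n * N n ^+ 4 <= (N n ^+ 4) ^+ 2.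
    by rewrite -exprS -exprM ler_weXn2l.
  have : (N n ^+ 4) ^+ 2 <= 2 * expR (N n ^+ 4) by move: h; rewrite (_ : 2`! = 2)%N//;
      move: (_ ^+ 2) (expR _) => u v; lra.
  by move=> h5; exact: le_trans h4 h5.
have := ler_wpM2l M0 (le_trans (ler_wpM2l (ltW p4) h2) h3).
by congr (_ <= _); ring.
Qed.

(** In the z plane these vertical sides are the quarter circles of radii N^4 and N^-4; both
    contributions are O(1 / N). *)
Lemma rotated_sides_cvg : ccvg (fun n =>
  'i * (CInt lam `[- (pi / 2), - (pi / 2) + pi / 2] (fun s : R => g n ((- A n + (A n + A n)) +i* s))
     - CInt lam `[- (pi / 2), - (pi / 2) + pi / 2] (fun s : R => g n ((- A n) +i* s)))) 0.
Proof.
have p0 := pi_gt0 R.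
pose K := pi * (2 * M) + pi * (M * expR C).
apply: (@ccvg_le_near _ _ (fun n => K * n.+1%:R^-1)); last first.
  rewrite -[X in _ --> X](mulr0 K); apply: cvgM; first exact: cvg_cst.
  exact: cvg_harmonic.
have [m hm] : exists m : nat, forall n, (m <= n)%N -> C + 1 <= cos (3 / 8 * pi) * N n.
  exists (Num.truncn ((C + 1) / cos (3 / 8 * pi))) => n mn.
  rewrite mulrC -ler_pdivrMr ?cos_damp_gt0// ltW// (lt_le_trans (truncnS_gt _))//.
  by rewrite /N ler_nat ltnS.
exists m => // n /= mn; rewrite subr0 cabsM cabs_i mul1r (le_trans (cabsB _ _))//.
rewrite [leRHS]mulrDl lerD//.
  have -> : pi * (2 * M) * n.+1%:R^-1 = 2 * (2 * M * (N n)^-1) * (- (pi / 2) + pi / 2 - - (pi / 2)).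
    by rewrite -/(N n); move: (N n)^-1 => u; field.
  apply: cabs_CInt_itv_le; [lra|exact: ccont_ver|move=> x hx].
  have -> : - A n + (A n + A n) = A n by ring.
  rewrite (le_trans (ver_right _ _))//; first by rewrite addNr in hx.
  exact: right_small (hm _ mn).
have -> : pi * (M * expR C) * n.+1%:R^-1 = 2 * (M * expR C * (N n)^-1) * (- (pi / 2) + pi / 2 - - (pi / 2)).
  by rewrite -/(N n); move: (N n)^-1 => u; field.
apply: cabs_CInt_itv_le; [lra|exact: ccont_ver|move=> x hx].
by rewrite ver_left//; rewrite addNr in hx.
Qed.

(** The side Im w = b is the ray of direction [u], which is e^{ib}. On it the damping is bounded by
    1 and tends to 1, so [G] restricted to the ray serves as the dominating function. *)
Lemma ray_cvg (b : R) (u : R[i]) : - (pi / 2) <= b <= 0 ->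
  (forall s, cexp (s +i* b) = u * (expR s)%:C) ->
  cintegrable lam `]0, +oo[ (fun y : R => G (u * y%:C)) ->
  ccvg (fun n => CInt lam `[- A n, - A n + (A n + A n)] (fun s : R => g n (s +i* b)))
    (u * CInt lam `]0, +oo[ (fun y : R => G (u * y%:C))).
Proof.
move=> hb hu iG.
pose k n s := u * (G (u * (expR s)%:C) * damp (N n)^-1 (s +i* b)).
have ck n : ccont (k n).
  apply: ccontM; first exact: ccont_cst.
  apply: ccontM; last first.
    by apply: (ccont_hor _ (g := damp (N n)^-1)); exact: centire_damp.
  apply: ccont_comp => //; apply: ccontM; first exact: ccont_cst.
  by apply: ccont_real; exact: continuous_expR.
have -> : (fun n => CInt lam `[- A n, - A n + (A n + A n)] (fun s : R => g n (s +i* b))) =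
    (fun n => CInt lam setT (fun y : T => if y \in `[expR (- A n), expR (A n)]%classic
       then k n (ln y) else 0)).
  apply/funext => n; rewrite -CInt_restrict CInt_subst_exp//.
  have -> : - A n + (A n + A n) = A n by ring.
  by apply: eq_CInt => s _; rewrite /g /k hu; ring.
rewrite -CIntZ//.
rewrite (CInt_restrict _ `]0, +oo[).
have [mc ic] := integrableP _ _ _ (integrable_cabs (measurable_itvT _) iG).
apply: (@CInt_dominated_cvg _ _ _ _ _
  (fun y : T => if y \in `]0, +oo[%classic then cabs (u * G (u * y%:C)) else 0)) => //.
- move=> n; apply: cmeas_restrict; first exact: measurable_itvT.
  apply: cmeasS (subsetT _) _ => //.
  apply: cmeas_comp; first exact: measurable_ln.
  exact: ccont_cmeas.
- apply: cmeas_restrict; first exact: measurable_itvT.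
  by apply: cmeasM; [exact: cmeas_cst|exact: cintegrable_cmeas iG].
- apply: aeW => y _; rewrite mem_itv_oy; have [y0|y0] := ltP 0 y; last first.
    apply: (@ccvg_le _ _ _ (fun _ => 0)); last exact: cvg_cst.
    move=> n; rewrite subr0 mem_itv_cc ifF ?cabs0//; apply/negP => /andP[h _].
    by have := lt_le_trans (expR_gt0 _) h; rewrite ltNge y0.
  have D := ccvgZ (u * G (u * y%:C)) (damp_cvg (ln y +i* b)); rewrite mulr1 in D.
  apply: (squeeze_cvgr _ (cvg_cst 0) D).
  (* As soon as y + 1/y <= N, the point [y] lies between N^-4 and N^4. *)
  have [m hm] : exists m : nat, forall n, (m <= n)%N -> y \in `[expR (- A n), expR (A n)]%classic.
    exists (Num.truncn (y + y^-1)) => n mn.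
    have hN : y + y^-1 <= N n.
      by rewrite ltW// (lt_le_trans (truncnS_gt _))// /N ler_nat ltnS.
    have yi0 : 0 < y^-1 by rewrite invr_gt0.
    have h4 : N n <= N n ^+ 4 by rewrite -[leLHS]expr1 ler_weXn2l.
    rewrite mem_itv_cc expRN expA; apply/andP; split.
      rewrite -[leRHS]invrK lef_pV2 ?posrE ?exprn_gt0//.
      by rewrite (le_trans _ h4)// (le_trans _ hN)// lerDr ltW.
    by rewrite (le_trans _ h4)// (le_trans _ hN)// lerDl ltW.
  exists m => // n /= mn; rewrite (hm _ mn) /k lnK ?posrE// mulrA lexx andbT.
  exact: cabs_ge0.
- rewrite [X in _.-integrable _ X](_ : _ = (EFin \o (fun y => cabs u * cabs (G (u * y%:C)))) \_ `]0, +oo[).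
    apply/integrable_restrict; rewrite ?setTI//.
    have := integrableZl (measurable_itvT _) (cabs u) (integrable_cabs (measurable_itvT _) iG).
    exact.
  apply/funext => y; rewrite patchE /=; case: ifP => // _; by rewrite cabsM.
- move=> n y _; case: ifPn => hy; last first.
    by rewrite cabs0; case: ifP => // _; exact: cabs_ge0.
  have y0 : 0 < y.
    by move: hy; rewrite mem_itv_cc => /andP[h _]; rewrite (lt_le_trans _ h)// expR_gt0.
  rewrite mem_itv_oy y0.
  rewrite /k lnK ?posrE// mulrA cabsM -[leRHS]mulr1 ler_wpM2l ?cabs_ge0//.
  have i0 : 0 <= (N n)^-1 by rewrite invr_ge0 ltW.
  exact: cabs_damp_le1.
Qed.

(** The bottom side of the rectangle is the negative imaginary axis and the top side the positive
    half line. Goursat makes the total vanish for each n, and the vertical sides disappear in the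
    limit. *)
Theorem contour_rotation :
  cintegrable lam `]0, +oo[ (fun y : R => G y%:C) ->
  cintegrable lam `]0, +oo[ (fun y : R => G (- 'i * y%:C)) ->
  CInt lam `]0, +oo[ (fun y : R => G y%:C) =
  - 'i * CInt lam `]0, +oo[ (fun y : R => G (- 'i * y%:C)).
Proof.
move=> i1 i2; have p0 := pi_gt0 R.
have e1 : (fun y : R => G y%:C) = (fun y : R => G (1 * y%:C)).
  by apply/funext => y; rewrite mul1r.
rewrite e1 in i1 *; rewrite -[LHS]mul1r.
have b1 : - (pi / 2) <= (0 : R) <= 0 by apply/andP; split; lra.
pose q : R := - (pi / 2).
have q0 : q <= 0 by rewrite oppr_le0 divr_ge0// ltW.
have b2 : q <= q <= 0 by rewrite lexx.
have u1 (s : R) : cexp (s +i* 0) = 1 * (expR s)%:C by rewrite mul1r -cexp_real.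
have u2 (s : R) : cexp (s +i* q) = - 'i * (expR s)%:C.
  apply: complex_ext; rewrite ?Re_cexp ?Im_cexp ?ReImE /= ?cosN ?sinN ?cos_pihalf ?sin_pihalf; ring.
have c1 := ray_cvg b1 u1 i1; have c2 := ray_cvg b2 u2 i2.
have c3 := ccvgD (ccvgD c2 (ccvgZ (-1) c1)) rotated_sides_cvg.
have Z n : rect_integral (g n) (- A n) (- (pi / 2)) (A n + A n) (pi / 2) = 0.
  by apply: goursat => //; [rewrite addr_ge0|rewrite divr_ge0// ltW].
have c4 : ccvg (fun _ => 0) (- 'i * CInt lam `]0, +oo[ (fun y : R => G (- 'i * y%:C)) +
    -1 * (1 * CInt lam `]0, +oo[ (fun y : R => G (1 * y%:C))) + 0).
  move: c3; congr (ccvg _ _); apply/funext => n; rewrite -[RHS](Z n) /rect_integral.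
  by rewrite mulN1r addNr.
have := ccvg_unique (@ccvg_cst R 0) c4; rewrite addr0 mulN1r => /esym/subr0_eq ->.
by [].
Qed.

End Rotation.
End ContourRotation.

(** * Vanishing of integrals over the whole line *)

Section WholeLine.
Variable R : realType.
Local Notation T := (measurableTypeR R).
Local Notation lam := (@leb R).

Lemma ae_neq (a : R) : {ae lam, forall x : T, x <> a}.
Proof.
exists [set a]; split => //; first exact: lebesgue_measure_set1.
by move=> x /=; rewrite notK.
Qed.

Lemma cmeas_itvT (D : set T) (g : T -> R[i]) : cmeas setT g -> cmeas D g.
Proof. exact: cmeasS. Qed.

Lemma cintegrable_restrict (D : set T) (g : T -> R[i]) : measurable D ->
  cintegrable lam D g -> cintegrable lam setT (fun x => if x \in D then g x else 0).
Proof.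
move=> mD [i1 i2]; split.
  have /(integrable_restrict _ mD measurableT) : lam.-integrable (setT `&` D) (fun x => (complex.Re (g x))%:E) by rewrite setTI.
  by apply: eq_integrable => // x _; rewrite patchE; case: ifP.
have /(integrable_restrict _ mD measurableT) : lam.-integrable (setT `&` D) (fun x => (complex.Im (g x))%:E) by rewrite setTI.
by apply: eq_integrable => // x _; rewrite patchE; case: ifP.
Qed.

Lemma CInt_reflect (g : T -> R[i]) : cintegrable lam setT g ->
  CInt lam setT g = CInt lam `]0, +oo[ g + CInt lam `]0, +oo[ (fun x => g (- x)).
Proof.
move=> ig; have mg := cintegrable_cmeas ig.
have mD : @measurable _ T `]0, +oo[ by exact: measurable_itvT.
pose P := fun x : T => if x \in `]0, +oo[%classic then g x else 0.
pose Q := fun x : T => if x \in `]0, +oo[%classic then g (- x) else 0.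
have igN : cintegrable lam setT (fun x => g (- x)).
  exact: (cintegrable_invariant (@measurable_oppT R) (@leb_opp R)).
have iP : cintegrable lam setT P.
  by apply: cintegrable_restrict => //; apply: cintegrableS ig.
have iQ : cintegrable lam setT Q.
  by apply: cintegrable_restrict => //; apply: cintegrableS igN.
have iQN : cintegrable lam setT (fun x => Q (- x)).
  exact: (cintegrable_invariant (@measurable_oppT R) (@leb_opp R)).
rewrite [in RHS]CInt_restrict [X in _ + X]CInt_restrict -/P -/Q.
rewrite -(CInt_invariant (@measurable_oppT R) (@leb_opp R) (cintegrable_cmeas iQ)).
rewrite -CIntD//; apply: ae_eq_CInt => //.
  exact: (cmeasD (cintegrable_cmeas iP) (cintegrable_cmeas iQN)).
apply: filterS (ae_neq 0) => x x0 _.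
rewrite /P /Q !mem_itv_oy oppr_gt0 opprK.
by case: (ltrgtP x 0) x0 => // h _; rewrite ?addr0 ?add0r.
Qed.

(** The negative half line is reached by rotating H(z) = conj(G(- conj z)), the reflection of [G] in
    the imaginary axis. On the negative imaginary axis [H] is the conjugate of [G], so if I is the
    integral of [G] along it, the two half lines contribute - i I and + i I. *)
Lemma integral_line_eq0 (G : R[i] -> R[i]) (M C : R) :
  centire G -> 0 <= M -> 0 <= C ->
  (forall z, cabs (G z) <= M * expR (C * cabs z)) ->
  cintegrable lam setT (fun x : R => G x%:C) ->
  cintegrable lam `]0, +oo[ (fun y : R => G (- 'i * y%:C)) ->
  CInt lam setT (fun x : R => G x%:C) = 0.
Proof.
move=> eG M0 C0 expG i1 i2.
have mD : @measurable _ T `]0, +oo[ by exact: measurable_itvT.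
have iNR := cintegrable_invariant (@measurable_oppT R) (@leb_opp R) i1.
rewrite CInt_reflect//.
rewrite (contour_rotation eG M0 C0 expG)//; last exact: cintegrableS i1.
pose H z := (G (- conjc z))^*.
have eN : centire (fun z => G (- z)).
  apply: (centire_comp (f := fun z => - z)) => // z.
  exists (-1) => e e0; exists 1 => // h _.
  have -> : - (z + h) - - z - -1 * h = 0 by ring.
  by rewrite cabs0 mulr_ge0 ?cabs_ge0// ltW.
have eH : centire H by exact: (centire_conj eN).
have expH z : cabs (H z) <= M * expR (C * cabs z).
  by rewrite /H cabsJ; have := expG (- conjc z); rewrite cabsN cabsJ.
have conjI (D : set T) (f : T -> R[i]) : measurable D -> cintegrable lam D f ->
    cintegrable lam D (fun x => (f x)^*).
  move=> mD' jf; apply: (le_cintegrable (h := fun x => cabs (f x))) => //.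
  - by apply: cmeasJ; exact: cintegrable_cmeas jf.
  - by move=> x _; rewrite cabsJ.
  - exact: integrable_cabs.
have HR (x : R) : H x%:C = conjc (G (- x)%:C).
  by rewrite /H conjc_real rmorphN.
have HI (y : R) : H (- 'i * y%:C) = conjc (G (- 'i * y%:C)).
  rewrite /H; congr (conjc (G _)); apply: complex_ext; rewrite !ReImE /=; ring.
have j1 : cintegrable lam `]0, +oo[ (fun x : R => H x%:C).
  apply: (eq_cintegrable mD (f := fun x : R => (G (- x)%:C)^*)); first by move=> x _; rewrite HR.
  by apply: conjI => //; exact: cintegrableS iNR.
have j2 : cintegrable lam `]0, +oo[ (fun x : R => H (- 'i * x%:C)).
  by apply: (eq_cintegrable mD (f := fun x : R => (G (- 'i * x%:C))^*)); [move=> x _; rewrite HI|exact: conjI].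
have := contour_rotation eH M0 C0 expH j1 j2.
under eq_CInt do rewrite HR.
under [in RHS]eq_CInt do rewrite HI.
have cM (c z : R[i]) : conjc (c * conjc z) = conjc c * z by rewrite rmorphM/= conjcK.
rewrite !CInt_conj => /(canRL (@conjcK R)) ->; rewrite cM; move: (CInt _ _ _) => z.
have -> : conjc (- 'i) = 'i :> R[i] by apply: complex_ext; rewrite !ReImE /= ?oppr0 ?opprK.
by rewrite mulNr addNr.
Qed.

End WholeLine.

(** * Square integrable functions *)

Section SquareIntegrable.
Variable R : realType.
Local Notation T := (measurableTypeR R).
Local Notation lam := (@leb R).
Implicit Types f g : T -> R[i].

Definition sqint f := cmeas setT f /\ lam.-integrable setT (EFin \o (fun x => cabs (f x) ^+ 2)).

Lemma L2norm_sq f : ((L2norm lam f) `^ 2 = \int[lam]_x (cabs (f x) ^+ 2)%:E)%E.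
Proof.
rewrite /L2norm powR_Lnorm ?pnatr_eq0//; apply: eq_integral => x _ /=.
by rewrite ger0_norm ?cabs_ge0// powR_mulrn// cabs_ge0.
Qed.

Lemma measurable_cabs2 (D : set T) f : cmeas D f -> measurable_fun D (fun x => cabs (f x) ^+ 2).
Proof. by move=> mf; apply: measurable_funX; exact: measurable_cabs. Qed.

Lemma integrable_cabs2P f : cmeas setT f ->
  lam.-integrable setT (EFin \o (fun x => cabs (f x) ^+ 2)) <->
  (\int[lam]_x (cabs (f x) ^+ 2)%:E < +oo)%E.
Proof.
move=> mf; have E : (\int[lam]_x `|(EFin \o (fun x => (cabs (f x) ^+ 2)%R)) x| =
    \int[lam]_x (cabs (f x) ^+ 2)%:E)%E.
  by apply: eq_integral => x _ /=; rewrite ger0_norm// sqr_ge0.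
split => [/integrableP[_]|h]; first by rewrite E.
apply/integrableP; rewrite E; split => //.
by apply/measurable_EFinP; exact: measurable_cabs2.
Qed.

Lemma sqintP f : inL2 f <-> sqint f.
Proof.
split => -[mf h]; split => //.
  by apply/integrable_cabs2P => //; rewrite -L2norm_sq; exact: poweR_lty.
by apply: (@lty_poweRy _ _ 2) => //; rewrite L2norm_sq; apply/integrable_cabs2P.
Qed.

(** A weighted inequality of arithmetic and geometric means, used where Cauchy-Schwarz would be:
    [e = 1] makes products integrable, a small [e] makes pairings small. *)
Lemma mul_le_half_sqr (a b e : R) : 0 < e -> a * b <= a ^+ 2 / e + e * b ^+ 2.
Proof.
move=> e0; have h : 0 <= (a / e - b) ^+ 2 * e by rewrite mulr_ge0 ?sqr_ge0// ltW.
have h1 : (a / e - b) ^+ 2 * e = a ^+ 2 / e - 2 * (a * b) + e * b ^+ 2 by field; rewrite gt_eqF.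
have h2 : 0 <= a ^+ 2 / e by rewrite divr_ge0 ?sqr_ge0// ltW.
have h3 : 0 <= e * b ^+ 2 by rewrite mulr_ge0 ?sqr_ge0// ltW.
by rewrite h1 in h; move: (a * b) (a ^+ 2 / e) (e * b ^+ 2) h h2 h3 => u v w; lra.
Qed.

Lemma integrableDT (u v : T -> R) : lam.-integrable setT (EFin \o u) ->
  lam.-integrable setT (EFin \o v) -> lam.-integrable setT (EFin \o (fun x => u x + v x)).
Proof. by move=> iu iv; have := integrableD measurableT iu iv. Qed.

Lemma integrableZT (c : R) (u : T -> R) : lam.-integrable setT (EFin \o u) ->
  lam.-integrable setT (EFin \o (fun x => c * u x)).
Proof. by move=> iu; have := integrableZl measurableT c iu. Qed.

Lemma sqintM_cintegrable f g : sqint f -> sqint g -> cintegrable lam setT (fun x => f x * g x).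
Proof.
move=> [mf if2] [mg ig2].
apply: (le_cintegrable (h := fun x => cabs (f x) ^+ 2 + cabs (g x) ^+ 2)) => //.
- exact: cmeasM.
- by move=> x _; rewrite cabsM; have := mul_le_half_sqr (cabs (f x)) (cabs (g x)) ltr01; rewrite divr1 mul1r.
- exact: integrableDT.
Qed.

End SquareIntegrable.

(** * The multiplication formula for the Fourier transform *)

Section Multiplication.
Variable R : realType.
Local Notation T := (measurableTypeR R).
Local Notation lam := (@leb R).

(** Unnormalised transform; the factor (2 pi)^{-1/2} is carried separately as [invsqrt2pi]. *)
Definition fourier (g : T -> R[i]) (xi : R) : R[i] :=
  CInt lam setT (fun x => cexpm xi x * g x).

Lemma cexpmC (a b : R) : cexpm a b = cexpm b a.
Proof. by rewrite /cexpm mulrC. Qed.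

Lemma FT_onE (D : set T) (g : T -> R[i]) (xi : R) :
  FT_on D g xi = invsqrt2pi R * fourier (fun x => if x \in D then g x else 0) xi.
Proof.
rewrite /FT_on /fourier CInt_restrict; congr (_ * _); apply: eq_CInt => x _.
by case: ifP => // _; rewrite mulr0.
Qed.

Lemma norm_cosB_le (a b : R) : `|cos b - cos a| <= `|b - a|.
Proof.
have := @mvt_bound _ cos (fun x => - sin x) 1 a b (fun x => is_derive_cos x).
by rewrite mul1r; apply => x _; rewrite normrN sin_max.
Qed.

Lemma norm_sinB_le_dist (a b : R) : `|sin b - sin a| <= `|b - a|.
Proof.
have := @mvt_bound _ sin cos 1 a b (fun x => is_derive_sin x).
by rewrite mul1r; apply => x _; exact: cos_max.
Qed.

Lemma cabs_cexpmB_le (a b x : R) : cabs (cexpm a x - cexpm b x) <= 2 * `|a - b| * `|x|.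
Proof.
rewrite (le_trans (cabs_le_ReIm _))// !ReImE /= opprK.
have h1 := norm_cosB_le (b * x) (a * x); have h2 := norm_sinB_le_dist (b * x) (a * x).
rewrite -mulrBl normrM in h1 h2.
have -> : - sin (a * x) + sin (b * x) = - (sin (a * x) - sin (b * x)) by ring.
by rewrite normrN -mulrA mulrDl mul1r lerD.
Qed.

Lemma cmeas_cexpmT (xi : R) : cmeas setT (fun x : T => cexpm xi x).
Proof. by apply: cmeas_cexpm; [exact: measurable_cst|exact: measurable_id]. Qed.

Lemma cintegrable_cexpmM (xi : R) (g : T -> R[i]) : cintegrable lam setT g ->
  cintegrable lam setT (fun x => cexpm xi x * g x).
Proof.
move=> ig; apply: (le_cintegrable (h := fun x => cabs (g x))) => //.
- apply: cmeasM; [exact: cmeas_cexpmT|exact: cintegrable_cmeas ig].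
- by move=> x _; rewrite cabsM cabs_cexpm mul1r.
- exact: integrable_cabs.
Qed.

Lemma cabs_fourier_le (xi : R) (g : T -> R[i]) : cintegrable lam setT g ->
  cabs (fourier g xi) <= 2 * Rintegral lam setT (fun x => cabs (g x)).
Proof.
move=> ig; apply: cabs_CInt_le => //.
- exact: cintegrable_cmeas (cintegrable_cexpmM xi ig).
- by move=> x _; rewrite cabsM cabs_cexpm mul1r.
- exact: integrable_cabs.
Qed.

(** A finite first moment makes the transform Lipschitz. This is how the truncated transforms are
    seen to be measurable. *)
Lemma fourier_ccont (g : T -> R[i]) : cintegrable lam setT g ->
  lam.-integrable setT (EFin \o (fun x : T => `|x| * cabs (g x))) -> ccont (fourier g).
Proof.
move=> ig ixg xi; pose K := Rintegral lam setT (fun x : T => `|x| * cabs (g x)).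
have C : (4 * K) * `|y - xi| @[y --> xi] --> (0 : R).
  rewrite -[X in _ --> X](mulr0 (4 * K)); apply: cvgM; first exact: cvg_cst.
  have : `|y - xi| @[y --> xi] --> `|xi - xi|.
    by apply: cvg_norm; apply: cvgB; [exact: cvg_id|exact: cvg_cst].
  by rewrite subrr normr0.
apply: (squeeze_cvgr _ (cvg_cst 0) C); near=> y; rewrite cabs_ge0 /=.
rewrite /fourier -CIntB//; [|exact: cintegrable_cexpmM..].
have := @cabs_CInt_le R lam setT (fun x => cexpm y x * g x - cexpm xi x * g x)
  (fun x => 2 * `|y - xi| * (`|x| * cabs (g x))) measurableT.
rewrite RintegralZl// -/K.
have -> : 2 * (2 * `|y - xi| * K) = 4 * K * `|y - xi| by ring.
apply.
- by apply: cmeasB; exact: cintegrable_cmeas (cintegrable_cexpmM _ ig).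
- by move=> x _; rewrite -mulrBl cabsM mulrA ler_wpM2r ?cabs_ge0// cabs_cexpmB_le.
- exact: integrableZT.
Unshelve. all: by end_near. Qed.

Section MultiplicationFormula.
Variables (k psi : R -> R[i]) (h : T -> R[i]).
Hypotheses (ck : ccont k) (k2 : sqint (k : T -> R[i])) (Hpsi : L2_fourier k psi).
Hypotheses (ih : cintegrable lam setT h) (h2 : sqint h) (hh2 : sqint (fourier h : T -> R[i])).

Let trunc (n : nat) : T -> R[i] := fun x => if x \in `[- n%:R, n%:R]%classic then k x else 0.

Let itrunc n : cintegrable lam setT (trunc n).
Proof. by apply: cintegrable_restrict => //; exact: ccont_cintegrable. Qed.

Let cabs_trunc_le n x : cabs (trunc n x) <= cabs (k x).
Proof. by rewrite /trunc; case: ifP => // _; rewrite cabs0 cabs_ge0. Qed.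

Let FTn n (xi : T) : R[i] := invsqrt2pi R * fourier (trunc n) xi.

Let cmeas_FTn n : cmeas setT (FTn n).
Proof.
apply: cmeasM; first exact: cmeas_cst.
apply: ccont_cmeas; apply: fourier_ccont => //.
have := integrableZT n%:R (integrable_cabs measurableT (itrunc n)).
apply: le_integrable => //.
  apply/measurable_EFinP; apply: measurable_funM.
    by apply: continuous_measurable_fun => y; exact: norm_continuous.
  exact: measurable_cabs (cintegrable_cmeas (itrunc n)).
move=> x _ /=; rewrite lee_fin ger0_norm ?mulr_ge0 ?cabs_ge0//.
have -> : `|n%:R * cabs (trunc n x)| = n%:R * cabs (trunc n x).
  by rewrite ger0_norm// mulr_ge0// cabs_ge0.
rewrite /trunc mem_itv_cc; case: ifP => [|_].
  by rewrite -ler_norml => hx; rewrite ler_wpM2r ?cabs_ge0.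
by rewrite cabs0 !mulr0.
Qed.

Let fubini n : CInt lam setT (fun xi => fourier (trunc n) xi * h xi) =
  CInt lam setT (fun x => trunc n x * fourier h x).
Proof.
pose F (p : T * T) := cexpm p.1 p.2 * trunc n p.2 * h p.1.
have mF : cmeas setT F.
  apply: cmeasM; first apply: cmeasM.
  - by apply: cmeas_cexpm; [exact: measurable_fst|exact: measurable_snd].
  - by apply: (cmeas_comp (h := snd)); [exact: measurable_snd|exact: cintegrable_cmeas (itrunc n)].
  - by apply: (cmeas_comp (h := fst)); [exact: measurable_fst|exact: cintegrable_cmeas ih].
have := @CInt_fubini R (fun x => cabs (h x)) (fun x => cabs (trunc n x))
  (integrable_cabs measurableT ih) (integrable_cabs measurableT (itrunc n)) F mF.
have H (p : T * T) : cabs (F p) <= cabs (h p.1) * cabs (trunc n p.2).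
  by rewrite /F !cabsM cabs_cexpm mul1r mulrC.
move=> /(_ H) E; transitivity (CInt lam setT (fun x => CInt lam setT (fun y => F (x, y)))).
  apply: eq_CInt => xi _; rewrite [LHS]mulrC /fourier -(CIntZ (h xi) measurableT (cintegrable_cexpmM xi (itrunc n))).
  by apply: eq_CInt => x _; rewrite /F /=; ring.
rewrite E; apply: eq_CInt => x _; rewrite /fourier -(CIntZ (trunc n x) measurableT (cintegrable_cexpmM x ih)).
by apply: eq_CInt => xi _; rewrite /F /= cexpmC; ring.
Qed.

Let cvg_fubini : ccvg (fun n => CInt lam setT (fun xi => FTn n xi * h xi))
  (invsqrt2pi R * CInt lam setT (fun x => k x * fourier h x)).
Proof.
have -> : (fun n => CInt lam setT (fun xi => FTn n xi * h xi)) =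
    (fun n => invsqrt2pi R * CInt lam setT (fun x => trunc n x * fourier h x)).
  apply/funext => n; rewrite -fubini -CIntZ//.
    by apply: eq_CInt => xi _; rewrite /FTn mulrA.
  pose B := 2 * Rintegral lam setT (fun x => cabs (trunc n x)).
  apply: (le_cintegrable (h := fun x => B * cabs (h x))) => //.
  - apply: cmeasM; last exact: cintegrable_cmeas ih.
    have := cmeasM (cmeas_cst setT (invsqrt2pi R)^-1) (cmeas_FTn n).
    have e : invsqrt2pi R != 0.
      rewrite /invsqrt2pi -cabs_gt0 cabs_real gtr0_norm ?invr_gt0 ?sqrtr_gt0 mulr_gt0 ?pi_gt0//.
    by under eq_fun do rewrite /FTn mulKf//.
  - by move=> x _; rewrite cabsM ler_wpM2r ?cabs_ge0//; exact: cabs_fourier_le.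
  - by apply: integrableZT; exact: integrable_cabs.
apply: ccvgZ.
have ikh := sqintM_cintegrable k2 hh2.
apply: (@CInt_dominated_cvg _ _ _ _ _ (fun x => cabs (k x * fourier h x))) => //.
- by move=> n; apply: cmeasM; [exact: cintegrable_cmeas (itrunc n)|exact: hh2.1].
- exact: cintegrable_cmeas ikh.
- apply: aeW => x _; apply: (@ccvg_le_near _ _ _ (fun _ => 0)); last exact: cvg_cst.
  exists (Num.truncn `|x|).+1 => // n /= mn.
  have hx : `|x| <= n%:R by rewrite ltW// (lt_le_trans (truncnS_gt _))// ler_nat.
  by rewrite /trunc mem_itv_cc -ler_norml hx subrr cabs0.
- exact: integrable_cabs.
- by move=> n x _; rewrite !cabsM ler_wpM2r ?cabs_ge0.
Qed.

Let cvg_L2 : ccvg (fun n => CInt lam setT (fun xi => FTn n xi * h xi))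
  (CInt lam setT (fun xi => psi xi * h xi)).
Proof.
have [psi2 cvgpsi] := Hpsi; move/sqintP : psi2 => psi2.
pose d n (xi : T) := psi xi - FTn n xi.
have md n : cmeas setT (d n) by apply: cmeasB; [exact: psi2.1|exact: cmeas_FTn].
have cvgd : (fun n => \int[lam]_x (cabs (d n x) ^+ 2)%:E)%E @ \oo --> (0 : R)%:E.
  have E : (fun n : nat => (\int[lam]_xi ((cabs (psi xi - FT_on `[- (n%:R), n%:R] k xi)) ^+ 2)%:E)%E) =
      (fun n => \int[lam]_x (cabs (d n x) ^+ 2)%:E)%E.
    by apply/funext => n; apply: eq_integral => x _; rewrite FT_onE.
  by rewrite E in cvgpsi.
(* The integrals live in the extended reals. Convergence to 0 makes them finite from some n on, and
   only for such n is [d n] square integrable. *)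
have [fin cvgf] := (fine_cvgP _ _).1 cvgd.
pose H := Rintegral lam setT (fun x => cabs (h x) ^+ 2).
have H0 : 0 <= H by apply: Rintegral_ge0 => x _; rewrite sqr_ge0.
apply/cvgr0Pnorm_lt => e e0.
(* [r] is the weight in [mul_le_half_sqr]: D / r and r H both fall below e / 4, and the factor 2 of
   [cabs_CInt_le] brings the sum to e. *)
pose r := e / (4 * (H + 1)).
have H1 : 0 < H + 1 by rewrite ltr_wpDl.
have r0 : 0 < r by rewrite divr_gt0// mulr_gt0.
have er : 0 < e * r / 4 by rewrite divr_gt0// mulr_gt0.
move/cvgr0Pnorm_lt : cvgf => /(_ _ er) cvgf.
apply: filterS2 fin cvgf => n fn Dn; rewrite ger0_norm ?cabs_ge0// cabs_distC.
have id2 : lam.-integrable setT (EFin \o (fun x => cabs (d n x) ^+ 2)).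
  apply/integrable_cabs2P => //; rewrite -ge0_fin_numE//.
  by apply: integral_ge0 => x _; rewrite lee_fin sqr_ge0.
have dn2 : sqint (d n) by [].
have ipsi := sqintM_cintegrable psi2 h2.
have idh := sqintM_cintegrable dn2 h2.
have iFT : cintegrable lam setT (fun xi => FTn n xi * h xi).
  have := cintegrableD measurableT ipsi (cintegrableZ (-1) measurableT idh).
  by apply: eq_cintegrable => // x _; rewrite /d; ring.
rewrite -CIntB//.
pose D := Rintegral lam setT (fun x => cabs (d n x) ^+ 2).
have D0 : 0 <= D by apply: Rintegral_ge0 => x _; rewrite sqr_ge0.
have Dlt : D < e * r / 4 by exact: le_lt_trans (ler_norm D) Dn.
have : cabs (CInt lam setT (fun x => psi x * h x - FTn n x * h x)) <= 2 * (r^-1 * D + r * H).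
  have h2i := h2.2.
  have <- : Rintegral lam setT (fun x => r^-1 * cabs (d n x) ^+ 2 + r * cabs (h x) ^+ 2) =
      r^-1 * D + r * H.
    rewrite (RintegralD measurableT (integrableZT r^-1 id2) (integrableZT r h2i)).
    by rewrite (RintegralZl r^-1 measurableT id2) (RintegralZl r measurableT h2i).
  apply: cabs_CInt_le => //.
  - exact: cmeasB (cintegrable_cmeas ipsi) (cintegrable_cmeas iFT).
  - move=> x _; rewrite -mulrBl cabsM; have := mul_le_half_sqr (cabs (d n x)) (cabs (h x)) r0.
    by rewrite [_ / r]mulrC.
  - exact: integrableDT (integrableZT _ id2) (integrableZT _ h2i).
move=> /le_lt_trans; apply.
have h3 : r^-1 * D < e / 4.
  by rewrite mulrC ltr_pdivrMr//; rewrite mulrAC in Dlt.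
have h4 : r * H < e / 4.
  rewrite /r; have -> : e / (4 * (H + 1)) * H = e / 4 * (H / (H + 1)) by field; rewrite gt_eqF.
  rewrite gtr_pMr ?divr_gt0// ltr_pdivrMr// mul1r; lra.
by move: (r^-1 * D) (r * H) h3 h4 => u v; lra.
Qed.

(** Both sides are limits of one sequence, the pairings of [FTn n] with [h]. The L^2 convergence to
    [psi] gives the left side; Fubini followed by dominated convergence gives the right side. *)
Theorem multiplication_formula :
  CInt lam setT (fun xi => psi xi * h xi) =
  invsqrt2pi R * CInt lam setT (fun x => k x * fourier h x).
Proof. exact: ccvg_unique cvg_L2 cvg_fubini. Qed.

End MultiplicationFormula.
End Multiplication.

(** * Entire extensions of transforms of functions on a bounded interval *)

Section PaleyWienerSupport.
Variable R : realType.
Local Notation T := (measurableTypeR R).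
Local Notation lam := (@leb R).

Lemma oneDsqr_pos (x : R) : 0 < oneDsqr x.
Proof. exact: lt_le_trans ltr01 (oneDsqr_ge1 x). Qed.

Lemma integrable_oneDsqrV : lam.-integrable setT (EFin \o (fun x : T => (oneDsqr x)^-1)).
Proof.
apply/integrableP; split.
  by apply/measurable_EFinP; apply: continuous_measurable_fun; exact: continuous_oneDsqrV.
have E : (\int[lam]_x `|(EFin \o (fun x : T => (oneDsqr x)^-1%R)) x| =
    \int[lam]_x ((oneDsqr x)^-1%R)%:E)%E.
  by apply: eq_integral => x _ /=; rewrite ger0_norm// invr_ge0// ltW// oneDsqr_pos.
rewrite E (ge0_symfun_integralT (f := fun x : R => (oneDsqr x)^-1)).
- by rewrite -set_itvcy integral0y_oneDsqr -EFinM ltry.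
- by move=> x; rewrite invr_ge0 ltW// oneDsqr_pos.
- exact: continuous_oneDsqrV.
- by move=> x /=; rewrite /oneDsqr sqrrN.
Qed.

(** Adding the squares of the two bounds gives (1 + x^2) |f|^2 <= 2 B^2. *)
Lemma sqint_of_decay (f : T -> R[i]) (B : R) : cmeas setT f ->
  (forall x, cabs (f x) <= B) -> (forall x, `|x| * cabs (f x) <= B) -> sqint f.
Proof.
move=> mf h1 h2; split => //.
have := integrableZT (2 * B ^+ 2) integrable_oneDsqrV.
apply: le_integrable => //; first by apply/measurable_EFinP; exact: measurable_cabs2.
move=> x _; rewrite /= lee_fin ger0_norm ?sqr_ge0// (le_trans _ (ler_norm _))//.
rewrite ler_pdivlMr ?oneDsqr_pos// /oneDsqr mulrDr mulr1 mulrDl mul1r lerD//.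
  by rewrite lerXn2r ?nnegrE ?cabs_ge0// (le_trans (cabs_ge0 _) (h1 0)).
have -> : cabs (f x) ^+ 2 * x ^+ 2 = (`|x| * cabs (f x)) ^+ 2.
  by rewrite exprMn [`|x| ^+ 2]real_normK ?num_real// mulrC.
by rewrite lerXn2r ?nnegrE ?mulr_ge0 ?cabs_ge0// (le_trans (cabs_ge0 _) (h1 0)).
Qed.

Lemma integrable_expRN (e : R) : 0 < e ->
  lam.-integrable setT (EFin \o (fun x : T => expR (- (e * `|x|)))).
Proof.
(* Since e^y >= 1 + y^2 / 2, it suffices that C (1 + e^2 x^2 / 2) dominates 1 + x^2; the product of
   the two second terms is exactly x^2. *)
move=> e0; pose C := 1 + 2 / e ^+ 2.
have C0 : 0 <= 2 / e ^+ 2 by rewrite divr_ge0// sqr_ge0.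
have := integrableZT C integrable_oneDsqrV; apply: le_integrable => //.
  apply/measurable_EFinP; apply: continuous_measurable_fun => x.
  apply: continuous_comp; last exact: continuous_expR.
  by apply: cvgN; apply: cvgM; [exact: cvg_cst|exact: norm_continuous].
move=> x _; rewrite /= lee_fin ger0_norm ?expR_ge0// (le_trans _ (ler_norm _))//.
rewrite ler_pdivlMr ?oneDsqr_pos// expRN mulrC ler_pdivrMr ?expR_gt0//.
have h0 : 0 <= e * `|x| by rewrite mulr_ge0// ltW.
have := expR_ge1Dxn 1 h0; rewrite (_ : 2`! = 2)%N//.
have -> : (e * `|x|) ^+ 2 = e ^+ 2 * x ^+ 2 by rewrite exprMn real_normK ?num_real.
move=> h; have c0 : 0 <= C by rewrite addr_ge0.
apply: le_trans (ler_wpM2l c0 h); rewrite /C /oneDsqr.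
have e2 : e != 0 by rewrite gt_eqF.
have -> : (1 + 2 / e ^+ 2) * (1 + e ^+ 2 * x ^+ 2 / 2) =
  1 + 2 / e ^+ 2 + e ^+ 2 * x ^+ 2 / 2 + x ^+ 2 by field; exact: e2.
have : 0 <= e ^+ 2 * x ^+ 2 / 2 by rewrite divr_ge0// mulr_ge0// sqr_ge0.
by move: (2 / e ^+ 2) (e ^+ 2 * x ^+ 2 / 2) (x ^+ 2) C0 => u v w; lra.
Qed.

Section AnalyticFourier.
Variables (phi : R -> R[i]) (a b : R).
Hypotheses (cphi : ccont phi) (ab : a <= b).

Definition fourier_ext (z : R[i]) : R[i] :=
  CInt lam `[a, b] (fun s : R => cexp (- 'i * z * s%:C) * phi s).

Let S := `|a| + `|b|.
Let S0 : 0 <= S. Proof. by rewrite addr_ge0. Qed.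
Let sS s : a <= s <= b -> `|s| <= S.
Proof.
move=> /andP[h1 h2]; rewrite ler_norml; apply/andP; split.
  have := ler_norm (- a); rewrite normrN; have := normr_ge0 b; rewrite /S; lra.
have := ler_norm b; have := normr_ge0 a; rewrite /S; lra.
Qed.

Lemma cexpm_cexp (x s : R) : cexpm x s = cexp (- 'i * x%:C * s%:C).
Proof. by rewrite cexpmE; congr cexp; rewrite rmorphM/=; ring. Qed.

Lemma ccont_fourier_kernel z : ccont (fun s : R => cexp (- 'i * z * s%:C)).
Proof.
apply: ccont_comp; first exact: centire_cexp.
by apply: ccontM; [exact: ccont_cst|apply: ccont_real => x; exact: cvg_id].
Qed.

Let ck z : ccont (fun s : R => cexp (- 'i * z * s%:C) * phi s).
Proof. by apply: ccontM => //; exact: ccont_fourier_kernel. Qed.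

Let mD : @measurable _ T `[a, b]. Proof. exact: measurable_itvT. Qed.

Let itv_cmeas (f : R -> R[i]) : ccont f -> cmeas (X := T) `[a, b] f.
Proof. by move=> cf; exact: cintegrable_cmeas (ccont_cintegrable a b cf). Qed.

Let iabs (f : R -> R[i]) : ccont f -> lam.-integrable `[a, b] (EFin \o (fun s : T => cabs (f s))).
Proof. by move=> cf; exact: integrable_cabs (ccont_cintegrable a b cf). Qed.

Let iZ (c : R) (f : T -> R) : lam.-integrable `[a, b] (EFin \o f) ->
  lam.-integrable `[a, b] (EFin \o (fun s => c * f s)).
Proof. by move=> jf; have := integrableZl mD c jf. Qed.

(** Differentiation under the integral, done by hand. Factoring e^{-izs} out of the kernel at z + h
    leaves the second-order remainder of the exponential at - i h s, which for |h| < 1 is at most C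
    |h|^2 uniformly in s. *)
Lemma centire_fourier_ext : centire fourier_ext.
Proof.
move=> z.
pose dk (s : R) := - 'i * s%:C * (cexp (- 'i * z * s%:C) * phi s).
have cdk : ccont dk.
  apply: ccontM => //; apply: ccontM; first exact: ccont_cst.
  by apply: ccont_real => x; exact: cvg_id.
exists (CInt lam `[a, b] dk) => e e0.
pose K := Rintegral lam `[a, b] (fun s : T => cabs (cexp (- 'i * z * s%:C) * phi s)).
have K0 : 0 <= K by apply: Rintegral_ge0 => s _; exact: cabs_ge0.
pose C := 5 * S ^+ 2 * expR S.
have C0 : 0 <= C by rewrite !mulr_ge0 ?expR_ge0// sqr_ge0.
have D0 : 0 < 2 * C * K + 1 by rewrite ltr_wpDl// !mulr_ge0.
exists (Num.min 1 (e / (2 * C * K + 1))); first by rewrite lt_min ltr01 divr_gt0.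
move=> h; rewrite lt_min => /andP[h1 he].
have c0 := cabs_ge0 h.
have -> : fourier_ext (z + h) - fourier_ext z - CInt lam `[a, b] dk * h =
    CInt lam `[a, b] (fun s : R => (cexp (- 'i * h * s%:C) - 1 - (- 'i * h * s%:C)) *
      (cexp (- 'i * z * s%:C) * phi s)).
  rewrite [CInt lam `[a, b] dk * h]mulrC -(CIntZ h mD (ccont_cintegrable a b cdk)).
  rewrite -(CIntB mD (ccont_cintegrable a b (ck (z + h))) (ccont_cintegrable a b (ck z))).
  rewrite -CIntB//.
  - apply: eq_CInt => s _.
    have -> : - 'i * (z + h) * s%:C = - 'i * h * s%:C + - 'i * z * s%:C by ring.
    by rewrite cexpD /dk; ring.
  - exact: ccont_cintegrable (ccontD (ck _) (ccontN (ck _))).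
  - exact: ccont_cintegrable (ccontM (ccont_cst _) cdk).
apply: (@le_trans _ _ (2 * (C * cabs h ^+ 2 * K))).
  rewrite -RintegralZl//; last exact: iabs.
  apply: cabs_CInt_le => //.
  - apply: itv_cmeas; apply: ccontM => //.
    apply: ccontD; first apply: ccontD.
    + exact: ccont_fourier_kernel.
    + exact: ccont_cst.
    + apply: ccontN; apply: ccontM; first exact: ccont_cst.
      by apply: ccont_real => x; exact: cvg_id.
  - move=> s; rewrite /= in_itv/= => /sS hs.
    rewrite cabsM ler_wpM2r ?cabs_ge0// (le_trans (cabs_cexpB1B_le _))//.
    have -> : cabs (- 'i * h * s%:C) = cabs h * `|s|.
      by rewrite !cabsM cabsN cabs_i mul1r cabs_real.
    have u1 : cabs h * `|s| <= cabs h * S by rewrite ler_wpM2l.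
    have u2 : expR (cabs h * `|s|) <= expR S.
      by rewrite ler_expR (le_trans u1)// -[leRHS]mul1r ler_wpM2r// ltW.
    rewrite /C (_ : 5 * S ^+ 2 * expR S * cabs h ^+ 2 = 5 * (cabs h * S) ^+ 2 * expR S); last by ring.
    apply: ler_pM; rewrite ?expR_ge0 ?mulr_ge0 ?sqr_ge0//.
    by rewrite ler_wpM2l// lerXn2r ?nnegrE ?mulr_ge0.
  - by apply: iZ; exact: iabs.
have h2 : cabs h * (2 * C * K + 1) <= e by rewrite -ler_pdivlMr// ltW.
have h3 := ler_wpM2r c0 h2.
apply: le_trans h3; rewrite (_ : 2 * (C * cabs h ^+ 2 * K) = cabs h * (2 * C * K) * cabs h); last by ring.
by rewrite ler_wpM2r// ler_wpM2l// lerDl.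
Qed.

Let Phi := Rintegral lam `[a, b] (fun s : T => cabs (phi s)).

(** The kernel has modulus e^{s Im z}. The bound serves with m = r |z| for the exponential type, m =
    0 on the real line, and m negative on a half of the imaginary axis. *)
Lemma fourier_ext_le (z : R[i]) (m : R) :
  (forall s, a <= s <= b -> complex.Im z * s <= m) ->
  cabs (fourier_ext z) <= 2 * Phi * expR m.
Proof.
move=> zm; rewrite -mulrA [Phi * _]mulrC -RintegralZl//; last exact: iabs.
apply: cabs_CInt_le => //; first exact: itv_cmeas.
  move=> s; rewrite /= in_itv/= => /zm hs; rewrite cabsM ler_wpM2r ?cabs_ge0//.
  rewrite cabs_cexp ler_expR; apply: le_trans hs.
  by rewrite !ReImE /= le_eqVlt; apply/orP; left; apply/eqP; ring.
by apply: iZ; exact: iabs.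
Qed.

Lemma fourier_ext_exp_type (r : R) : `|a| <= r -> `|b| <= r ->
  forall z, cabs (fourier_ext z) <= 2 * Phi * expR (r * cabs z).
Proof.
move=> ar br z; apply: fourier_ext_le => s /andP[h1 h2].
have hs : `|s| <= r.
  rewrite ler_norml in ar; rewrite ler_norml in br; rewrite ler_norml.
  by move: ar br => /andP[? ?] /andP[? ?]; apply/andP; split; lra.
rewrite (le_trans (ler_norm _))// normrM mulrC ler_pM//; exact: Im_le_cabs.
Qed.

Lemma fourier_ext_real (x : R) :
  fourier_ext x%:C = fourier (fun s => if s \in `[a, b]%classic then phi s else 0) x.
Proof.
rewrite /fourier_ext /fourier CInt_restrict; apply: eq_CInt => s _.
case: ifP => _; last by rewrite mulr0.
by rewrite cexpm_cexp.
Qed.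

Variable phi' : R -> R[i].
Hypotheses (ab' : a < b) (cphi' : ccont phi').
Hypothesis dRe : forall x : R, is_derive x 1 (fun y : R => complex.Re (phi y)) (complex.Re (phi' x)).
Hypothesis dIm : forall x : R, is_derive x 1 (fun y : R => complex.Im (phi y)) (complex.Im (phi' x)).

(** Integration by parts with the boundary terms kept: for the indicator of an interval, where
    [phi'] is 0, they are the whole bound. *)
Lemma fourier_ext_decay (x : R) : `|x| * cabs (fourier_ext x%:C) <=
  cabs (phi a) + cabs (phi b) + 2 * Rintegral lam `[a, b] (fun s : T => cabs (phi' s)).
Proof.
pose F (s : R) := cexpm x s * phi s.
pose f (s : R) := cexpm x s * phi' s - 'i * x%:C * (cexpm x s * phi s).
have cE : ccont (fun s => cexpm x s).
  have -> : (fun s => cexpm x s) = (fun s : R => cexp (- 'i * x%:C * s%:C)).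
    by apply/funext => s; exact: cexpm_cexp.
  exact: ccont_fourier_kernel.
have c1 : ccont (fun s => cexpm x s * phi' s) by exact: ccontM.
have c2 : ccont (fun s => cexpm x s * phi s) by exact: ccontM.
have cf : ccont f by apply: ccontD => //; apply: ccontN; apply: ccontM => //; exact: ccont_cst.
have dlin (s : R) : is_derive s 1 (fun y : R => x * y) x.
  by have := is_deriveZ x (is_derive_id s (1 : R)); rewrite /GRing.scale/= mulr1.
have dcos (s : R) : is_derive s 1 (fun y : R => cos (x * y)) (- sin (x * s) * x).
  exact: (is_derive1_comp (is_derive_cos (x * s)) (dlin s)).
have dsin (s : R) : is_derive s 1 (fun y : R => sin (x * y)) (cos (x * s) * x).
  exact: (is_derive1_comp (is_derive_sin (x * s)) (dlin s)).
have dF1 (s : R) : is_derive s 1 (fun y : R => complex.Re (F y)) (complex.Re (f s)).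
  have -> : (fun y : R => complex.Re (F y)) =
      (fun y : R => cos (x * y)) * (fun y : R => complex.Re (phi y)) +
      (fun y : R => sin (x * y)) * (fun y : R => complex.Im (phi y)).
    by apply/funext => y; rewrite /F ReM /= mulNr opprK.
  apply: is_derive_eq (is_deriveD (is_deriveM (dcos s) (dRe s)) (is_deriveM (dsin s) (dIm s))) _.
  by rewrite /f /GRing.scale/= !ReImE /=; ring.
have dF2 (s : R) : is_derive s 1 (fun y : R => complex.Im (F y)) (complex.Im (f s)).
  have -> : (fun y : R => complex.Im (F y)) =
      (fun y : R => cos (x * y)) * (fun y : R => complex.Im (phi y)) -
      (fun y : R => sin (x * y)) * (fun y : R => complex.Re (phi y)).
    by apply/funext => y; rewrite /F ImM /= mulNr.
  apply: is_derive_eq (is_deriveB (is_deriveM (dcos s) (dIm s)) (is_deriveM (dsin s) (dRe s))) _.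
  by rewrite /f /GRing.scale/= !ReImE /=; ring.
have key := CInt_FTC ab' dF1 dF2 cf.
have E : fourier_ext x%:C = CInt lam `[a, b] (fun s : R => cexpm x s * phi s).
  by apply: eq_CInt => s _; rewrite cexpm_cexp.
have : 'i * x%:C * fourier_ext x%:C =
    CInt lam `[a, b] (fun s : R => cexpm x s * phi' s) - (F b - F a).
  rewrite -key E -(CIntZ _ mD (ccont_cintegrable a b c2)).
  rewrite -(CIntB mD (ccont_cintegrable a b c1) (ccont_cintegrable a b cf)).
  by apply: eq_CInt => s _; rewrite /f; ring.
move=> /(congr1 (@cabs R)); rewrite !cabsM cabs_i mul1r cabs_real => ->.
rewrite (le_trans (cabsB _ _))// addrC lerD//.
  by rewrite (le_trans (cabsB _ _))// /F !cabsM !cabs_cexpm !mul1r addrC.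
apply: cabs_CInt_le => //.
- exact: itv_cmeas.
- by move=> s _; rewrite cabsM cabs_cexpm mul1r.
- exact: iabs.
Qed.

Lemma fourier_ext_sqint : sqint (fun x : T => fourier_ext x%:C).
Proof.
pose B := cabs (phi a) + cabs (phi b) + 2 * Rintegral lam `[a, b] (fun s : T => cabs (phi' s)).
have B0 : 0 <= B.
  by rewrite !addr_ge0 ?cabs_ge0// mulr_ge0// Rintegral_ge0// => s _; exact: cabs_ge0.
have P0 : 0 <= 2 * Phi by rewrite mulr_ge0// Rintegral_ge0// => s _; exact: cabs_ge0.
apply: (@sqint_of_decay _ (2 * Phi + B)).
- apply: ccont_cmeas; apply: ccont_comp; first exact: centire_fourier_ext.
  by apply: ccont_real => x; exact: cvg_id.
- move=> x; rewrite ler_wpDr//.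
  have := @fourier_ext_le x%:C 0; rewrite expR0 mulr1; apply => s _ /=.
  by rewrite mul0r.
- by move=> x; rewrite ler_wpDl// fourier_ext_decay.
Qed.

End AnalyticFourier.
End PaleyWienerSupport.

(** * Vanishing of the integrals of [psi] away from the interval *)

Section Support.
Variable R : realType.
Local Notation T := (measurableTypeR R).
Local Notation lam := (@leb R).

Lemma cintegrable_exp_decay (g : R -> R[i]) (M e : R) : ccont g -> 0 < e ->
  (forall y, 0 < y -> cabs (g y) <= M * expR (- (e * y))) ->
  cintegrable lam `]0, +oo[ g.
Proof.
move=> cg e0 hg; have mD : @measurable _ T `]0, +oo[ by exact: measurable_itvT.
apply: (le_cintegrable (h := fun y : T => M * expR (- (e * `|y|)))) => //.
- by apply: cmeas_itvT; exact: ccont_cmeas.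
- move=> y; rewrite /= in_itv/= andbT => y0; rewrite gtr0_norm//; exact: hg.
- by apply: integrableS (integrableZT M (integrable_expRN e0)).
Qed.

(** Replacing z by - z exchanges the two halves of the imaginary axis. This version serves intervals
    to the left of - t, for which [q] decays upwards. *)
Lemma integral_line_eq0_up (G : R[i] -> R[i]) (M C : R) :
  centire G -> 0 <= M -> 0 <= C ->
  (forall z, cabs (G z) <= M * expR (C * cabs z)) ->
  cintegrable lam setT (fun x : R => G x%:C) ->
  cintegrable lam `]0, +oo[ (fun y : R => G ('i * y%:C)) ->
  CInt lam setT (fun x : R => G x%:C) = 0.
Proof.
move=> eG M0 C0 expG i1 i2.
rewrite -(CInt_invariant (@measurable_oppT R) (@leb_opp R) (cintegrable_cmeas i1)).
have eN : centire (fun z => G (- z)).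
  apply: (centire_comp (f := fun z => - z)) => // z.
  exists (-1) => e e0; exists 1 => // h _.
  have -> : - (z + h) - - z - -1 * h = 0 by ring.
  by rewrite cabs0 mulr_ge0 ?cabs_ge0// ltW.
have eq1 : (fun x : R => G (- x)%:C) = (fun x : R => G (- x%:C)).
  by apply/funext => x; rewrite rmorphN.
rewrite eq1; apply: (integral_line_eq0 (G := fun z => G (- z)) eN M0 C0).
- by move=> z; have := expG (- z); rewrite cabsN.
- rewrite -eq1; exact: (cintegrable_invariant (@measurable_oppT R) (@leb_opp R) i1).
- move: i2; congr (cintegrable _ _ _); apply/funext => y; congr G; ring.
Qed.

Section FourierSupport.
Variables (t : R) (k : R[i] -> R[i]) (psi : R -> R[i]).
Hypotheses (t0 : 0 < t) (ek : centire k) (typek : exp_type_le t k).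
Hypotheses (k2 : sqint (onR k : T -> R[i])) (Hpsi : L2_fourier (onR k) psi).

Lemma ccont_onR (f : R[i] -> R[i]) : centire f -> ccont (onR f).
Proof. by move=> ef; apply: ccont_comp => //; apply: ccont_real => x; exact: cvg_id. Qed.

Lemma CInt_psi_itv_eq0 (a b : R) : a < b -> t < a \/ b < - t -> CInt lam `[a, b] psi = 0.
Proof.
move=> ab htab; have ab' := ltW ab.
have mD : @measurable _ T `[a, b] by exact: measurable_itvT.
pose one (s : R) : R[i] := 1; have c1 : ccont one by exact: ccont_cst.
pose q := fourier_ext one a b.
pose h (s : T) : R[i] := if s \in `[a, b]%classic then 1 else 0.
have ih : cintegrable lam setT h.
  by apply: cintegrable_restrict => //; exact: (ccont_cintegrable a b c1).
have hle s : cabs (h s) ^+ 2 <= cabs (h s).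
  by rewrite /h; case: ifP => _; rewrite ?cabs1 ?cabs0 ?expr1n// expr0n.
have h2 : sqint h.
  split; first exact: cintegrable_cmeas ih.
  apply: le_integrable (integrable_cabs measurableT ih) => //.
    by apply/measurable_EFinP; apply: measurable_cabs2; exact: cintegrable_cmeas ih.
  by move=> s _; rewrite /= lee_fin !ger0_norm ?cabs_ge0 ?sqr_ge0.
have qE x : fourier h x = q x%:C by rewrite /q fourier_ext_real.
have q2 : sqint (fun x : T => q x%:C).
  apply: (@fourier_ext_sqint R one a b c1 (fun _ => 0) ab).
  - exact: ccont_cst.
  - by move=> x; exact: is_derive_cst.
  - by move=> x; exact: is_derive_cst.
have hh2 : sqint (fourier h : T -> R[i]).
  by move: q2; congr sqint; apply/funext => x; rewrite qE.
have := multiplication_formula (ccont_onR ek) k2 Hpsi ih h2 hh2.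
have -> : CInt lam setT (fun xi => psi xi * h xi) = CInt lam `[a, b] psi.
  rewrite [RHS]CInt_restrict; apply: eq_CInt => x _; rewrite /h.
  by case: ifP => _; rewrite ?mulr1 ?mulr0.
move=> ->.
pose G z := k z * q z.
have eq' : centire q by exact: centire_fourier_ext.
have eG : centire G by exact: centireM.
have iG : cintegrable lam setT (fun x : R => G x%:C) by exact: sqintM_cintegrable k2 q2.
have -> : CInt lam setT (fun x : R => onR k x * fourier h x) = CInt lam setT (fun x : R => G x%:C).
  by apply: eq_CInt => x _; rewrite qE.
suff -> : CInt lam setT (fun x : R => G x%:C) = 0 by rewrite mulr0.
(* [m] is the gap between [a, b] and [-t, t]. On the chosen half axis [k] grows at most like e^{(t +
   m/2) y} and [q] decays like e^{-(t + m) y}, so half of the gap survives as the decay rate m/2 of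
   the product. *)
pose m := if t < a then a - t else - t - b.
have m0 : 0 < m by rewrite /m; case: (ltP t a) htab => ta [h'|h']; lra.
have e0 : 0 < m / 2 by rewrite divr_gt0.
have [M HM] := typek e0.
have M0 : 0 <= M by have := HM 0; rewrite cabs0 mulr0 expR0 mulr1; apply: le_trans; exact: cabs_ge0.
pose Phi := 2 * Rintegral lam `[a, b] (fun s : T => cabs (one s)).
have P0 : 0 <= Phi by rewrite mulr_ge0// Rintegral_ge0// => s _; exact: cabs_ge0.
pose r := Num.max `|a| `|b|.
have r0 : 0 <= r by rewrite le_max normr_ge0.
have expG z : cabs (G z) <= (M * Phi) * expR ((t + m / 2 + r) * cabs z).
  rewrite /G cabsM mulrDl expRD.
  have -> : M * Phi * (expR ((t + m / 2) * cabs z) * expR (r * cabs z)) =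
    (M * expR ((t + m / 2) * cabs z)) * (Phi * expR (r * cabs z)) by ring.
  apply: ler_pM; rewrite ?cabs_ge0//.
  by apply: fourier_ext_exp_type => //; rewrite le_max lexx ?orbT.
have MP : 0 <= M * Phi by rewrite mulr_ge0.
have C0 : 0 <= t + m / 2 + r by rewrite !addr_ge0// ltW.
have cG (u : R[i]) : ccont (fun y : R => G (u * y%:C)).
  apply: ccont_comp => //; apply: ccontM; first exact: ccont_cst.
  by apply: ccont_real => x; exact: cvg_id.
have axis (u : R[i]) : cabs u = 1 -> (forall y s : R, 0 < y -> a <= s <= b ->
    complex.Im (u * y%:C) * s <= - ((t + m) * y)) ->
    cintegrable lam `]0, +oo[ (fun y : R => G (u * y%:C)).
  move=> u1 hu; apply: (@cintegrable_exp_decay _ (M * Phi) (m / 2)) => // y y0.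
  have -> : expR (- (m / 2 * y)) = expR ((t + m / 2) * y) * expR (- ((t + m) * y)).
    by rewrite -expRD; congr expR; field.
  have -> : M * Phi * (expR ((t + m / 2) * y) * expR (- ((t + m) * y))) =
    (M * expR ((t + m / 2) * y)) * (Phi * expR (- ((t + m) * y))) by ring.
  rewrite /G cabsM; apply: ler_pM; rewrite ?cabs_ge0//.
    by have := HM (u * y%:C); rewrite cabsM u1 mul1r cabs_real gtr0_norm.
  by apply: fourier_ext_le => // s hs; exact: hu.
case: (ltP t a) => ta.
  apply: (integral_line_eq0 eG MP C0 expG iG); apply: axis; first by rewrite cabsN cabs_i.
  move=> y s y0 /andP[as_ _]; rewrite /m ta !ReImE /= !(oppr0, mulr0, mul0r, add0r) mulN1r mulNr lerN2.
  by have := ler_wpM2r (ltW y0) as_; lra.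
have bt : b < - t by case: htab => // h'; lra.
apply: (integral_line_eq0_up eG MP C0 expG iG); apply: axis; first exact: cabs_i.
move=> y s y0 /andP[_ sb]; rewrite /m ltNge ta /= !(mulr0, mul0r, add0r) mul1r.
by have := ler_wpM2r (ltW y0) sb; lra.
Qed.

End FourierSupport.

Lemma locally_integrable_itv (f : R -> R) : measurable_fun (setT : set T) f ->
  (forall a b : R, lam.-integrable `[a, b] (EFin \o f)) -> locally_integrable setT f.
Proof.
move=> mf fi; split => //; first exact: openT.
move=> K _ cK.
have [M [Mr HM]] := compact_bounded cK.
have KM : K `<=` `[- (M + 1), M + 1]%classic.
  move=> x Kx; rewrite /= in_itv/= -ler_norml; apply: (HM (M + 1)) => //; lra.
have mK : @measurable _ T K by apply: closed_measurable; exact: compact_closed.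
have /integrableP[mfi] := fi (- (M + 1)) (M + 1); apply: le_lt_trans.
apply: ge0_subset_integral => //.
apply/measurable_EFinP; apply: measurableT_comp => //; exact/measurable_EFinP.
Qed.

(** Lebesgue differentiation: the integral of [f] from [c] to x has derivative f(x) for almost every
    x, and here it is locally constant on the open interval. *)
Lemma ae_eq0_of_integrals (f : R -> R) (c d : R) : measurable_fun (setT : set T) f ->
  (forall a b : R, lam.-integrable `[a, b] (EFin \o f)) ->
  (forall a b : R, c < a -> a < b -> b < d -> Rintegral lam `[a, b] f = 0) ->
  {ae lam, forall x : T, c < x -> x < d -> f x = 0}.
Proof.
move=> mf fi f0.
have H := @FTC1 R f (BLeft c).
have := H (fi c) (locally_integrable_itv mf fi); apply: filterS.
  exact: (ae_filter_ringOfSetsType (@lebesgue_measure R)).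
move=> x Hx cx xd.
have [|_ <-] := Hx; first by rewrite /= lte_fin.
(* The integrals are known to vanish only when they start strictly to the right of [c], hence the
   comparison with the value at a midpoint. *)
pose m := (c + x) / 2.
have mx : m < x by rewrite /m; lra.
have cm : c < m by rewrite /m; lra.
rewrite derive1E.
have E : \forall y \near x, Rintegral lam `[c, y] f = cst (Rintegral lam `[c, m] f) y.
  have : \forall y \near x, m < y < d.
    near=> y; apply/andP; split; near: y; [exact: lt_nbhsr|exact: lt_nbhsl].
  apply: filterS => y /andP[my yd] /=.
  by rewrite (Rintegral_itv_split (ltW cm) (ltW my))// (f0 m y)// addr0.
by rewrite (@near_eq_derive R R R _ _ x 1 E) derive_cst.
Unshelve. all: by end_near. Qed.

End Support.

(** * Support of [psi]; the Poisson kernel as a Fourier transform *)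

Section Inversion.
Variable R : realType.
Local Notation T := (measurableTypeR R).
Local Notation lam := (@leb R).

Lemma sqint_itv_cintegrable (f : T -> R[i]) (a b : R) : sqint f -> cintegrable lam `[a, b] f.
Proof.
move=> [mf if2]; have mD : @measurable _ T `[a, b] by exact: measurable_itvT.
apply: (le_cintegrable (h := fun x : T => cabs (f x) ^+ 2 + 1)) => //.
- exact: cmeas_itvT.
- move=> x _; have := mul_le_half_sqr (cabs (f x)) 1 ltr01.
  by rewrite mulr1 divr1 mul1r expr1n.
- have := integrableD mD (integrableS measurableT mD (@subsetT _ _) if2) (integrable_itv_cst a b 1).
  exact.
Qed.

Section PsiSupport.
Variables (t : R) (k : R[i] -> R[i]) (psi : R -> R[i]).
Hypotheses (t0 : 0 < t) (ek : centire k) (typek : exp_type_le t k).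
Hypotheses (k2 : sqint (onR k : T -> R[i])) (Hpsi : L2_fourier (onR k) psi).

Lemma psi_ae_eq0 : {ae lam, forall x : T, ~ (`[- t, t]%classic x) -> psi x = 0}.
Proof.
have psi2 : sqint psi by apply/sqintP; case: Hpsi.
(* [p] is the real or the imaginary part; the differentiation lemma concerns real functions. *)
have H (p : R[i] -> R) :
    (forall a b : R, Rintegral lam `[a, b] (fun x => p (psi x)) = p (CInt lam `[a, b] psi)) ->
    p 0 = 0 -> measurable_fun (setT : set T) (fun x => p (psi x)) ->
    (forall a b : R, lam.-integrable `[a, b] (EFin \o (fun x => p (psi x)))) ->
    {ae lam, forall x : T, ~ (`[- t, t]%classic x) -> p (psi x) = 0}.
  move=> pC p0 mp ip.
  (* Each half line is exhausted by countably many bounded windows, because the differentiation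
     lemma takes real end points. *)
  have H1 n : {ae lam, forall x : T, t < x -> x < n%:R -> p (psi x) = 0}.
    apply: (@ae_eq0_of_integrals R (fun x => p (psi x)) t n%:R) => // a b ta ab _.
    by rewrite pC (CInt_psi_itv_eq0 t0 ek typek k2 Hpsi ab)//; left.
  have H2 n : {ae lam, forall x : T, - n%:R < x -> x < - t -> p (psi x) = 0}.
    apply: (@ae_eq0_of_integrals R (fun x => p (psi x)) (- n%:R) (- t)) => // a b _ ab bt.
    by rewrite pC (CInt_psi_itv_eq0 t0 ek typek k2 Hpsi ab)//; right.
  apply: filterS2 (ae_foralln H1) (ae_foralln H2) => x h1 h2.
  pose n := (Num.truncn `|x|).+1.
  have xn : `|x| < n%:R by exact: truncnS_gt.
  move: xn; rewrite ltr_norml => /andP[xn1 xn2].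
  rewrite /= in_itv/= => /negP; rewrite negb_and -!ltNge => /orP[xt|tx].
    exact: (h2 n).
  exact: (h1 n).
have [m1 m2] := psi2.1.
have HR := H (@complex.Re R) (fun a b => esym (Re_CInt _ _ _)) erefl m1
  (fun a b => (sqint_itv_cintegrable a b psi2).1).
have HI := H (@complex.Im R) (fun a b => esym (Im_CInt _ _ _)) erefl m2
  (fun a b => (sqint_itv_cintegrable a b psi2).2).
apply: filterS2 HR HI => x h1 h2 xt.
by apply: complex_ext; [exact: h1|exact: h2].
Qed.

End PsiSupport.

(** 2 pi times the Poisson kernel of the half plane, so of total mass 2 pi: the value of [fourier]
    on e^{-e|x|}. *)
Definition poisson (e : R) (x : R) : R := 2 * e / (e ^+ 2 + x ^+ 2).

Lemma poisson_denom_gt0 (e x : R) : 0 < e -> 0 < e ^+ 2 + x ^+ 2.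
Proof. by move=> e0; rewrite ltr_wpDr ?sqr_ge0// exprn_gt0. Qed.

Lemma poisson_ge0 (e x : R) : 0 < e -> 0 <= poisson e x.
Proof. by move=> e0; rewrite divr_ge0 ?mulr_ge0 ?ltW// poisson_denom_gt0. Qed.

Lemma continuous_poisson (e : R) : 0 < e -> continuous (poisson e).
Proof.
move=> e0 x; apply: cvgM; first exact: cvg_cst.
apply: cvgV; first by rewrite gt_eqF// poisson_denom_gt0.
by apply: cvgD; [exact: cvg_cst|exact: exprn_continuous].
Qed.

Lemma integral_poisson (e : R) : 0 < e ->
  (\int[lam]_x (poisson e x)%:E = (2 * pi)%:E)%E.
Proof.
move=> e0.
have dF (x : R) : is_derive x 1 (fun y : R => 2 * atan (e^-1 * y)) (poisson e x).
  have dlin : is_derive x 1 (fun y : R => e^-1 * y) e^-1.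
    by have := is_deriveZ e^-1 (is_derive_id x (1 : R)); rewrite /GRing.scale/= mulr1.
  have := is_deriveZ 2 (is_derive1_comp (is_derive1_atan (e^-1 * x)) dlin).
  move=> /is_derive_eq; apply; rewrite /GRing.scale/= /poisson; field.
  by rewrite !gt_eqF// poisson_denom_gt0.
have cF : continuous (fun y : R => 2 * atan (e^-1 * y)).
  by move=> x; apply: differentiable_continuous; apply/derivable1_diffP; have [] := dF x.
rewrite (ge0_symfun_integralT (f := poisson e)).
- rewrite -set_itvcy (@ge0_continuous_FTC2y _ _ (fun y : R => 2 * atan (e^-1 * y)) 0 pi).
  + by rewrite mulr0 atan0 mulr0 sube0 -EFinM.
  + by move=> x _; exact: poisson_ge0.
  + by apply: continuous_subspaceT; exact: continuous_poisson.
  + rewrite [X in _ --> X](_ : _ = 2 * (pi / 2)); last by field.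
    apply: cvgM; first exact: cvg_cst.
    apply: (cvg_comp _ _ _ (@cvgy_atan R)).
    apply/cvgryPge => A; near=> x; rewrite ler_pdivlMl//; near: x.
  + by move=> x _; have [] := dF x.
  + by apply: cvg_at_right_filter; exact: cF.
  + by move=> x _; rewrite derive1E; have [] := dF x.
- by move=> x; exact: poisson_ge0.
- exact: continuous_poisson.
- by move=> x; rewrite /poisson /= sqrrN.
Unshelve. all: by end_near. Qed.

Lemma integrable_poisson (e : R) : 0 < e -> lam.-integrable setT (EFin \o (poisson e : T -> R)).
Proof.
move=> e0; apply/integrableP; split.
  by apply/measurable_EFinP; apply: continuous_measurable_fun; exact: continuous_poisson.
have -> : (\int[lam]_x `|(EFin \o (poisson e : T -> R)) x| = \int[lam]_x (poisson e x)%:E)%E.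
  by apply: eq_integral => x _ /=; rewrite ger0_norm// poisson_ge0.
by rewrite integral_poisson// ltry.
Qed.

Lemma laplace_cexp (w : R[i]) : 0 < complex.Re w ->
  CInt lam `]0, +oo[ (fun y : R => cexp (- w * y%:C)) = w^-1.
Proof.
move=> w0; set r := complex.Re w in w0; pose s := complex.Im w.
have wn0 : w != 0 by apply/negP => /eqP w00; move: w0; rewrite /r w00 ltxx.
have cE : ccont (fun y : R => cexp (- w * y%:C)).
  apply: ccont_comp; first exact: centire_cexp.
  by apply: ccontM; [exact: ccont_cst|apply: ccont_real => x; exact: cvg_id].
have absE (y : R) : cabs (cexp (- w * y%:C)) = expR (- (r * y)).
  by rewrite cabs_cexp !ReImE /= mulr0 subr0 mulNr.
have ReE (y : R) : complex.Re (cexp (- w * y%:C)) = expR (- r * y) * cos (- s * y).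
  by rewrite Re_cexp !ReImE /= !mulr0 subr0 add0r.
have ImE (y : R) : complex.Im (cexp (- w * y%:C)) = expR (- r * y) * sin (- s * y).
  by rewrite Im_cexp !ReImE /= !mulr0 subr0 add0r.
have dlin (c x : R) : is_derive x 1 (fun y : R => c * y) c.
  by have := is_deriveZ c (is_derive_id x (1 : R)); rewrite /GRing.scale/= mulr1.
have dexp (x : R) : is_derive x 1 (fun y : R => expR (- r * y)) (expR (- r * x) * - r).
  exact: (is_derive1_comp (is_derive_expR (- r * x)) (dlin (- r) x)).
have dcos (x : R) : is_derive x 1 (fun y : R => cos (- s * y)) (- sin (- s * x) * - s).
  exact: (is_derive1_comp (is_derive_cos (- s * x)) (dlin (- s) x)).
have dsin (x : R) : is_derive x 1 (fun y : R => sin (- s * y)) (cos (- s * x) * - s).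
  exact: (is_derive1_comp (is_derive_sin (- s * x)) (dlin (- s) x)).
have cf : ccont (fun y : R => - w * cexp (- w * y%:C)) by apply: ccontM => //; exact: ccont_cst.
have d1 (x : R) : is_derive x 1 (fun y : R => complex.Re (cexp (- w * y%:C)))
    (complex.Re (- w * cexp (- w * x%:C))).
  have -> : (fun y : R => complex.Re (cexp (- w * y%:C))) =
      (fun y : R => expR (- r * y)) * (fun y : R => cos (- s * y)).
    by apply/funext => y; rewrite ReE.
  apply: is_derive_eq (is_deriveM (dexp x) (dcos x)) _.
  by rewrite ReM ReE ImE ReN ImN -/r -/s /GRing.scale/=; ring.
have d2 (x : R) : is_derive x 1 (fun y : R => complex.Im (cexp (- w * y%:C)))
    (complex.Im (- w * cexp (- w * x%:C))).
  have -> : (fun y : R => complex.Im (cexp (- w * y%:C))) =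
      (fun y : R => expR (- r * y)) * (fun y : R => sin (- s * y)).
    by apply/funext => y; rewrite ImE.
  apply: is_derive_eq (is_deriveM (dexp x) (dsin x)) _.
  by rewrite ImM ReE ImE ReN ImN -/r -/s /GRing.scale/=; ring.
have I n : CInt lam `[0, n.+1%:R] (fun y : R => cexp (- w * y%:C)) =
    w^-1 * (1 - cexp (- w * n.+1%:R%:C)).
  have := CInt_FTC (ltr0Sn R n) d1 d2 cf.
  rewrite CIntZ//; last exact: ccont_cintegrable.
  rewrite mulr0 cexp0 => E; rewrite -[1 - _]opprB -E; field; exact: wn0.
have lim1 : ccvg (fun n => CInt lam `[0, n.+1%:R] (fun y : R => cexp (- w * y%:C))) w^-1.
  have -> : (fun n => CInt lam `[0, n.+1%:R] (fun y : R => cexp (- w * y%:C))) =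
    (fun n => w^-1 * (1 - cexp (- w * n.+1%:R%:C))) by apply/funext => n; exact: I.
  rewrite -[X in ccvg _ X]mulr1; apply: ccvgZ.
  apply: (@ccvg_le _ _ _ (fun n => r^-1 * n.+1%:R^-1)); last first.
    rewrite -[X in _ --> X](mulr0 r^-1); apply: cvgM; first exact: cvg_cst.
    exact: cvg_harmonic.
  move=> n; have -> : 1 - cexp (- w * n.+1%:R%:C) - 1 = - cexp (- w * n.+1%:R%:C) by ring.
  rewrite cabsN absE expRN -invfM lef_pV2 ?posrE ?expR_gt0 ?mulr_gt0//.
  by have := expR_ge1Dx (r * n.+1%:R); lra.
apply: ccvg_unique lim1.
have -> : (fun n => CInt lam `[0, n.+1%:R] (fun y : R => cexp (- w * y%:C))) =
    (fun n => CInt lam setT (fun y : T => if y \in `[0, n.+1%:R]%classic then cexp (- w * y%:C) else 0)).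
  by apply/funext => n; rewrite CInt_restrict.
rewrite (CInt_restrict _ `]0, +oo[).
have mE : cmeas setT (fun y : T => cexp (- w * y%:C)) by exact: ccont_cmeas.
apply: (@CInt_dominated_cvg _ _ _ _ _ (fun y : T => expR (- (r * `|y|)))) => //.
- by move=> n; apply: cmeas_restrict; [exact: measurable_itvT|exact: cmeas_itvT].
- by apply: cmeas_restrict; [exact: measurable_itvT|exact: cmeas_itvT].
(* The closed intervals contain 0 and the open half line does not, so pointwise convergence fails at
   0 alone. *)
- apply: filterS (ae_neq 0) => y y0 _.
  apply: (@ccvg_le_near _ _ _ (fun _ => 0)); last exact: cvg_cst.
  exists (Num.truncn `|y|) => // n /= mn.
  have hy : `|y| <= n.+1%:R by rewrite ltW// (lt_le_trans (truncnS_gt _))// ler_nat ltnS.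
  rewrite mem_itv_cc mem_itv_oy; have [yp|yn|] := ltrgtP 0 y; last by move=> e; case: y0.
    by rewrite (le_trans (ler_norm _) hy) subrr cabs0.
  by rewrite subrr cabs0.
- exact: integrable_expRN.
- move=> n y _; rewrite mem_itv_cc; case: ifP => [/andP[y0 _]|_].
    by rewrite absE ger0_norm.
  by rewrite cabs0 expR_ge0.
Qed.

Definition expabs (e : R) (x : T) : R[i] := (expR (- (e * `|x|)))%:C.

Lemma cabs_expabs (e : R) x : cabs (expabs e x) = expR (- (e * `|x|)).
Proof. by rewrite cabs_real ger0_norm// expR_ge0. Qed.

Lemma cintegrable_expabs (e : R) : 0 < e -> cintegrable lam setT (expabs e).
Proof.
move=> e0; have ie := integrable_expRN e0.
apply: (le_cintegrable measurableT _ _ ie).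
  apply: cmeas_real; apply/measurable_EFinP; exact: (integrableP _ _ _ ie).1.
by move=> x _; rewrite cabs_expabs.
Qed.

(** Each half line is a Laplace integral; 1/(e + ix) and 1/(e - ix) add up to 2e/(e^2 + x^2). *)
Lemma fourier_expabs (e x : R) : 0 < e -> fourier (expabs e) x = (poisson e x)%:C.
Proof.
move=> e0; have ie := cintegrable_expabs e0.
rewrite /fourier CInt_reflect; last exact: cintegrable_cexpmM.
have E1 : CInt lam `]0, +oo[ (fun y : T => cexpm x y * expabs e y) = (e +i* x)^-1.
  rewrite -laplace_cexp//; apply: eq_CInt => y; rewrite /= in_itv/= andbT => y0.
  rewrite /expabs gtr0_norm// -cexp_real cexpm_cexp -cexpD; congr cexp.
  by apply: complex_ext; rewrite !ReImE /=; ring.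
have E2 : CInt lam `]0, +oo[ (fun y : T => cexpm x (- y) * expabs e (- y)) = (e +i* (- x))^-1.
  rewrite -laplace_cexp//; apply: eq_CInt => y; rewrite /= in_itv/= andbT => y0.
  rewrite /expabs normrN gtr0_norm// -cexp_real cexpm_cexp -cexpD; congr cexp.
  by apply: complex_ext; rewrite !ReImE /=; ring.
rewrite E1 E2 /poisson.
apply: complex_ext; rewrite ?ReD ?ImD /= sqrrN; field;
  by rewrite gt_eqF// poisson_denom_gt0.
Qed.

End Inversion.

(** * Abel summation and pointwise inversion *)

Section PoissonLimit.
Variable R : realType.
Local Notation T := (measurableTypeR R).
Local Notation lam := (@leb R).

Lemma poisson_cvg0 (x : R) : x <> 0 -> (fun n => poisson n.+1%:R^-1 x) @ \oo --> (0 : R).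
Proof.
move=> /eqP x0; have x2 : 0 < x ^+ 2 by rewrite exprn_even_gt0.
have H : (fun n => 2 / x ^+ 2 * n.+1%:R^-1) @ \oo --> (0 : R).
  rewrite -[X in _ --> X](mulr0 (2 / x ^+ 2)); apply: cvgM; first exact: cvg_cst.
  exact: cvg_harmonic.
apply: (squeeze_cvgr _ (cvg_cst 0) H); near=> n.
have e0 : 0 < (n.+1%:R : R)^-1 by rewrite invr_gt0.
rewrite poisson_ge0//= /poisson mulrAC ler_wpM2r ?(ltW e0)//.
by rewrite ler_wpM2l// lef_pV2 ?posrE// ?poisson_denom_gt0// lerDr sqr_ge0.
Unshelve. all: by end_near. Qed.

(** [K] is only square integrable, so one integrable bound, valid for all n, is built for (K - K(0))
    times the kernel. Near 0 the Lipschitz bound meets |x| times the kernel, at most 1 because 2 e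
    |x| <= e^2 + x^2. Away from 0 the kernel is O(1/(1 + x^2)), and the product of |K| with 1/(1 +
    x^2) is at most |K|^2 + 1/(1 + x^2). *)
Lemma poisson_limit (K : R -> R[i]) (d L : R) : ccont K -> sqint (K : T -> R[i]) ->
  0 < d -> 0 <= L -> (forall x, `|x| < d -> cabs (K x - K 0) <= L * `|x|) ->
  ccvg (fun n => CInt lam setT (fun x : T => K x * (poisson n.+1%:R^-1 x)%:C))
    (K 0 * (2 * pi)%:C).
Proof.
move=> cK K2 d0 L0 lipK.
have e0 n : 0 < (n.+1%:R : R)^-1 by rewrite invr_gt0.
have e1 n : (n.+1%:R : R)^-1 <= 1 by rewrite invf_le1// ler1n.
(* For e <= 1, [A] bounds (1 + x^2) times the kernel where |x| >= d; [B] bounds L (1 + x^2) where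
   |x| < d. *)
pose A := 2 * (1 + (d ^+ 2)^-1); pose B := L * (1 + d ^+ 2).
have d20 : 0 < d ^+ 2 by rewrite exprn_gt0.
have A0 : 0 <= A by rewrite mulr_ge0// addr_ge0// invr_ge0 ltW.
have B0 : 0 <= B by rewrite mulr_ge0// addr_ge0// ltW.
pose C := A + A * cabs (K 0) + B.
have C0 : 0 <= C by rewrite !addr_ge0// mulr_ge0// cabs_ge0.
pose g (x : T) := A * cabs (K x) ^+ 2 + C * (oneDsqr x)^-1.
have ig : lam.-integrable setT (EFin \o g).
  by apply: integrableDT; apply: integrableZT; [exact: K2.2|exact: integrable_oneDsqrV].
have mP n : cmeas setT (fun x : T => (poisson n.+1%:R^-1 x)%:C).
  apply: cmeas_real; apply: continuous_measurable_fun; exact: continuous_poisson.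
have mdiff n : cmeas setT (fun x : T => (K x - K 0) * (poisson n.+1%:R^-1 x)%:C).
  by apply: cmeasM => //; apply: cmeasB; [exact: K2.1|exact: cmeas_cst].
have bound n x : cabs ((K x - K 0) * (poisson n.+1%:R^-1 x)%:C) <= g x.
  set e := n.+1%:R^-1; have P0 := poisson_ge0 x (e0 n).
  rewrite cabsM cabs_real ger0_norm// /g.
  have o0 := oneDsqr_pos x.
  have oi0 : 0 <= (oneDsqr x)^-1 by rewrite invr_ge0 ltW.
  have oi1 : (oneDsqr x)^-1 <= 1 by rewrite invf_le1// oneDsqr_ge1.
  have sq0 : 0 <= A * cabs (K x) ^+ 2 by rewrite mulr_ge0// sqr_ge0.
  have x2 : `|x| ^+ 2 = x ^+ 2 by rewrite real_normK// num_real.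
  have den := poisson_denom_gt0 x (e0 n).
  have [xd|xd] := ltP `|x| d.
    apply: (@le_trans _ _ (B * (oneDsqr x)^-1)); last first.
      by rewrite ler_wpDl// ler_wpM2r// /C lerDr addr_ge0// mulr_ge0// cabs_ge0.
    apply: (@le_trans _ _ L).
      apply: (@le_trans _ _ (L * `|x| * poisson e x)); first by rewrite ler_wpM2r// lipK.
      rewrite -mulrA -[leRHS]mulr1 ler_wpM2l// /poisson mulrA ler_pdivrMr// mul1r -x2.
      by have := sqr_ge0 (e - `|x|); rewrite sqrrB; move: (e ^+ 2) (`|x| ^+ 2) => u v; lra.
    rewrite ler_pdivlMr// ler_wpM2l// /oneDsqr lerD2l -x2 lerXn2r ?nnegrE ?(ltW d0)// ltW//.
  have xx : d ^+ 2 <= x ^+ 2 by rewrite -x2 lerXn2r ?nnegrE// ltW.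
  have PA : poisson e x <= A * (oneDsqr x)^-1.
    rewrite ler_pdivlMr// /poisson mulrAC ler_pdivrMr//.
    apply: (@le_trans _ _ (2 * oneDsqr x)).
      by rewrite -mulrA ler_wpM2l// -[leRHS]mul1r ler_wpM2r ?(ltW o0)// e1.
    rewrite /A -mulrA ler_wpM2l// /oneDsqr mulrDl mul1r.
    have h1 : 1 <= (d ^+ 2)^-1 * (e ^+ 2 + x ^+ 2).
      rewrite ler_pdivlMl// mulr1 (le_trans xx)// lerDr sqr_ge0//.
    by have := sqr_ge0 e; move: ((d ^+ 2)^-1 * _) h1 => u; lra.
  apply: (@le_trans _ _ ((cabs (K x) + cabs (K 0)) * (A * (oneDsqr x)^-1))).
    by rewrite ler_pM ?cabs_ge0// cabsB.
  have h2 : cabs (K x) * (oneDsqr x)^-1 <= cabs (K x) ^+ 2 + (oneDsqr x)^-1.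
    have := mul_le_half_sqr (cabs (K x)) (oneDsqr x)^-1 ltr01; rewrite divr1 mul1r.
    move=> /le_trans; apply; rewrite lerD2l expr2 -[leRHS]mulr1 ler_wpM2l//.
  have h3 := ler_wpM2l A0 h2.
  have h4 : 0 <= B * (oneDsqr x)^-1 by rewrite mulr_ge0.
  rewrite (_ : (cabs (K x) + cabs (K 0)) * (A * (oneDsqr x)^-1) =
    A * (cabs (K x) * (oneDsqr x)^-1) + A * cabs (K 0) * (oneDsqr x)^-1); last by ring.
  rewrite /C !mulrDl; move: h3; rewrite mulrDr.
  move: (A * (oneDsqr x)^-1) (A * (cabs (K x) * _)) (A * cabs (K x) ^+ 2) (A * cabs (K 0) * _) => u1 u2 u3 u4.
  lra.
have cvg0 : ccvg (fun n => CInt lam setT (fun x : T => (K x - K 0) * (poisson n.+1%:R^-1 x)%:C)) 0.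
  have <- : CInt lam setT (fun _ : T => 0) = 0 :> R[i].
    by rewrite (CInt_real lam setT (fun _ => 0)) /Rintegral integral0.
  apply: (@CInt_dominated_cvg _ _ _ _ _ g) => //.
  - apply: filterS (ae_neq 0) => x x0 _.
    apply: (@ccvg_le _ _ _ (fun n => cabs (K x - K 0) * poisson n.+1%:R^-1 x)).
      by move=> n; rewrite subr0 cabsM cabs_real ger0_norm// poisson_ge0.
    rewrite -[X in _ --> X](mulr0 (cabs (K x - K 0))); apply: cvgM; first exact: cvg_cst.
    exact: poisson_cvg0.
have iP n : cintegrable lam setT (fun x : T => (poisson n.+1%:R^-1 x)%:C).
  apply: (le_cintegrable measurableT _ _ (integrable_poisson (e0 n))) => //.
  by move=> x _; rewrite cabs_real ger0_norm// poisson_ge0.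
have idf n : cintegrable lam setT (fun x : T => (K x - K 0) * (poisson n.+1%:R^-1 x)%:C).
  exact: (le_cintegrable measurableT (mdiff n) (fun x _ => bound n x) ig).
have E : (fun n => CInt lam setT (fun x : T => K x * (poisson n.+1%:R^-1 x)%:C)) =
    (fun n => CInt lam setT (fun x : T => (K x - K 0) * (poisson n.+1%:R^-1 x)%:C) + K 0 * (2 * pi)%:C).
  apply/funext => n.
  have -> : K 0 * (2 * pi)%:C = CInt lam setT (fun x : T => K 0 * (poisson n.+1%:R^-1 x)%:C).
    rewrite (CIntZ (K 0) measurableT (iP n)) CInt_real.
    by rewrite /Rintegral integral_poisson.
  rewrite -(CIntD measurableT (idf n) (cintegrableZ (K 0) measurableT (iP n))).
  by apply: eq_CInt => x _; ring.
by rewrite E -[X in ccvg _ X]add0r; apply: ccvgD => //; exact: ccvg_cst.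
Qed.

Section Inversion.
Variables (t : R) (k : R[i] -> R[i]) (psi : R -> R[i]).
Hypotheses (t0 : 0 < t) (ek : centire k) (typek : exp_type_le t k).
Hypotheses (k2 : sqint (onR k : T -> R[i])) (Hpsi : L2_fourier (onR k) psi).

(** A representative of [psi] that vanishes everywhere outside the interval, hence is integrable;
    pairings can be moved to it. *)
Definition psi_trunc (x : T) : R[i] := if x \in `[- t, t]%classic then psi x else 0.

Lemma psi_sqint : sqint (psi : T -> R[i]).
Proof. by apply/sqintP; case: Hpsi. Qed.

Lemma cintegrable_psi_trunc : cintegrable lam setT psi_trunc.
Proof.
apply: cintegrable_restrict; first exact: measurable_itvT.
exact: sqint_itv_cintegrable psi_sqint.
Qed.

Lemma CInt_psi_trunc (h : T -> R[i]) : cmeas setT h ->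
  CInt lam setT (fun x => psi x * h x) = CInt lam setT (fun x => psi_trunc x * h x).
Proof.
move=> mh; apply: ae_eq_CInt => //.
- by apply: cmeasM => //; exact: psi_sqint.1.
- by apply: cmeasM => //; exact: cintegrable_cmeas cintegrable_psi_trunc.
- apply: filterS (psi_ae_eq0 t0 ek typek k2 Hpsi) => x hx _; rewrite /psi_trunc.
  have [xt|xt] := boolP (x \in `[- t, t]%classic) => //.
  by rewrite hx//; move: xt; rewrite notin_setE.
Qed.

Lemma invsqrt2pi_sq : invsqrt2pi R * invsqrt2pi R * (2 * pi)%:C = 1.
Proof.
have p0 : 0 < 2 * pi :> R by rewrite mulr_gt0// pi_gt0.
rewrite /invsqrt2pi -!rmorphM/= -invfM -expr2 sqr_sqrtr ?ltW//.
by rewrite mulVf ?gt_eqF.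
Qed.

Theorem fourier_inversion (x0 : R) :
  CInt lam setT (fun xi => psi_trunc xi * cexpm (- x0) xi) * invsqrt2pi R = k x0%:C.
Proof.
(* Translation by [x0] brings the point of evaluation to 0, where [poisson_limit] applies. *)
pose K (x : R) := k (x + x0)%:C.
have cK : ccont K.
  apply: ccont_comp => //; apply: ccont_real => x.
  by apply: cvgD; [exact: cvg_id|exact: cvg_cst].
have mt := measurable_translation x0.
have lt := @leb_translation R x0.
have K2 : sqint (K : T -> R[i]).
  split; first exact: ccont_cmeas.
  have := cintegrable_invariant mt lt (g := fun x => (cabs (onR k x) ^+ 2)%:C).
  have : cintegrable lam setT (fun x : T => (cabs (onR k x) ^+ 2)%:C).
    apply: (le_cintegrable measurableT _ _ k2.2).
      by apply: cmeas_real; apply: measurable_cabs2; exact: k2.1.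
    by move=> x _; rewrite cabs_real ger0_norm// sqr_ge0.
  by move=> i1 /(_ i1)[].
have [D hD] := ek x0%:C.
have [d d0 Hd] := cdiff_lip hD.
have K0E : K 0 = k x0%:C by rewrite /K add0r.
have L0 : 0 <= cabs D + 1 by rewrite addr_ge0// cabs_ge0.
have lipK x : `|x| < d -> cabs (K x - K 0) <= (cabs D + 1) * `|x|.
  move=> xd; have := Hd x%:C; rewrite cabs_real => /(_ xd).
  by rewrite K0E /K (_ : (x + x0)%:C = x0%:C + x%:C)//; apply: complex_ext; rewrite !ReImE /=; ring.
have lim1 := poisson_limit cK K2 d0 L0 lipK.
(* The Abel factor modulated by the frequency [- x0]; its transform is the Poisson kernel centred at
   [x0]. *)
pose h (n : nat) (xi : T) := cexpm (- x0) xi * expabs n.+1%:R^-1 xi.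
have e0 n : 0 < (n.+1%:R : R)^-1 by rewrite invr_gt0.
have ih n : cintegrable lam setT (h n) by apply: cintegrable_cexpmM; exact: cintegrable_expabs.
have habs n xi : cabs (h n xi) = expR (- (n.+1%:R^-1 * `|xi|)).
  by rewrite cabsM cabs_cexpm mul1r cabs_expabs.
have habs1 n xi : cabs (h n xi) <= 1.
  by rewrite habs expR_le1 oppr_le0 mulr_ge0// ltW.
have h2 n : sqint (h n).
  split; first exact: cintegrable_cmeas (ih n).
  apply: le_integrable (integrable_cabs measurableT (ih n)) => //.
    by apply/measurable_EFinP; apply: measurable_cabs2; exact: cintegrable_cmeas (ih n).
  move=> xi _; rewrite /= lee_fin !ger0_norm ?cabs_ge0 ?sqr_ge0//.
  by rewrite expr2 -[leRHS]mulr1 ler_wpM2l ?cabs_ge0.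
have fh n x : fourier (h n) x = (poisson n.+1%:R^-1 (x - x0))%:C.
  rewrite -fourier_expabs//; apply: eq_CInt => xi _; rewrite /h mulrA; congr (_ * _).
  rewrite !cexpmE -cexpD; congr cexp.
  by apply: complex_ext; rewrite !ReImE /=; ring.
have fh2 n : sqint (fourier (h n) : T -> R[i]).
  have -> : (fourier (h n) : T -> R[i]) = (fun x => (poisson n.+1%:R^-1 (x - x0))%:C).
    by apply/funext => x; rewrite fh.
  have ip : cintegrable lam setT (fun x : T => (poisson n.+1%:R^-1 (x - x0))%:C).
    have := cintegrable_invariant (measurable_translation (- x0)) (@leb_translation R (- x0))
      (g := fun x => (poisson n.+1%:R^-1 x)%:C).
    apply; apply: (le_cintegrable measurableT _ _ (integrable_poisson (e0 n))).
      by apply: cmeas_real; apply: continuous_measurable_fun; exact: continuous_poisson.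
    by move=> x _; rewrite cabs_real ger0_norm// poisson_ge0.
  have mp := cintegrable_cmeas ip; split => //.
  (* The kernel with parameter e is bounded by 2/e, here 2 (n + 1), so its square is at most a
     multiple of itself and is integrable. *)
  have pb (x : R) : poisson n.+1%:R^-1 x <= 2 * n.+1%:R.
    rewrite /poisson ler_pdivrMr ?poisson_denom_gt0// -mulrA ler_wpM2l// mulrDr.
    apply: (@le_trans _ _ (n.+1%:R * n.+1%:R^-1 ^+ 2)).
      by rewrite expr2 mulrA mulfV// mul1r.
    by rewrite lerDl mulr_ge0// sqr_ge0.
  have := integrableZT (2 * n.+1%:R) (integrable_cabs measurableT ip).
  apply: le_integrable => //; first by apply/measurable_EFinP; exact: measurable_cabs2.
  move=> x _; rewrite /= lee_fin [leRHS]ger0_norm ?ger0_norm ?sqr_ge0 ?mulr_ge0 ?cabs_ge0//.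
  by rewrite expr2 ler_wpM2r ?cabs_ge0// cabs_real ger0_norm ?poisson_ge0// pb.
have mul n : CInt lam setT (fun xi => psi_trunc xi * h n xi) =
    invsqrt2pi R * CInt lam setT (fun x : T => K x * (poisson n.+1%:R^-1 x)%:C).
  rewrite -CInt_psi_trunc; last exact: cintegrable_cmeas (ih n).
  rewrite (multiplication_formula (ccont_onR ek) k2 Hpsi (ih n) (h2 n) (fh2 n)); congr (_ * _).
  have := CInt_invariant mt lt (g := fun x => onR k x * fourier (h n) x).
  rewrite -/(cmeas _ _) => <-; last by apply: cmeasM; [exact: k2.1|exact: (fh2 n).1].
  by apply: eq_CInt => x _; rewrite fh /translation addrK.
have lim2 : ccvg (fun n => CInt lam setT (fun xi => psi_trunc xi * h n xi))
    (invsqrt2pi R * (K 0 * (2 * pi)%:C)).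
  by rewrite (funext mul); exact: ccvgZ.
have mpt := cintegrable_cmeas cintegrable_psi_trunc.
have lim3 : ccvg (fun n => CInt lam setT (fun xi => psi_trunc xi * h n xi))
    (CInt lam setT (fun xi => psi_trunc xi * cexpm (- x0) xi)).
  apply: (@CInt_dominated_cvg _ _ _ _ _ (fun x => cabs (psi_trunc x))) => //.
  - by move=> n; apply: cmeasM => //; exact: cintegrable_cmeas (ih n).
  - by apply: cmeasM => //; exact: cmeas_cexpmT.
  - apply: aeW => xi _.
    have lim : ccvg (fun n => expabs n.+1%:R^-1 xi) 1.
      apply: ReIm_ccvg; last by exact: cvg_cst.
      have L : (fun n => expR (- (n.+1%:R^-1 * `|xi|))) @ \oo --> expR (0 : R).
        apply: continuous_cvg; first exact: continuous_expR.
        rewrite -[X in _ --> X]oppr0; apply: cvgN; rewrite -[X in _ --> X](mul0r `|xi|).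
        by apply: cvgM; [exact: cvg_harmonic|exact: cvg_cst].
      by move: L; rewrite expR0.
    have := ccvgZ (psi_trunc xi * cexpm (- x0) xi) lim; rewrite mulr1.
    by under eq_fun do rewrite -mulrA.
  - by have := integrable_cabs measurableT cintegrable_psi_trunc.
  - by move=> n xi _; rewrite cabsM -[leRHS]mulr1 ler_wpM2l ?cabs_ge0.
rewrite (ccvg_unique lim3 lim2) K0E.
transitivity (k x0%:C * (invsqrt2pi R * invsqrt2pi R * (2 * pi)%:C)); last first.
  by rewrite invsqrt2pi_sq mulr1.
by move: (k _) (invsqrt2pi R) ((2 * pi)%:C) => a b c; ring.
Qed.

End Inversion.
End PoissonLimit.

(** * Test functions and the pairing with the transform of the measure *)

Section Pairing.
Variable R : realType.
Local Notation T := (measurableTypeR R).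
Local Notation lam := (@leb R).

Lemma ccont_bounded (g : R -> R[i]) (a b : R) : ccont g ->
  exists2 M, 0 <= M & forall x, a <= x <= b -> cabs (g x) <= M.
Proof.
move=> /ccont_ReIm[h1 h2]; have [ab|ba] := leP a b; last first.
  by exists 0 => // x /andP[ax xb]; have := lt_le_trans ba (le_trans ax xb); rewrite ltxx.
have bd (h : R -> R) : continuous h -> exists M, forall x, a <= x <= b -> `|h x| <= M.
  move=> ch; have [|c _ H] := @EVT_max R (fun x => `|h x|) a b ab.
    by apply: continuous_subspaceT => x; apply: cvg_norm; exact: ch.
  by exists `|h c| => x xab; apply: H; rewrite in_itv.
have [M1 H1] := bd _ h1; have [M2 H2] := bd _ h2.
have aab : a <= a <= b by rewrite lexx.
exists (M1 + M2).
  by rewrite addr_ge0// (le_trans (normr_ge0 _) (H1 _ aab), le_trans (normr_ge0 _) (H2 _ aab)).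
by move=> x xab; rewrite (le_trans (cabs_le_ReIm _))// lerD ?H1 ?H2.
Qed.

Section TestFunction.
Variables (t : R) (phi : R -> R[i]).
Hypotheses (t0 : 0 < t) (tphi : test_fun_in t phi).

(** The radius in [test_fun_in] may be negative. Raising it to at least t/2 makes the interval
    [-a, a] nondegenerate and keeps it inside (-t, t). *)
Lemma test_fun_support : exists a, [/\ 0 < a, a < t & forall x, a < `|x| -> phi x = 0].
Proof.
have [_ [_ [a [at_ Ha]]]] := tphi; exists (Num.max a (t / 2)); split.
- by rewrite lt_max divr_gt0// orbT.
- by rewrite gt_max at_/= ltr_pdivrMr// ltr_pMr// ltr1n.
- by move=> x; rewrite gt_max => /andP[/Ha].
Qed.

Let phi' (x : R) : R[i] :=
  ((fun y => complex.Re (phi y))^`() x) +i* ((fun y => complex.Im (phi y))^`() x).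

Lemma smooth_is_derive (h : R -> R) (x : R) : smoothR h -> is_derive x 1 h (h^`() x).
Proof. by move=> /(_ 0%N x) dh; rewrite derive1E; exact: DeriveDef. Qed.

Lemma smooth_continuous (h : R -> R) : smoothR h -> continuous h.
Proof.
move=> H x; apply: differentiable_continuous; apply/derivable1_diffP; exact: (H 0%N x).
Qed.

Lemma smooth_derive (h : R -> R) : smoothR h -> smoothR h^`().
Proof. by move=> H n x; have := H n.+1 x; rewrite /derive1n iterSr. Qed.

Lemma test_fun_ccont : ccont phi.
Proof. by case: tphi => /smooth_continuous h1 [/smooth_continuous h2 _]; exact: ReIm_ccont h1 h2. Qed.

Lemma test_fun_sqint (a b : R) : a < b -> sqint (fun x : T => fourier_ext phi a b x%:C).
Proof.
case: tphi => h1 [h2 _] ab; apply: (@fourier_ext_sqint R phi a b test_fun_ccont phi' ab).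
- have c1 := smooth_continuous (smooth_derive h1).
  have c2 := smooth_continuous (smooth_derive h2).
  by apply: ReIm_ccont => x; [exact: c1|exact: c2].
- by move=> x; exact: smooth_is_derive.
- by move=> x; exact: smooth_is_derive.
Qed.

(** The type is read off from the support, and smoothness gives decay of order 1/|x| on the line,
    hence square integrability; the two conjugations preserve moduli and holomorphy. *)
Lemma PW_conj_fourier_ext (a : R) : 0 < a -> a <= t ->
  PW t (fun z => conjc (fourier_ext phi (- a) a (conjc z))).
Proof.
move=> a0 a_t; have aa : - a < a by rewrite gtrN.
have cphi := test_fun_ccont.
split; first by apply/entireP; apply: centire_conj; exact: (centire_fourier_ext _ _ cphi).
split=> [e e0|].
  have at1 : `|a| <= t + e by rewrite gtr0_norm// (le_trans a_t)// lerDl ltW.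
  have at2 : `|- a| <= t + e by rewrite normrN.
  have H := fourier_ext_exp_type cphi at2 at1.
  by eexists => z; rewrite cabsJ -(cabsJ z); exact: H.
apply/sqintP; have [m i] := test_fun_sqint aa.
have E (x : R) : onR (fun z => conjc (fourier_ext phi (- a) a (conjc z))) x
    = conjc (fourier_ext phi (- a) a x%:C).
  by rewrite /onR conjc_real.
split.
  have := cmeasJ m; congr (cmeas _ _); apply/funext => x; exact/esym/E.
by move: i; congr (_.-integrable _ _); apply/funext => x /=; rewrite E cabsJ.
Qed.

Lemma test_fun_trunc (a : R) : (forall x, a < `|x| -> phi x = 0) ->
  (fun s => if s \in `[- a, a]%classic then phi s else 0) = phi.
Proof.
move=> H; apply/funext => s; rewrite mem_itv_cc; case: ifPn => // /negP h; rewrite H//.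
by rewrite ltNge; apply/negP; rewrite ler_norml.
Qed.

Lemma cintegrable_test_fun : cintegrable lam setT phi.
Proof.
have [a [_ _ H]] := test_fun_support; rewrite -(test_fun_trunc H).
apply: cintegrable_restrict; first exact: measurable_itvT.
by apply: ccont_cintegrable; exact: test_fun_ccont.
Qed.

(** Substituting x + y for x separates the double integral: the x integral is the transform of [phi]
    times e^{i xi y}. The plus sign, due to the reflection of [psi], makes the remaining y integral
    the inversion formula for [k] at [xi]. *)
Lemma FT_conv_refl (k : R[i] -> R[i]) (psi : R -> R[i]) (xi : R) : centire k ->
  exp_type_le t k -> sqint (onR k : T -> R[i]) -> L2_fourier (onR k) psi ->
  FT (conv_refl psi phi) xi = fourier phi xi * k xi%:C.
Proof.
move=> ek typek k2 Hpsi.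
have cphi := test_fun_ccont; have mphi := ccont_cmeas cphi.
have ips := cintegrable_psi_trunc t Hpsi.
have mps := cintegrable_cmeas ips.
have [a [a0 a_t Ha]] := test_fun_support.
have [M M0 HM] := ccont_bounded (- a) a cphi.
have phiM x : cabs (phi x) <= M.
  have [xa|xa] := leP `|x| a; first by rewrite HM// -ler_norml.
  by rewrite Ha// cabs0.
(* [F] is nonzero only if |y| <= t and |x + y| <= a, hence |x| <= a + t. The cut-off [ind] at this
   radius makes the bound integrable in x, as Fubini requires. *)
pose F (p : T * T) := cexpm xi p.1 * (psi_trunc t psi p.2 * phi (p.1 + p.2)).
pose B := a + t; pose ind (x : T) := if x \in `[- B, B]%classic then M else 0.
have iM : lam.-integrable setT (EFin \o ind).
  have := cintegrable_restrict (measurable_itvT _)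
    (ccont_cintegrable (- B) B (ccont_cst (M%:C : R[i]))).
  by move=> [+ _]; congr (_.-integrable _ _); apply/funext => x /=; rewrite /ind; case: ifP.
have mF : cmeas setT F.
  apply: cmeasM; first by apply: cmeas_cexpm; [exact: measurable_cst|exact: measurable_fst].
  apply: cmeasM; first by apply: (cmeas_comp (h := snd)) => //; exact: measurable_snd.
  apply: (cmeas_comp (h := fun p : T * T => (p.1 + p.2 : T))) => //.
  by apply: measurable_funD; [exact: measurable_fst|exact: measurable_snd].
have Fb p : cabs (F p) <= ind p.1 * cabs (psi_trunc t psi p.2).
  case: p => x y; rewrite /F /= !cabsM cabs_cexpm mul1r mulrC.
  have i0 : 0 <= ind x by rewrite /ind; case: ifP.
  have [yt|yt] := boolP (y \in `[- t, t]%classic); last first.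
    by rewrite /psi_trunc (negbTE yt) cabs0 !mulr0.
  have [xya|xya] := ltP a `|x + y|.
    by rewrite Ha// cabs0 mul0r mulr_ge0// cabs_ge0.
  rewrite ler_wpM2r ?cabs_ge0// /ind ifT// mem_itv_cc.
  move: yt xya; rewrite mem_itv_cc ler_norml /B => /andP[y1 y2] /andP[y3 y4].
  by apply/andP; split; lra.
have inner (y : T) : CInt lam setT (fun x : T => F (x, y)) =
    fourier phi xi * (psi_trunc t psi y * cexpm (- xi) y).
  pose g (x : T) := (psi_trunc t psi y * cexpm (- xi) y) * (cexpm xi x * phi x).
  have ig := cintegrable_cexpmM xi cintegrable_test_fun.
  rewrite [RHS]mulrC -(CIntZ (psi_trunc t psi y * cexpm (- xi) y) measurableT ig) -/g.
  have mg : cmeas setT g by apply: cmeasM; [exact: cmeas_cst|exact: cintegrable_cmeas ig].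
  rewrite -(CInt_invariant (measurable_translation y) (@leb_translation R y) mg).
  apply: eq_CInt => x _; rewrite /g /F /translation /=.
  have -> : cexpm xi x = cexpm (- xi) y * cexpm xi (x + y).
    rewrite !cexpmE -cexpD; congr cexp.
    by apply: complex_ext; rewrite !ReImE /=; ring.
  by move: (cexpm _ _) (cexpm _ _) (phi _) (psi_trunc _ _ _) => u v w s; ring.
have ich : cintegrable lam setT (fun y => psi_trunc t psi y * cexpm (- xi) y).
  have := cintegrable_cexpmM (- xi) ips.
  by apply: eq_cintegrable => // y _; rewrite mulrC.
rewrite -(fourier_inversion t0 ek typek k2 Hpsi xi) mulrA mulrC.
rewrite /FT /FT_on; congr (_ * _).
rewrite -(CIntZ (fourier phi xi) measurableT ich).
have iabs := integrable_cabs measurableT ips.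
transitivity (CInt lam setT (fun x : T => CInt lam setT (fun y : T => F (x, y)))); last first.
  by rewrite (CInt_fubini iM iabs mF Fb); apply: eq_CInt => y _; exact: inner.
apply: eq_CInt => x _; rewrite /conv_refl.
have mpx : cmeas setT (fun y : T => phi (x + y)).
  apply: (cmeas_comp (h := fun y : T => (x + y : T))) => //.
  by apply: measurable_funD; [exact: measurable_cst|exact: measurable_id].
rewrite (CInt_psi_trunc t0 ek typek k2 Hpsi mpx) /F.
have ipx : cintegrable lam setT (fun y : T => psi_trunc t psi y * phi (x + y)).
  apply: (le_cintegrable (h := fun y => M * cabs (psi_trunc t psi y))) => //.
  - exact: cmeasM.
  - by move=> y _; rewrite cabsM mulrC ler_wpM2r ?cabs_ge0.
  - by have := integrableZT M iabs.
by rewrite -(CIntZ (cexpm xi x) measurableT ipx).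
Qed.

End TestFunction.
End Pairing.

(** * Assembly of the three claims *)

Theorem mainTheorem13 (R : realType)
  (mu : {measure set (measurableTypeR R) -> \bar R}) (t : R)
  (k : R[i] -> R[i]) (psi : R -> R[i]) :
  PW_sampling mu -> 0 < t ->
  repr_kernel0 mu t k ->
  L2_fourier (onR k) psi ->
  {ae @leb R, forall x : R, ~ (`[- t, t] x) -> psi x = 0} /\
  (forall phi : R -> R[i], test_fun_in t phi ->
     pair_conv_FTmeasure mu psi phi = CInt (@leb R) setT phi) /\
  k 0 = invsqrt2pi R * CInt (@leb R) setT psi.
Proof.
move=> _ t0 [[/entireP ek [typek /sqintP k2]] Hk] Hpsi.
split; first exact: psi_ae_eq0 ek typek k2 Hpsi.
have cexpm0 (x y : R) : x = 0 -> cexpm x y = 1.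
  by move=> ->; rewrite /cexpm mul0r cos0 sin0 oppr0.
split=> [phi tphi|].
  have [a [a0 a_t Ha]] := test_fun_support t0 tphi.
  have qE x : fourier_ext phi (- a) a x%:C = fourier phi x.
    by rewrite fourier_ext_real (test_fun_trunc Ha).
  have H := Hk _ (PW_conj_fourier_ext tphi a0 (ltW a_t)).
  (* At frequency 0 the exponential is 1, so the integral of [phi] is the value at 0 of the entire
     function whose reflection is fed to the reproducing kernel. *)
  transitivity (fourier phi 0); last first.
    by apply: eq_CInt => x _; rewrite cexpm0// mul1r.
  rewrite -(qE 0) /pair_conv_FTmeasure.
  have c0 : conjc (0 : R[i]) = 0 by apply: complex_ext; rewrite !ReImE /= ?oppr0.
  rewrite c0 in H.
  rewrite -[RHS]conjcK H -CInt_conj; apply: eq_CInt => x _.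
  rewrite (FT_conv_refl t0 tphi x ek typek k2 Hpsi) -qE /onR.
  rewrite [RHS]rmorphM; congr (_ * _); last exact/esym/conjcK.
  by rewrite [RHS]conjcK conjc_real.
rewrite -[0 : R[i]]/(0 : R)%:C -(fourier_inversion t0 ek typek k2 Hpsi 0) [LHS]mulrC.
congr (_ * _).
have := CInt_psi_trunc t0 ek typek k2 Hpsi (@cmeas_cst R _ _ setT 1).
have -> : (fun x => psi x * 1) = psi by apply/funext => x; rewrite mulr1.
by move=> ->; apply: eq_CInt => x _; rewrite cexpm0 ?oppr0.
Qed.
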